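(* The generalized polygamma function $\psi(z,q)$ satisfies $$\frac{\partial}{\partial q}\psi(z,q)=\psi(z+1,q)$$ and $$\psi(m,q)=\psi^{(m)}(q),\qquad m\in\mathbb{N}=\{1,2,3,\ldots\},$$ where $\psi^{(m)}(q)=\frac{d^m}{dq^m}\psi(q)$ is the polygamma function and $\psi(q)=\frac{d}{dq}\log\Gamma(q)$ is the digamma function.
   Context: The Hurwitz zeta function is defined by $\zeta(z,q)=\sum_{n=0}^{\infty}\frac{1}{(n+q)^{z}}$ for $z\in\mathbb{C}$, $\mathrm{Re}\,z>1$ and $q\neq 0,-1,-2,\ldots$, and is continued meromorphically in $z$ to the whole complex plane, its only singularity being a simple pole at $z=1$ with residue $1$. $\Gamma$ is the gamma function and $\gamma$ is Euler's constant. The generalized polygamma function is defined by $$\psi(z,q):=e^{-\gamma z}\frac{\partial}{\partial z}\left[e^{\gamma z}\frac{\zeta(z+1,q)}{\Gamma(-z)}\right],$$ where $z\in\mathbb{C}$ and $q\in\mathbb{C}$, $q\notin\{0,-1,-2,\ldots\}$; at $z=m\in\mathbb{N}$, where $\Gamma(-z)$ has a pole, and at $z=0$, where both $\Gamma(-z)$ and $\zeta(z+1,q)$ have poles, it is defined by the corresponding limiting values.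
   Formalization: The English leaves the branch of (n+q)^z open; here it is any branch cut along a ray of angle θ, 0<θ<2π, and the q-derivative identity is stated for q with no n+q on the cut (it fails there in general); each q not in {0,-1,-2,...} satisfies this for some θ. *)

(* Defs.v *)
From Stdlib Require Import Reals Lra Factorial ClassicalEpsilon.
From Coquelicot Require Import Coquelicot.
Open Scope R_scope.

Definition Cexp (z : C) : C :=
  (exp (Re z) * cos (Im z), exp (Re z) * sin (Im z)).

(** Complex powers are multivalued.  The branch is fixed by the direction
    [theta] of the cut: arguments are taken in (theta - 2 PI, theta].  The
    principal branch is [theta = PI]. *)
Definition Carg (theta : R) (w : C) : R :=
  epsilon (inhabits 0) (fun phi : R =>
    theta - 2 * PI < phi <= theta /\ w = (RtoC (Cmod w) * Cexp (0, phi))%C).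

Definition Clog (theta : R) (w : C) : C := (ln (Cmod w), Carg theta w).

Definition Cpower (theta : R) (w z : C) : C := Cexp (z * Clog theta w)%C.

Definition nonpos_int (q : C) : Prop := exists n : nat, q = RtoC (- INR n).

(** No [n + q] lies on the (closed) cut in the direction [theta], so that all
    the powers [(n + q)^z] are holomorphic in [q] nearby.  For [theta = PI] this
    says that [q] is not in (-oo, 0]. *)
Definition off_cuts (theta : R) (q : C) : Prop :=
  forall (n : nat) (t : R), 0 <= t ->
    (RtoC (INR n) + q)%C <> (RtoC t * Cexp (0, theta))%C.

(** Every admissible [q] is off the cuts of a suitable branch. *)
Lemma off_cuts_exists (q : C) :
  ~ nonpos_int q -> exists theta, 0 < theta < 2 * PI /\ off_cuts theta q.
Proof.
intros Hq. assert (Hpi := PI_RGT_0). destruct q as [x y].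
destruct (Req_dec y 0) as [Hy | Hy].
- exists (PI / 2). split; [lra|]. intros n t Ht H. apply Hq. exists n.
  unfold Cexp, Re, Im in H; simpl in H. rewrite exp_0, cos_PI2, sin_PI2 in H.
  injection H as H1 H2. unfold RtoC. f_equal; lra.
- exists PI. split; [lra|]. intros n t Ht H. apply Hy.
  unfold Cexp, Re, Im in H; simpl in H. rewrite exp_0, cos_PI, sin_PI in H.
  injection H as H1 H2. lra.
Qed.

(** For fixed [q], the meromorphic continuation of the Hurwitz series: the only
    singularity is a simple pole at [z = 1] with residue 1.  The value of [f] at
    [z = 1] itself is left unconstrained. *)
Definition is_hurwitz_zeta (theta : R) (q : C) (f : C -> C) : Prop :=
  (forall z : C, 1 < Re z ->
     is_series (K := C_AbsRing) (V := C_NormedModule)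
       (fun n : nat => / Cpower theta (RtoC (INR n) + q) z)%C (f z)) /\
  (forall z : C, z <> RtoC 1 ->
     ex_derive (K := C_AbsRing) (V := C_NormedModule) f z) /\
  filterlim (fun z : C => (z - 1) * f z)%C
    (locally' (RtoC 1)) (locally (RtoC 1)).

Definition hurwitz_zeta (theta : R) (z q : C) : C :=
  epsilon (inhabits (fun _ : C => RtoC 0)) (is_hurwitz_zeta theta q) z.

Fixpoint rising (z : C) (n : nat) : C :=
  match n with
  | O => RtoC 1
  | S k => (rising z k * (z + RtoC (INR k)))%C
  end.

(** The Euler-Gauss limit n! n^z / (z (z+1) ... (z+n)).  At the poles
    0, -1, -2, ... the value is a placeholder. *)
Definition Gamma (z : C) : C :=
  let u n := (RtoC (INR (fact n)) * Cexp (z * RtoC (ln (INR n)))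
                / rising z (S n))%C in
  (real (Lim_seq (fun n => Re (u n))), real (Lim_seq (fun n => Im (u n)))).

Definition Euler_gamma : R :=
  real (Lim_seq (fun n => sum_n_m (fun k => / INR k) 1 n - ln (INR n))).

(** The defining formula, meaningful for [z] not in {0, 1, 2, ...}. *)
Definition gen_polygamma_formula (theta : R) (z q : C) : C :=
  (Cexp (- (RtoC Euler_gamma * z)) *
   C_derive (fun w : C => Cexp (RtoC Euler_gamma * w)
                          * (hurwitz_zeta theta (w + 1) q / Gamma (- w))) z)%C.

Definition gen_polygamma (theta : R) (z q : C) : C :=
  if excluded_middle_informative (exists m : nat, z = RtoC (INR m))
  then C_lim (fun w : C => gen_polygamma_formula theta w q) z
  else gen_polygamma_formula theta z q.

(** d/dq log Gamma(q): the derivative at [q] of a branch of [log Gamma] near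
    [q]; it does not depend on the branch. *)
Definition digamma (q : C) : C :=
  epsilon (inhabits (RtoC 0)) (fun l : C => exists L : C -> C,
    locally q (fun w : C => Cexp (L w) = Gamma w) /\
    is_derive (K := C_AbsRing) (V := C_NormedModule) L q l).

Definition polygamma (m : nat) : C -> C := Nat.iter m C_derive digamma.

(* Main.v *)
Require Import Defs.
From Stdlib Require Import ZArith Reals Lra Lia Psatz Factorial ClassicalEpsilon Classical.
From Coquelicot Require Import Coquelicot.
Open Scope R_scope.

(** Two facts about the Hurwitz zeta function carry the theorem: its
    derivative in [q] is [- s zeta(s + 1, q)], and [(s - 1) zeta(s, q)] is
    entire in [s]. Together with [1 / Gamma(- z) = - z / Gamma(1 - z)] they
    give formally [d/dq (zeta(z + 1, q) / Gamma(- z)) = zeta(z + 2, q) /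
    Gamma(- (z + 1))]; the operator [e^(- gamma z) d/dz e^(gamma z)] commutes
    with [d/dq] and with the shift of [z], which is the first identity. At
    [z = m], the function [1 / Gamma(- z)] has a simple zero, so that only its
    derivative survives and
    [psi(m, q) = (- 1)^(m + 1) m! sum (n + q)^(- m - 1)]. For [m = 1] this is
    the derivative of the digamma function, and the first identity propagates
    the equality to all [m].

    The value of [hurwitz_zeta] is chosen among all functions that continue
    the series, so a continuation must be constructed and shown to be unique.

    Uniqueness ([hurwitz_zeta_unique]). The difference of two continuations,
    multiplied by [(z - 1)^2], is complex differentiable everywhere and
    vanishes for [Re z > 1]. That it vanishes identically is
    [vanishing_half_plane]: Goursat's theorem for rectangles gives it a
    primitive, which has a continuous derivative; for such functions the mean
    value property on circles holds, and it is applied after multiplication by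
    [e^(lam p)], where the real part of the polynomial [p] is [0] at the
    centre and negative on the part of the circle where the function may be
    nonzero. Then [lam] tends to infinity.

    Existence ([num_right_hurwitz_like], [num_branch_hurwitz]). For principal
    powers and [Re q > 0], integration by parts expresses [(s - 1) zeta(s, q)]
    through an integral of [s zeta(s + 1, q + t)] over [0 <= t <= 1]. This
    identity, iterated, extends the function to the left by one unit at a
    time, keeps it jointly continuous together with its derivative in [s], and
    preserves the formula for its derivative in [q]. The mixed derivative is
    obtained by exchanging the order of differentiation ([Cder_swap]). For
    another branch or another [q], only finitely many terms of the series
    differ from the principal ones, and they are added separately.

    The gamma function. In the right half-plane the logarithms of the terms of
    the Euler-Gauss sequence have increments of order [1 / n^2], as have their
    derivatives; this gives [log Gamma] and its first two derivatives as
    dominated series. The relation [Gamma(z) = Gamma(z + 1) / z] extends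
    [1 / Gamma] to an entire function [rgam], with its values and derivatives
    at the nonpositive integers ([rgam_nonpos]), and yields the series of the
    trigamma function ([trigamma_series]). *)

(** * Limits and derivatives of complex functions *)

Notation Clim F f l := (filterlim f F (locally (T := C_UniformSpace) l)).
Notation nearC z := (locally (T := C_UniformSpace) z).
Notation nearR x := (locally (T := R_UniformSpace) x).
Notation Cder f z l :=
  (is_derive (K := C_AbsRing) (V := C_NormedModule) f z l).
Notation RCder f t l :=
  (is_derive (K := R_AbsRing) (V := C_R_NormedModule) f t l).

(** [ring] for equations whose type is only convertible to [C]. *)
Ltac Cring := match goal with |- @eq _ ?x ?y => change (@eq C x y) end; cbv beta; ring.

Lemma Cmod_le_sum (z : C) : Cmod z <= Rabs (Re z) + Rabs (Im z).
Proof.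
unfold Cmod. change (fst z) with (Re z). change (snd z) with (Im z).
apply Rsqr_incr_0_var.
- rewrite Rsqr_sqrt by nra. unfold Rsqr.
  assert (H1 := Rabs_pos (Re z)). assert (H2 := Rabs_pos (Im z)).
  assert (E1 := pow2_abs (Re z)). assert (E2 := pow2_abs (Im z)). nra.
- assert (H1 := Rabs_pos (Re z)). assert (H2 := Rabs_pos (Im z)). lra.
Qed.

Lemma Im_le_Cmod (z : C) : Rabs (Im z) <= Cmod z.
Proof.
unfold Cmod. change (fst z) with (Re z). change (snd z) with (Im z).
rewrite <- sqrt_Rsqr_abs. apply sqrt_le_1_alt. unfold Rsqr. nra.
Qed.

Lemma Re_Lipschitz (w z : C) : Rabs (Re w - Re z) <= Cmod (w - z).
Proof.
eapply Rle_trans; [|apply re_le_Cmod]. unfold Cminus. rewrite re_plus, re_opp. apply Rle_refl.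
Qed.

Lemma Im_Lipschitz (w z : C) : Rabs (Im w - Im z) <= Cmod (w - z).
Proof.
eapply Rle_trans; [|apply Im_le_Cmod]. unfold Cminus. rewrite im_plus, im_opp. apply Rle_refl.
Qed.

Lemma Re_le_Cmod (z : C) : Re z <= Cmod z.
Proof. eapply Rle_trans; [apply Rle_abs | apply re_le_Cmod]. Qed.

Lemma Cmod_Ci : Cmod Ci = 1.
Proof.
unfold Cmod, Ci; simpl. replace (0 * (0 * 1) + 1 * (1 * 1)) with 1 by ring. apply sqrt_1.
Qed.

Lemma Cmod_refl_lt (z : C) (r : R) : 0 < r -> Cmod (z - z) < r.
Proof. intros H. replace (z - z)%C with (RtoC 0) by ring. now rewrite Cmod_0. Qed.

Lemma nearC_iff (z : C) (P : C -> Prop) :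
  nearC z P <-> exists d, 0 < d /\ forall w, Cmod (w - z) < d -> P w.
Proof.
split.
- intros H. apply locally_C in H. destruct H as [d Hd].
  exists d. split; [apply cond_pos|]. intros w Hw. apply Hd. exact Hw.
- intros [d [Hd H]]. apply locally_C. exists (mkposreal d Hd). intros w Hw.
  apply H. exact Hw.
Qed.

Lemma Cball_near (z : C) (d : R) : 0 < d -> nearC z (fun w => Cmod (w - z) < d).
Proof. intros Hd. apply nearC_iff. exists d. auto. Qed.

Lemma Clim_iff {T : Type} {F} {FF : @Filter T F}
  (f : T -> C) (l : C) :
  Clim F f l <-> forall eps, 0 < eps -> F (fun x => Cmod (f x - l) < eps).
Proof.
split.
- intros H eps He. apply (H (fun w => Cmod (w - l) < eps)). apply Cball_near, He.
- intros H P HP. apply nearC_iff in HP. destruct HP as [d [Hd HP]].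
  unfold filtermap. generalize (H d Hd). apply filter_imp. intros x Hx.
  apply HP, Hx.
Qed.

Lemma Clim_plus {T : Type} {F} {FF : @Filter T F}
  (f g : T -> C) (a b : C) :
  Clim F f a -> Clim F g b -> Clim F (fun x => (f x + g x)%C) (a + b)%C.
Proof.
intros Hf Hg.
apply (filterlim_comp_2 (G := nearC a) (H := nearC b) f g Cplus Hf Hg).
exact (filterlim_plus (K := C_AbsRing) (V := C_NormedModule) a b).
Qed.

Lemma Clim_opp {T : Type} {F} {FF : @Filter T F}
  (f : T -> C) (a : C) : Clim F f a -> Clim F (fun x => (- f x)%C) (- a)%C.
Proof.
intros Hf. apply (filterlim_comp _ _ _ f Copp _ (nearC a)); [exact Hf|].
exact (filterlim_opp (K := C_AbsRing) (V := C_NormedModule) a).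
Qed.

Lemma Clim_minus {T : Type} {F} {FF : @Filter T F}
  (f g : T -> C) (a b : C) :
  Clim F f a -> Clim F g b -> Clim F (fun x => (f x - g x)%C) (a - b)%C.
Proof. intros Hf Hg. apply Clim_plus; [exact Hf | now apply Clim_opp]. Qed.

Lemma Clim_mult {T : Type} {F} {FF : @Filter T F}
  (f g : T -> C) (a b : C) :
  Clim F f a -> Clim F g b -> Clim F (fun x => (f x * g x)%C) (a * b)%C.
Proof.
intros Hf Hg P HP. apply locally_C in HP. revert P HP.
apply (filterlim_comp_2 (G := locally (T := AbsRing_UniformSpace C_AbsRing) a)
  (H := locally (T := AbsRing_UniformSpace C_AbsRing) b) f g Cmult).
- intros P HP. now apply Hf, locally_C.
- intros P HP. now apply Hg, locally_C.
- exact (filterlim_mult (K := C_AbsRing) a b).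
Qed.

Lemma Clim_const {T : Type} {F} {FF : @Filter T F} (a : C) :
  Clim F (fun _ => a) a.
Proof. apply filterlim_const. Qed.

Lemma Clim_inv {T : Type} {F} {FF : @Filter T F}
  (f : T -> C) (a : C) :
  a <> RtoC 0 -> Clim F f a -> Clim F (fun x => (/ f x)%C) (/ a)%C.
Proof.
intros Ha Hf. rewrite !Clim_iff in *. intros eps He.
assert (HM : 0 < Cmod a) by now apply Cmod_gt_0.
assert (He' : 0 < Rmin (Cmod a / 2) (eps * Cmod a * Cmod a / 2)).
{ apply Rmin_pos; [lra|].
  assert (0 < eps * Cmod a * Cmod a) by (repeat apply Rmult_lt_0_compat; lra). lra. }
generalize (Hf _ He'). apply filter_imp. intros x Hx.
assert (Hm1 := Rmin_l (Cmod a / 2) (eps * Cmod a * Cmod a / 2)).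
assert (Hm2 := Rmin_r (Cmod a / 2) (eps * Cmod a * Cmod a / 2)).
assert (Hfx : Cmod a / 2 < Cmod (f x)).
{ assert (Cmod a <= Cmod (f x) + Cmod (f x - a)).
  { rewrite <- (Cmod_opp (f x - a)).
    replace a with (f x + - (f x - a))%C at 1 by ring. apply Cmod_triangle. }
  lra. }
assert (Hfx0 : f x <> RtoC 0) by (apply Cmod_gt_0; lra).
replace (/ f x - / a)%C with (- ((f x - a) * / (f x * a)))%C by (field; auto).
rewrite Cmod_opp, Cmod_mult, Cmod_inv by now apply Cmult_neq_0.
rewrite Cmod_mult.
apply Rmult_lt_reg_r with (Cmod (f x) * Cmod a); [nra|].
rewrite Rmult_assoc, Rinv_l by nra. rewrite Rmult_1_r.
eapply Rlt_le_trans; [exact Hx|]. eapply Rle_trans; [exact Hm2|]. nra.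
Qed.

Lemma Clim_ext {T : Type} {F} {FF : @Filter T F}
  (f g : T -> C) (a : C) :
  F (fun x => f x = g x) -> Clim F f a -> Clim F g a.
Proof. intros H. exact (filterlim_ext_loc f g H). Qed.

Lemma Clim_unique {T : Type} {F : (T -> Prop) -> Prop} {FF : ProperFilter F}
  (f : T -> C) (a b : C) : Clim F f a -> Clim F f b -> a = b.
Proof.
intros Ha Hb.
exact (filterlim_locally_unique (K := C_AbsRing) (V := C_NormedModule) f a b Ha Hb).
Qed.

Lemma Clim_comp {T : Type} {F} {FF : @Filter T F}
  (f : T -> C) (g : C -> C) (a b : C) :
  Clim F f a -> Clim (nearC a) g b -> Clim F (fun x => g (f x)) b.
Proof. intros Hf Hg. exact (filterlim_comp _ _ _ f g _ _ _ Hf Hg). Qed.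

Lemma Cder_iff (f : C -> C) (z l : C) :
  Cder f z l <->
  forall eps, 0 < eps -> exists d, 0 < d /\ forall w, Cmod (w - z) < d ->
    Cmod (f w - f z - (w - z) * l) <= eps * Cmod (w - z).
Proof.
split.
- intros [_ H] eps He.
  destruct (H z (fun P HP => HP) (mkposreal eps He)) as [d Hd].
  exists d. split; [apply cond_pos|]. intros w Hw. exact (Hd w Hw).
- intros H. split; [apply is_linear_scal_l|].
  intros x Hx eps. apply (is_filter_lim_locally_unique (V := AbsRing_NormedModule C_AbsRing)) in Hx. subst x.
  destruct (H eps (cond_pos eps)) as [d [Hd H']].
  exists (mkposreal d Hd). intros w Hw. exact (H' w Hw).
Qed.

Lemma RCder_iff (f : R -> C) (t : R) (l : C) :
  RCder f t l <->
  forall eps, 0 < eps -> exists d, 0 < d /\ forall u, Rabs (u - t) < d ->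
    Cmod (f u - f t - RtoC (u - t) * l) <= eps * Rabs (u - t).
Proof.
assert (E : forall u, norm (K := R_AbsRing) (V := C_R_NormedModule)
    (minus (minus (f u) (f t)) (scal (minus u t) l))
  = Cmod (f u - f t - RtoC (u - t) * l)).
{ intros u. rewrite <- (scal_R_Cmult (u - t)). symmetry. apply Cmod_norm. }
split.
- intros [_ H] eps He.
  destruct (H t (fun P HP => HP) (mkposreal eps He)) as [d Hd].
  exists d. split; [apply cond_pos|]. intros w Hw. rewrite <- E. exact (Hd w Hw).
- intros H. split; [apply is_linear_scal_l|].
  intros x Hx eps. apply (is_filter_lim_locally_unique (V := AbsRing_NormedModule R_AbsRing)) in Hx. subst x.
  destruct (H eps (cond_pos eps)) as [d [Hd H']].
  exists (mkposreal d Hd). intros w Hw. specialize (H' w Hw). rewrite <- E in H'.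
  exact H'.
Qed.

(** [C] carries two normed-module structures over itself, with equivalent
    neighbourhoods: the rules for products and composition are stated for one,
    the derivatives here are taken in the other. *)
Lemma Cder_AbsRing (f : C -> C) (z l : C) :
  Cder f z l <-> is_derive (K := C_AbsRing) (V := AbsRing_NormedModule C_AbsRing) f z l.
Proof.
rewrite Cder_iff. split.
- intros H. split; [apply is_linear_scal_l|].
  intros x Hx eps. apply (is_filter_lim_locally_unique (V := AbsRing_NormedModule C_AbsRing)) in Hx. subst x.
  destruct (H eps (cond_pos eps)) as [d [Hd H']].
  exists (mkposreal d Hd). intros w Hw. exact (H' w Hw).
- intros [_ H] eps He.
  destruct (H z (fun P HP => HP) (mkposreal eps He)) as [d Hd].
  exists d. split; [apply cond_pos|]. intros w Hw. exact (Hd w Hw).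
Qed.

Lemma Cder_ext (f g : C -> C) (z l : C) :
  nearC z (fun w => f w = g w) -> Cder f z l -> Cder g z l.
Proof. intros H. apply is_derive_ext_loc. now apply locally_C. Qed.

Lemma Cder_continuous (f : C -> C) (z l : C) : Cder f z l -> Clim (nearC z) f (f z).
Proof.
intros H. apply Clim_iff. intros eps He.
rewrite Cder_iff in H. destruct (H 1 Rlt_0_1) as [d [Hd H']].
apply nearC_iff. exists (Rmin d (eps / (1 + 1 + Cmod l))).
assert (0 <= Cmod l) by apply Cmod_ge_0.
split. { apply Rmin_pos; [lra|]. apply Rdiv_lt_0_compat; lra. }
intros w Hw.
assert (Hw1 := Rlt_le_trans _ _ _ Hw (Rmin_l _ _)).
assert (Hw2 := Rlt_le_trans _ _ _ Hw (Rmin_r _ _)).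
specialize (H' w Hw1).
replace (f w - f z)%C with ((f w - f z - (w - z) * l) + (w - z) * l)%C by ring.
eapply Rle_lt_trans; [apply Cmod_triangle|]. rewrite Cmod_mult.
assert (0 <= Cmod (w - z)) by apply Cmod_ge_0.
assert (Cmod (w - z) * (1 + 1 + Cmod l) < eps).
{ apply Rmult_lt_reg_r with (/ (1 + 1 + Cmod l)).
  - apply Rinv_0_lt_compat; lra.
  - rewrite Rmult_assoc, Rinv_r by lra. lra. }
nra.
Qed.

Lemma Cder_const (c z : C) : Cder (fun _ => c) z (RtoC 0).
Proof. exact (is_derive_const (K := C_AbsRing) (V := C_NormedModule) c z). Qed.

Lemma Cder_id (z : C) : Cder (fun w => w) z (RtoC 1).
Proof. apply Cder_AbsRing. exact (is_derive_id (K := C_AbsRing) z). Qed.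

Lemma Cder_plus (f g : C -> C) (z a b : C) :
  Cder f z a -> Cder g z b -> Cder (fun w => (f w + g w)%C) z (a + b)%C.
Proof. exact (is_derive_plus (K := C_AbsRing) (V := C_NormedModule) f g z a b). Qed.

Lemma Cder_opp (f : C -> C) (z a : C) :
  Cder f z a -> Cder (fun w => (- f w)%C) z (- a)%C.
Proof. exact (is_derive_opp (K := C_AbsRing) (V := C_NormedModule) f z a). Qed.

Lemma Cder_minus (f g : C -> C) (z a b : C) :
  Cder f z a -> Cder g z b -> Cder (fun w => (f w - g w)%C) z (a - b)%C.
Proof. intros Hf Hg. apply Cder_plus; [exact Hf | now apply Cder_opp]. Qed.

Lemma Cder_mult (f g : C -> C) (z a b : C) :
  Cder f z a -> Cder g z b -> Cder (fun w => (f w * g w)%C) z (a * g z + f z * b)%C.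
Proof.
rewrite !Cder_AbsRing. intros Hf Hg.
exact (is_derive_mult (K := C_AbsRing) f g z a b Hf Hg Cmult_comm).
Qed.

Lemma Cder_scal (f : C -> C) (c z a : C) :
  Cder f z a -> Cder (fun w => (c * f w)%C) z (c * a)%C.
Proof.
intros H. replace (c * a)%C with (RtoC 0 * f z + c * a)%C by ring.
apply (Cder_mult (fun _ => c)); [apply Cder_const | exact H].
Qed.

Lemma Cder_comp (f g : C -> C) (z a b : C) :
  Cder f (g z) a -> Cder g z b -> Cder (fun w => f (g w)) z (b * a)%C.
Proof.
intros Hf Hg. apply Cder_AbsRing in Hg.
exact (is_derive_comp (K := C_AbsRing) (V := C_NormedModule) f g z a b Hf Hg).
Qed.

Lemma Cder_eq (f : C -> C) (z a b : C) : Cder f z a -> a = b -> Cder f z b.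
Proof. now intros H <-. Qed.

Lemma Cder_translate (f : C -> C) (a q l : C) :
  Cder f (q + a)%C l -> Cder (fun w => f (w + a)%C) q l.
Proof.
intros H. eapply Cder_eq.
- apply (Cder_comp f (fun w => (w + a)%C)); [exact H|].
  apply Cder_plus; [apply Cder_id | apply Cder_const].
- ring.
Qed.

Lemma Cder_translate_l (f : C -> C) (a q l : C) :
  Cder f (a + q)%C l -> Cder (fun w => f (a + w)%C) q l.
Proof.
intros H. eapply Cder_eq.
- apply (Cder_comp f (fun w => (a + w)%C)); [exact H|].
  apply Cder_plus; [apply Cder_const | apply Cder_id].
- ring.
Qed.

Lemma Cder_sub_const (a z : C) : Cder (fun v => (v - a)%C) z (RtoC 1).
Proof. eapply Cder_eq; [apply Cder_minus; [apply Cder_id | apply Cder_const]|]. ring. Qed.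

Lemma Cder_unique (f : C -> C) (z a b : C) : Cder f z a -> Cder f z b -> a = b.
Proof.
intros Ha Hb.
rewrite <- (is_C_derive_unique f z a Ha). now apply is_C_derive_unique.
Qed.

(** [Cder] as convergence of difference quotients, in the punctured
    neighbourhood of the point. *)
Lemma Cder_quotient (f : C -> C) (z l : C) :
  Cder f z l <->
  Clim (locally' (T := C_UniformSpace) z) (fun w => ((f w - f z) / (w - z))%C) l.
Proof.
rewrite Cder_iff, Clim_iff. split.
- intros H eps He. destruct (H (eps / 2)) as [d [Hd H']]; [lra|].
  apply nearC_iff. exists d. split; [exact Hd|]. intros w Hw Hne.
  assert (Hwz : (w - z)%C <> RtoC 0) by now apply Cminus_eq_contra.
  specialize (H' w Hw). apply Cmod_gt_0 in Hwz as Hp.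
  replace ((f w - f z) / (w - z) - l)%C
    with ((f w - f z - (w - z) * l) / (w - z))%C by (field; exact Hwz).
  rewrite Cmod_div by exact Hwz.
  apply Rmult_lt_reg_r with (Cmod (w - z)); [exact Hp|].
  unfold Rdiv. rewrite Rmult_assoc, Rinv_l by lra. nra.
- intros H eps He. specialize (H eps He). apply nearC_iff in H.
  destruct H as [d [Hd H']]. exists d. split; [exact Hd|]. intros w Hw.
  destruct (Ceq_dec w z) as [->|Hne].
  + replace (f z - f z - (z - z) * l)%C with (RtoC 0) by ring.
    replace (z - z)%C with (RtoC 0) by ring. rewrite Cmod_0. lra.
  + assert (Hwz : (w - z)%C <> RtoC 0) by now apply Cminus_eq_contra.
    specialize (H' w Hw Hne). apply Cmod_gt_0 in Hwz as Hp.
    replace (f w - f z - (w - z) * l)%C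
      with (((f w - f z) / (w - z) - l) * (w - z))%C by (field; exact Hwz).
    rewrite Cmod_mult. nra.
Qed.

Lemma Cder_RCder_comp (f : C -> C) (g : R -> C) (t : R) (a b : C) :
  Cder f (g t) a -> RCder g t b -> RCder (fun u => f (g u)) t (b * a)%C.
Proof.
rewrite Cder_iff, !RCder_iff. intros Hf Hg eps He.
assert (Ha := Cmod_ge_0 a). assert (Hb := Cmod_ge_0 b).
set (e1 := eps / 2 / (1 + Cmod b)).
assert (He1 : 0 < e1) by (unfold e1; repeat apply Rdiv_lt_0_compat; lra).
assert (He1b : e1 * (1 + Cmod b) = eps / 2) by (unfold e1; field; lra).
set (e2 := Rmin 1 (eps / 2 / (1 + Cmod a))).
assert (He2 : 0 < e2).
{ unfold e2. apply Rmin_pos; [lra|]. repeat apply Rdiv_lt_0_compat; lra. }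
assert (He2a : e2 * Cmod a <= eps / 2).
{ assert (e2 <= eps / 2 / (1 + Cmod a)) by apply Rmin_r.
  assert (eps / 2 / (1 + Cmod a) * (1 + Cmod a) = eps / 2) by (field; lra). nra. }
assert (He21 : e2 <= 1) by apply Rmin_l.
destruct (Hf e1 He1) as [d1 [Hd1 H1]].
destruct (Hg e2 He2) as [d2 [Hd2 H2]].
exists (Rmin d2 (d1 / (1 + Cmod b))).
split. { apply Rmin_pos; [lra|]. apply Rdiv_lt_0_compat; lra. }
intros u Hu.
assert (Hu1 := Rlt_le_trans _ _ _ Hu (Rmin_l _ _)).
assert (Hu2 := Rlt_le_trans _ _ _ Hu (Rmin_r _ _)).
specialize (H2 u Hu1).
assert (Hau := Rabs_pos (u - t)).
assert (Hgu : Cmod (g u - g t) <= (1 + Cmod b) * Rabs (u - t)).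
{ replace (g u - g t)%C
    with ((g u - g t - RtoC (u - t) * b) + RtoC (u - t) * b)%C by ring.
  eapply Rle_trans; [apply Cmod_triangle|]. rewrite Cmod_mult, Cmod_R. nra. }
assert (Hgd : Cmod (g u - g t) < d1).
{ eapply Rle_lt_trans; [exact Hgu|].
  apply Rmult_lt_compat_r with (r := 1 + Cmod b) in Hu2; [|lra].
  replace (d1 / (1 + Cmod b) * (1 + Cmod b)) with d1 in Hu2 by (field; lra). lra. }
specialize (H1 _ Hgd).
replace (f (g u) - f (g t) - RtoC (u - t) * (b * a))%C
  with ((f (g u) - f (g t) - (g u - g t) * a)
        + (g u - g t - RtoC (u - t) * b) * a)%C by ring.
eapply Rle_trans; [apply Cmod_triangle|]. rewrite Cmod_mult. nra.
Qed.

Lemma RCder_eq (f : R -> C) (t : R) (a b : C) : RCder f t a -> a = b -> RCder f t b.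
Proof. now intros H <-. Qed.

Lemma RCder_line (z h : C) (t : R) : RCder (fun u => (z + RtoC u * h)%C) t h.
Proof.
apply RCder_iff. intros eps He. exists 1. split; [lra|]. intros u _.
replace (z + RtoC u * h - (z + RtoC t * h) - RtoC (u - t) * h)%C with (RtoC 0).
- rewrite Cmod_0. assert (Ha := Rabs_pos (u - t)). nra.
- rewrite RtoC_minus. ring.
Qed.

(** Reduces paths in the plane to real functions, to which the real mean value
    theorem applies. *)
Lemma RCder_Re (f : R -> C) (t : R) (l c : C) :
  RCder f t l -> is_derive (fun u => Re (c * f u)) t (Re (c * l)).
Proof.
rewrite RCder_iff. intros H. split; [apply is_linear_scal_l|].
intros x Hx eps.
apply (is_filter_lim_locally_unique (V := AbsRing_NormedModule R_AbsRing)) in Hx. subst x.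
assert (Hc := Cmod_ge_0 c).
destruct (H (eps / (1 + Cmod c))) as [d [Hd H']].
{ apply Rdiv_lt_0_compat; [apply cond_pos | lra]. }
exists (mkposreal d Hd). intros u Hu. specialize (H' u Hu).
change (Rabs (Re (c * f u) - Re (c * f t) - (u - t) * Re (c * l)) <= eps * Rabs (u - t)).
replace (Re (c * f u) - Re (c * f t) - (u - t) * Re (c * l))
  with (Re (c * (f u - f t - RtoC (u - t) * l))).
2:{ rewrite !re_mult. unfold Cminus. rewrite !re_plus, !im_plus, !re_opp, !im_opp.
    rewrite re_scal_l, im_scal_l. ring. }
eapply Rle_trans; [apply re_le_Cmod|]. rewrite Cmod_mult.
assert (Ha := Rabs_pos (u - t)). assert (Hep := cond_pos eps).
replace (eps * Rabs (u - t)) with ((1 + Cmod c) * (eps / (1 + Cmod c) * Rabs (u - t)))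
  by (field; lra).
apply Rmult_le_compat; try apply Cmod_ge_0; lra.
Qed.

(** Projecting on the direction of the increment turns the mean value
    theorem into an inequality for complex-valued paths. *)
Lemma path_mean_value (f df : R -> C) (a b M : R) :
  a <= b ->
  (forall t, a <= t <= b -> RCder f t (df t)) ->
  (forall t, a <= t <= b -> Cmod (df t) <= M) ->
  Cmod (f b - f a) <= M * (b - a).
Proof.
intros Hab Hf HM.
assert (HM0 : 0 <= M).
{ eapply Rle_trans; [apply Cmod_ge_0 | apply (HM a); lra]. }
set (c := Cconj (f b - f a)). set (D := Cmod (f b - f a)).
destruct (MVT_gen (fun t => Re (c * f t)) a b (fun t => Re (c * df t))) as [t [Ht E]].
- intros t Ht. rewrite Rmin_left, Rmax_right in Ht by lra.
  apply RCder_Re, Hf; lra.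
- intros t Ht. rewrite Rmin_left, Rmax_right in Ht by lra.
  apply derivable_continuous_pt. exists (Re (c * df t)).
  apply is_derive_Reals, RCder_Re, Hf; lra.
- rewrite Rmin_left, Rmax_right in Ht by lra.
  assert (E1 : Re (c * f b) - Re (c * f a) = D * D).
  { unfold c, D. rewrite !re_mult.
    replace (Cmod (f b - f a) * Cmod (f b - f a)) with (Cmod (f b - f a) ^ 2) by ring.
    rewrite Cmod2_alt, re_conj, im_conj.
    unfold Cminus. rewrite !re_plus, !im_plus, !re_opp, !im_opp. ring. }
  rewrite E1 in E.
  assert (HD : 0 <= D) by apply Cmod_ge_0.
  assert (E2 : Re (c * df t) <= D * M).
  { eapply Rle_trans; [apply Rle_abs|]. eapply Rle_trans; [apply re_le_Cmod|].
    rewrite Cmod_mult. unfold c. rewrite Cmod_conj. fold D.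
    apply Rmult_le_compat_l; [exact HD | now apply HM]. }
  destruct (Req_dec D 0) as [H0|H0]; [rewrite H0; nra|].
  apply Rmult_le_reg_l with D; [lra|]. nra.
Qed.

Definition segment (z w : C) (t : R) : C := (z + RtoC t * (w - z))%C.

Lemma segment_close (z w : C) (t : R) :
  0 <= t <= 1 -> Cmod (segment z w t - z) <= Cmod (w - z).
Proof.
intros Ht. unfold segment.
replace (z + RtoC t * (w - z) - z)%C with (RtoC t * (w - z))%C by ring.
rewrite Cmod_mult, Cmod_R, Rabs_pos_eq by lra.
assert (H := Cmod_ge_0 (w - z)). nra.
Qed.

(** With [l = 0] this is the mean value inequality; with [l = f' z] it bounds
    the error of the linear approximation by the oscillation of [f']. *)
Lemma Cder_mean_value (f df : C -> C) (z w l : C) (M : R) :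
  (forall t, 0 <= t <= 1 -> Cder f (segment z w t) (df (segment z w t))) ->
  (forall t, 0 <= t <= 1 -> Cmod (df (segment z w t) - l) <= M) ->
  Cmod (f w - f z - (w - z) * l) <= M * Cmod (w - z).
Proof.
intros Hf HM.
set (g := fun t => (f (segment z w t) - segment z w t * l)%C).
replace (f w - f z - (w - z) * l)%C with (g 1 - g 0)%C.
2:{ unfold g, segment. replace (z + 1 * (w - z))%C with w by ring.
    replace (z + 0 * (w - z))%C with z by ring. ring. }
replace (M * Cmod (w - z)) with (M * Cmod (w - z) * (1 - 0)) by ring.
apply (path_mean_value g (fun t => ((w - z) * (df (segment z w t) - l))%C)).
- lra.
- intros t Ht.
  apply (Cder_RCder_comp (fun s => (f s - s * l)%C) (segment z w)).
  + apply Cder_minus; [now apply Hf|].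
    eapply Cder_eq; [apply (Cder_mult (fun s => s) (fun _ => l));
      [apply Cder_id | apply Cder_const] |]. ring.
  + apply RCder_line.
- intros t Ht. rewrite Cmod_mult, Rmult_comm.
  apply Rmult_le_compat_r; [apply Cmod_ge_0 | now apply HM].
Qed.

Lemma Cder_Lipschitz (f df : C -> C) (z w : C) (M : R) :
  (forall t, 0 <= t <= 1 -> Cder f (segment z w t) (df (segment z w t))) ->
  (forall t, 0 <= t <= 1 -> Cmod (df (segment z w t)) <= M) ->
  Cmod (f w - f z) <= M * Cmod (w - z).
Proof.
intros Hf HM. replace (f w - f z)%C with (f w - f z - (w - z) * 0)%C by ring.
apply (Cder_mean_value f df); [exact Hf|]. intros t Ht.
replace (df (segment z w t) - 0)%C with (df (segment z w t)) by ring.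
now apply HM.
Qed.

(** * Dominated series of complex functions *)

Notation Cser a l := (is_series (K := C_AbsRing) (V := C_NormedModule) a l).
Notation Csum_n a n := (sum_n (G := C_AbelianMonoid) a n).

Definition Cseries (a : nat -> C) : C := epsilon (inhabits (RtoC 0)) (fun l => Cser a l).

Lemma Csum_Sn (a : nat -> C) (n : nat) : Csum_n a (S n) = (Csum_n a n + a (S n))%C.
Proof. exact (sum_Sn a n). Qed.

Lemma Csum_O (a : nat -> C) : Csum_n a 0%nat = a 0%nat.
Proof. exact (sum_O a). Qed.

Lemma Cser_iff (a : nat -> C) (l : C) :
  Cser a l <-> forall eps, 0 < eps -> eventually (fun n => Cmod (Csum_n a n - l) < eps).
Proof. exact (Clim_iff (fun n => Csum_n a n) l). Qed.

Lemma Cser_unique (a : nat -> C) (l m : C) : Cser a l -> Cser a m -> l = m.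
Proof. apply Clim_unique. Qed.

Lemma Cseries_unique (a : nat -> C) (l : C) : Cser a l -> Cseries a = l.
Proof.
intros H. apply (Cser_unique a); [|exact H].
apply (epsilon_spec (inhabits (RtoC 0)) (fun l => Cser a l)). now exists l.
Qed.

Lemma Cseries_dominated (a : nat -> C) (M : nat -> R) :
  (forall n, Cmod (a n) <= M n) -> ex_series M -> Cser a (Cseries a).
Proof.
intros Ha HM.
destruct (ex_series_le (K := C_AbsRing) (V := C_CompleteNormedModule) a M Ha HM) as [l Hl].
change (Cser a l) in Hl. now rewrite (Cseries_unique a l Hl).
Qed.

Lemma Csum_diff_le (a : nat -> C) (M : nat -> R) (N k : nat) :
  (forall n, Cmod (a n) <= M n) ->
  Cmod (Csum_n a (N + k) - Csum_n a N) <= sum_n M (N + k) - sum_n M N.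
Proof.
intros Ha. induction k as [|k IH].
- rewrite Nat.add_0_r.
  replace (Csum_n a N - Csum_n a N)%C with (RtoC 0) by ring. rewrite Cmod_0. lra.
- rewrite Nat.add_succ_r, Csum_Sn, sum_Sn. change plus with Rplus.
  replace (Csum_n a (N + k) + a (S (N + k)) - Csum_n a N)%C
    with ((Csum_n a (N + k) - Csum_n a N) + a (S (N + k)))%C by ring.
  eapply Rle_trans; [apply Cmod_triangle|]. specialize (Ha (S (N + k))). lra.
Qed.

Lemma sum_n_le_Series (M : nat -> R) (N : nat) :
  (forall n, 0 <= M n) -> ex_series M -> sum_n M N <= Series M.
Proof.
intros HM Hex.
apply (is_lim_seq_incr_compare (sum_n M)).
- apply Series_correct, Hex.
- intros n. rewrite sum_Sn. change plus with Rplus. specialize (HM (S n)). lra.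
Qed.

Lemma Cser_tail (a : nat -> C) (l : C) (M : nat -> R) (N : nat) :
  (forall n, Cmod (a n) <= M n) -> ex_series M -> Cser a l ->
  Cmod (l - Csum_n a N) <= Series M - sum_n M N.
Proof.
intros Ha HM Hl.
assert (HM0 : forall n, 0 <= M n) by (intros n; eapply Rle_trans; [apply Cmod_ge_0 | apply Ha]).
apply Rnot_lt_le. intros Hlt.
rewrite Cser_iff in Hl.
destruct (Hl (Cmod (l - Csum_n a N) - (Series M - sum_n M N))) as [K HK]; [lra|].
specialize (HK (N + K)%nat ltac:(lia)).
assert (H1 := Csum_diff_le a M N K Ha).
assert (H2 := sum_n_le_Series M (N + K) HM0 HM).
assert (H3 : Cmod (l - Csum_n a N)
  <= Cmod (Csum_n a (N + K) - l) + Cmod (Csum_n a (N + K) - Csum_n a N)).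
{ rewrite <- (Cmod_opp (Csum_n a (N + K) - l)).
  replace (l - Csum_n a N)%C
    with (- (Csum_n a (N + K) - l) + (Csum_n a (N + K) - Csum_n a N))%C by ring.
  apply Cmod_triangle. }
lra.
Qed.

Lemma Clim_sum_n {T : Type} {F} {FF : @Filter T F}
  (f : nat -> T -> C) (l : nat -> C) (N : nat) :
  (forall n, Clim F (f n) (l n)) ->
  Clim F (fun x => Csum_n (fun n => f n x) N) (Csum_n l N).
Proof.
intros H. induction N as [|N IH].
- rewrite Csum_O. eapply Clim_ext; [|apply (H 0%nat)].
  apply filter_forall. intros x. now rewrite Csum_O.
- rewrite Csum_Sn. eapply Clim_ext; [|exact (Clim_plus _ _ _ _ IH (H (S N)))].
  apply filter_forall. intros x. now rewrite Csum_Sn.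
Qed.

(** Beyond a rank that depends only on [M] the tails of all the series are small,
    and a finite sum commutes with the limit. *)
Lemma Tannery {T : Type} {F} {FF : @Filter T F}
  (f : nat -> T -> C) (l : nat -> C) (M : nat -> R) (s : T -> C) (L : C) :
  ex_series M ->
  (forall n, Clim F (f n) (l n)) ->
  F (fun x => forall n, Cmod (f n x) <= M n) ->
  (forall n, Cmod (l n) <= M n) ->
  F (fun x => Cser (fun n => f n x) (s x)) ->
  Cser l L ->
  Clim F s L.
Proof.
intros HM Hf Hb Hl Hs HL. apply Clim_iff. intros eps He.
assert (HMl := Series_correct M HM).
assert (He3 : 0 < eps / 3) by lra.
destruct (proj1 (is_series_Reals M _) HMl (eps / 3) He3) as [N HN].
specialize (HN N (Nat.le_refl _)). rewrite <- sum_n_Reals in HN.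
unfold Rdist in HN. rewrite Rabs_minus_sym in HN. apply Rabs_lt_between in HN.
assert (HsN := Clim_sum_n f l N Hf). rewrite Clim_iff in HsN.
generalize (filter_and _ _ (HsN (eps / 3) He3) (filter_and _ _ Hb Hs)).
apply filter_imp. intros x [H1 [H2 H3]].
assert (T1 := Cser_tail _ _ M N H2 HM H3).
assert (T2 := Cser_tail _ _ M N Hl HM HL).
replace (s x - L)%C
  with ((s x - Csum_n (fun n => f n x) N) + (Csum_n (fun n => f n x) N - Csum_n l N)
        + - (L - Csum_n l N))%C by ring.
eapply Rle_lt_trans; [apply Cmod_triangle|]. rewrite Cmod_opp.
eapply Rle_lt_trans; [apply Rplus_le_compat_r, Cmod_triangle|]. lra.
Qed.

(** By the mean value inequality a bound on the derivatives of the terms also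
    dominates their difference quotients, so [Tannery] applies. *)
Lemma Cder_series (f df : nat -> C -> C) (M : nat -> R) (z : C) (r : R) (s : C -> C) (ds : C) :
  0 < r -> ex_series M ->
  (forall n w, Cmod (w - z) < r -> Cder (f n) w (df n w)) ->
  (forall n w, Cmod (w - z) < r -> Cmod (df n w) <= M n) ->
  (forall w, Cmod (w - z) < r -> Cser (fun n => f n w) (s w)) ->
  Cser (fun n => df n z) ds ->
  Cder s z ds.
Proof.
intros Hr HM Hf Hb Hs Hds.
assert (Hz := Cmod_refl_lt z r Hr).
apply Cder_quotient.
apply (Tannery (fun n w => ((f n w - f n z) / (w - z))%C) (fun n => df n z) M).
- exact HM.
- intros n. apply Cder_quotient. now apply Hf.
- apply nearC_iff. exists r. split; [exact Hr|]. intros w Hw Hne n.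
  assert (Hwz : (w - z)%C <> RtoC 0) by now apply Cminus_eq_contra.
  apply Cmod_gt_0 in Hwz as Hp. rewrite Cmod_div by exact Hwz.
  apply Rle_div_l; [exact Hp|].
  assert (Hseg : forall t, 0 <= t <= 1 -> Cmod (segment z w t - z) < r).
  { intros t Ht. eapply Rle_lt_trans; [now apply segment_close | exact Hw]. }
  apply (Cder_Lipschitz (f n) (df n)); intros t Ht; [apply Hf | apply Hb]; auto.
- intros n. now apply Hb.
- apply nearC_iff. exists r. split; [exact Hr|]. intros w Hw Hne.
  assert (Hwz : (w - z)%C <> RtoC 0) by now apply Cminus_eq_contra.
  assert (H := is_series_scal (K := C_AbsRing) (V := C_NormedModule) (/ (w - z))%C _ _
    (is_series_minus (K := C_AbsRing) (V := C_NormedModule) _ _ _ _ (Hs w Hw) (Hs z Hz))).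
  replace ((s w - s z) / (w - z))%C with (/ (w - z) * (s w - s z))%C by apply Cmult_comm.
  eapply is_series_ext; [|exact H]. intros n.
  apply Cmult_comm.
- exact Hds.
Qed.

Lemma Cser_scal (c : C) (a : nat -> C) (l : C) :
  Cser a l -> Cser (fun n => (c * a n)%C) (c * l)%C.
Proof. exact (is_series_scal (K := C_AbsRing) (V := C_NormedModule) c a l). Qed.

Lemma Cser_ext (a b : nat -> C) (l : C) :
  (forall n, a n = b n) -> Cser a l -> Cser b l.
Proof. exact (is_series_ext (K := C_AbsRing) (V := C_NormedModule) a b l). Qed.

Lemma Csum_shift (a : nat -> C) (N n : nat) :
  Csum_n (fun k => a (N + k)%nat) n
  = match N with O => Csum_n a n | S N' => (Csum_n a (N + n) - Csum_n a N')%C end.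
Proof.
destruct N as [|N].
- reflexivity.
- induction n as [|n IH].
  + rewrite Csum_O, Nat.add_0_r, Csum_Sn. Cring.
  + rewrite Csum_Sn, IH, Nat.add_succ_r, Csum_Sn. Cring.
Qed.

(** Unlike [sum_n], which has [n + 1] terms, this sum can be empty. *)
Fixpoint Csum_lt (a : nat -> C) (N : nat) : C :=
  match N with O => RtoC 0 | S n => (Csum_lt a n + a n)%C end.

Lemma Csum_lt_S (a : nat -> C) (n : nat) : Csum_n a n = Csum_lt a (S n).
Proof.
induction n as [|n IH]; [rewrite Csum_O; simpl; Cring|].
rewrite Csum_Sn, IH. reflexivity.
Qed.

Lemma Cser_shift (a : nat -> C) (N : nat) (l : C) :
  Cser (fun n => a (N + n)%nat) l -> Cser a (Csum_lt a N + l)%C.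
Proof.
intros H. destruct N as [|N].
- simpl. replace (RtoC 0 + l)%C with l by Cring. exact H.
- rewrite Cser_iff in *. intros eps He.
  destruct (H eps He) as [K HK]. exists (S N + K)%nat. intros n Hn.
  replace n with (S N + (n - S N))%nat by lia.
  specialize (HK (n - S N)%nat ltac:(lia)). rewrite Csum_shift in HK.
  rewrite <- Csum_lt_S.
  match goal with |- Cmod ?x < _ => match type of HK with Cmod ?y < _ =>
    replace x with y by Cring end end. exact HK.
Qed.

(** By the mean value theorem, each term is at most [1 / d] times a difference
    of two successive values of [y^(- d)], and these differences telescope. *)
Lemma ex_series_power (x d : R) :
  0 < x -> 0 < d -> ex_series (fun n => Rpower (INR n + x) (- (1 + d))).
Proof.
intros Hx Hd. apply ex_series_incr_1.
assert (Hpos : forall n, 0 < INR n + x) by (intros n; pose proof (pos_INR n); lra).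
apply (ex_series_le (K := R_AbsRing) (V := R_CompleteNormedModule) _
  (fun n => / d * (Rpower (INR n + x) (- d) - Rpower (INR (S n) + x) (- d)))).
- intros n. change (Rabs (Rpower (INR (S n) + x) (- (1 + d)))
    <= / d * (Rpower (INR n + x) (- d) - Rpower (INR (S n) + x) (- d))).
  rewrite Rabs_pos_eq by apply Rlt_le, exp_pos. rewrite S_INR.
  specialize (Hpos n). set (y := INR n + x) in *.
  replace (INR n + 1 + x) with (y + 1) by (unfold y; ring).
  destruct (MVT_gen (fun t => Rpower t (- d)) y (y + 1)
    (fun t => - d * Rpower t (- d - 1))) as [c [Hc E]].
  + intros t Ht. rewrite Rmin_left in Ht by lra.
    apply is_derive_Reals, derivable_pt_lim_power. lra.
  + intros t Ht. rewrite Rmin_left in Ht by lra.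
    apply derivable_continuous_pt. eexists. apply derivable_pt_lim_power. lra.
  + rewrite Rmin_left, Rmax_right in Hc by lra.
    assert (Hm : Rpower (y + 1) (- (1 + d)) <= Rpower c (- d - 1)).
    { unfold Rpower. destruct (Req_dec c (y + 1)) as [->|Hne].
      - right. f_equal. ring.
      - apply Rlt_le, exp_increasing.
        assert (ln c < ln (y + 1)) by (apply ln_increasing; lra). nra. }
    apply Rmult_le_reg_l with d; [exact Hd|].
    rewrite <- Rmult_assoc, Rinv_r, Rmult_1_l by lra. nra.
- refine (ex_series_scal (K := R_AbsRing) (V := R_NormedModule) (/ d) _ _).
  set (u := fun n => Rpower (INR n + x) (- d)).
  assert (Hs : forall n, sum_n (fun n => u n - u (S n)) n = u 0%nat - u (S n)).
  { induction n as [|n IH]; [apply sum_O|].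
    rewrite sum_Sn, IH. change plus with Rplus.
    match goal with |- @eq _ ?a ?b => change (@eq R a b) end. ring. }
  apply (ex_finite_lim_seq_incr (sum_n (fun n => u n - u (S n))) (u 0%nat)).
  + intros n. rewrite !Hs.
    assert (u (S (S n)) <= u (S n)); [|lra].
    unfold u, Rpower. apply Rlt_le, exp_increasing.
    assert (ln (INR (S n) + x) < ln (INR (S (S n)) + x)); [|nra].
    apply ln_increasing; [apply Hpos|]. rewrite (S_INR (S n)). lra.
  + intros n. rewrite Hs. assert (0 < u (S n)) by apply exp_pos. lra.
Qed.

(** * Integrals of complex functions depending on parameters *)

Notation Rcont f t :=
  (filterlim f (nearR t) (locally (T := C_UniformSpace) (f%function t))).
Notation CInt f a b := (RInt (V := C_R_CompleteNormedModule) f a b).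
Notation is_CInt f a b l := (is_RInt (V := C_R_CompleteNormedModule) f a b l).

Lemma RCder_continuous (f : R -> C) (t : R) (l : C) : RCder f t l -> Rcont f t.
Proof.
intros H.
exact (ex_derive_continuous (K := R_AbsRing) (V := C_R_NormedModule) f t (ex_intro _ l H)).
Qed.

Lemma is_CInt_continuous (f : R -> C) (a b : R) :
  a <= b -> (forall t, a <= t <= b -> Rcont f t) -> is_CInt f a b (CInt f a b).
Proof.
intros Hab Hf. apply (RInt_correct (V := C_R_CompleteNormedModule)).
apply (ex_RInt_continuous (V := C_R_CompleteNormedModule)).
intros t Ht. rewrite Rmin_left, Rmax_right in Ht by exact Hab. now apply Hf.
Qed.

Lemma CInt_bound (f : R -> C) (a b M : R) (l : C) :
  a <= b -> (forall t, a <= t <= b -> Cmod (f t) <= M) -> is_CInt f a b l ->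
  Cmod l <= (b - a) * M.
Proof.
intros Hab Hf Hl. rewrite Cmod_norm.
apply (norm_RInt_le_const (V := C_R_NormedModule) f a b l M Hab); [|exact Hl].
intros t Ht. rewrite <- Cmod_norm. now apply Hf.
Qed.

Lemma is_CInt_unique (f : R -> C) (a b : R) (l : C) : is_CInt f a b l -> CInt f a b = l.
Proof. exact (is_RInt_unique (V := C_R_CompleteNormedModule) f a b l). Qed.

Lemma is_CInt_FTC (f df : R -> C) (a b : R) :
  a <= b ->
  (forall t, a <= t <= b -> RCder f t (df t)) ->
  (forall t, a <= t <= b -> Rcont df t) ->
  is_CInt df a b (f b - f a)%C.
Proof.
intros Hab Hf Hc.
apply (is_RInt_derive (V := C_R_CompleteNormedModule) f df);
  intros t Ht; rewrite Rmin_left, Rmax_right in Ht by exact Hab.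
- exact (Hf t Ht).
- exact (Hc t Ht).
Qed.

Lemma is_CInt_plus (f g : R -> C) (a b : R) (l m : C) :
  is_CInt f a b l -> is_CInt g a b m -> is_CInt (fun t => (f t + g t)%C) a b (l + m)%C.
Proof. exact (is_RInt_plus (V := C_R_NormedModule) f g a b l m). Qed.

Lemma is_CInt_minus (f g : R -> C) (a b : R) (l m : C) :
  is_CInt f a b l -> is_CInt g a b m -> is_CInt (fun t => (f t - g t)%C) a b (l - m)%C.
Proof. exact (is_RInt_minus (V := C_R_NormedModule) f g a b l m). Qed.

(** Multiplication by [i] permutes the two coordinates, which are integrated
    separately. *)
Lemma is_CInt_Ci (f : R -> C) (a b : R) (l : C) :
  is_CInt f a b l -> is_CInt (fun t => (Ci * f t)%C) a b (Ci * l)%C.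
Proof.
intros H.
assert (H1 := is_RInt_fct_extend_fst (U := R_NormedModule) (V := R_NormedModule) f a b l H).
assert (H2 := is_RInt_fct_extend_snd (U := R_NormedModule) (V := R_NormedModule) f a b l H).
assert (H3 := is_RInt_fct_extend_pair (U := R_NormedModule) (V := R_NormedModule)
  (fun t => (- snd (f t), fst (f t))) a b (- snd l) (fst l)
  (is_RInt_opp (V := R_NormedModule) _ _ _ _ H2) H1).
replace (Ci * l)%C with (- snd l, fst l).
2:{ unfold Ci, Cmult; simpl. f_equal; ring. }
eapply is_RInt_ext; [|exact H3]. intros t _.
unfold Ci, Cmult; simpl. f_equal; ring.
Qed.

Lemma is_CInt_Rscal (f : R -> C) (x a b : R) (l : C) :
  is_CInt f a b l -> is_CInt (fun t => (RtoC x * f t)%C) a b (RtoC x * l)%C.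
Proof.
intros H. rewrite <- scal_R_Cmult.
eapply is_RInt_ext; [|exact (is_RInt_scal (V := C_R_NormedModule) f a b x l H)].
intros t _. apply (scal_R_Cmult x).
Qed.

Lemma is_CInt_scal (f : R -> C) (c : C) (a b : R) (l : C) :
  is_CInt f a b l -> is_CInt (fun t => (c * f t)%C) a b (c * l)%C.
Proof.
intros H. destruct c as [x y].
assert (H1 := is_CInt_Rscal f x a b l H).
assert (H2 := is_CInt_Rscal _ y a b _ (is_CInt_Ci f a b l H)).
assert (E : forall w, ((x, y) * w)%C = (RtoC x * w + RtoC y * (Ci * w))%C).
{ intros w. unfold RtoC, Ci, Cmult, Cplus; simpl. f_equal; ring. }
rewrite E. eapply is_RInt_ext; [|exact (is_CInt_plus _ _ a b _ _ H1 H2)].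
intros t _. now rewrite E.
Qed.

Lemma is_CInt_Chasles (f : R -> C) (a b c : R) (l m : C) :
  is_CInt f a b l -> is_CInt f b c m -> is_CInt f a c (l + m)%C.
Proof. exact (is_RInt_Chasles (V := C_R_NormedModule) f a b c l m). Qed.

Lemma is_CInt_ext (f g : R -> C) (a b : R) (l : C) :
  a <= b -> (forall t, a <= t <= b -> f t = g t) -> is_CInt f a b l -> is_CInt g a b l.
Proof.
intros Hab H. apply is_RInt_ext. intros t Ht.
rewrite Rmin_left, Rmax_right in Ht by exact Hab. apply H; lra.
Qed.

Lemma is_CInt_const (a b : R) (c : C) : is_CInt (fun _ => c) a b (RtoC (b - a) * c)%C.
Proof. rewrite <- scal_R_Cmult. exact (is_RInt_const (V := C_R_NormedModule) a b c). Qed.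

(** The set of the [u] for which the property holds on a product neighbourhood
    of the fibre over [[a, u]] contains its supremum, and extends beyond it unless
    the supremum is [b]. *)
Lemma tube {T : Type} (F : (T -> Prop) -> Prop) {FF : Filter F}
  (P : T -> R -> Prop) (a b : R) :
  a <= b ->
  (forall t, a <= t <= b -> filter_prod F (nearR t) (fun p => P (fst p) (snd p))) ->
  F (fun x => forall t, a <= t <= b -> P x t).
Proof.
intros Hab H.
set (E := fun u => a <= u <= b /\ F (fun x => forall t, a <= t <= u -> P x t)).
assert (Hloc : forall t, a <= t <= b -> exists d, 0 < d /\
  F (fun x => forall u, Rabs (u - t) < d -> P x u)).
{ intros t Ht. destruct (H t Ht) as [Q S HQ [d Hd] HQS]. exists d.
  split; [apply cond_pos|]. revert HQ. apply filter_imp. intros x Hx u Hu.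
  apply (HQS x u Hx), Hd, Hu. }
assert (Ha : E a).
{ split; [lra|]. destruct (Hloc a ltac:(lra)) as [d [Hd HF]]. revert HF.
  apply filter_imp. intros x Hx t Ht. apply Hx.
  replace (t - a) with 0 by lra. now rewrite Rabs_R0. }
destruct (completeness E) as [c [Hc1 Hc2]].
- exists b. intros u [Hu _]. lra.
- exists a. exact Ha.
- assert (Hac : a <= c) by now apply Hc1.
  assert (Hcb : c <= b) by (apply Hc2; intros u [Hu _]; lra).
  destruct (Hloc c ltac:(lra)) as [d [Hd HF]].
  assert (Hu : exists u, E u /\ c - d < u).
  { apply NNPP. intros Hn. assert (c <= c - d); [|lra].
    apply Hc2. intros u Hu. apply Rnot_lt_le. intros Hlt. apply Hn. now exists u. }
  destruct Hu as [u [[Hu HFu] Hcu]].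
  assert (Hv : F (fun x => forall t, a <= t <= Rmin b (c + d / 2) -> P x t)).
  { generalize (filter_and _ _ HFu HF). apply filter_imp. intros x [H1 H2] t Ht.
    assert (Hm1 := Rmin_r b (c + d / 2)).
    destruct (Rle_dec t u); [apply H1; lra | apply H2, Rabs_def1; lra]. }
  destruct (Rle_dec b (c + d / 2)) as [Hle|Hgt].
  + rewrite Rmin_left in Hv by exact Hle. exact Hv.
  + rewrite Rmin_right in Hv by lra.
    assert (c + d / 2 <= c); [|lra]. apply Hc1. split; [lra | exact Hv].
Qed.

Lemma filter_prod_slice {T : Type} (F : (T -> Prop) -> Prop) {FF : Filter F}
  (t : R) (f : T -> R -> C) (z : T) (l : C) :
  (forall P, F P -> P z) ->
  Clim (filter_prod F (nearR t)) (fun p => f (fst p) (snd p)) l ->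
  Clim (nearR t) (f z) l.
Proof.
intros Hz H P HP. destruct (H P HP) as [Q S HQ HS HQS]. unfold filtermap in *.
revert HS. apply filter_imp. intros u Hu. exact (HQS z u (Hz Q HQ) Hu).
Qed.

Lemma nearC_point (z : C) (P : C -> Prop) : nearC z P -> P z.
Proof. apply locally_singleton. Qed.

(** Heine's theorem in the form needed under the integral sign: [tube] makes the
    estimates given by joint continuity uniform on the compact interval. *)
Lemma uniform_near {T : Type} (F : (T -> Prop) -> Prop) {FF : Filter F}
  (f : T -> R -> C) (z : T) (a b eps : R) :
  a <= b -> 0 < eps ->
  (forall P, F P -> P z) ->
  (forall t, a <= t <= b ->
    Clim (filter_prod F (nearR t)) (fun p => f (fst p) (snd p)) (f z t)) ->
  F (fun x => forall t, a <= t <= b -> Cmod (f x t - f z t) < eps).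
Proof.
intros Hab He Hz H. apply (tube F (fun x t => Cmod (f x t - f z t) < eps)); [exact Hab|].
intros t Ht.
assert (H1 := proj1 (Clim_iff _ _) (H t Ht) (eps / 2) ltac:(lra)).
assert (H2 := proj1 (Clim_iff _ _) (filter_prod_slice F t f z _ Hz (H t Ht)) (eps / 2) ltac:(lra)).
assert (H3 : filter_prod F (nearR t) (fun p => Cmod (f z (snd p) - f z t) < eps / 2)).
{ exact (filterlim_snd (F := F) (G := nearR t) _ H2). }
generalize (filter_and _ _ H1 H3). apply filter_imp. intros [x u] [H4 H5]. simpl in *.
replace (f x u - f z u)%C with ((f x u - f z t) + - (f z u - f z t))%C by ring.
eapply Rle_lt_trans; [apply Cmod_triangle|]. rewrite Cmod_opp. lra.
Qed.

Lemma CInt_param_continuous {T : Type} (F : (T -> Prop) -> Prop) {FF : Filter F}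
  (f : T -> R -> C) (z : T) (a b : R) :
  a <= b ->
  (forall P, F P -> P z) ->
  F (fun x => forall t, a <= t <= b -> Rcont (f x) t) ->
  (forall t, a <= t <= b ->
    Clim (filter_prod F (nearR t)) (fun p => f (fst p) (snd p)) (f z t)) ->
  Clim F (fun x => CInt (f x) a b) (CInt (f z) a b).
Proof.
intros Hab Hz Hc H. apply Clim_iff. intros eps He.
assert (Hd : 0 < eps / (1 + (b - a))) by (apply Rdiv_lt_0_compat; lra).
generalize (filter_and _ _ Hc (uniform_near F f z a b _ Hab Hd Hz H)).
apply filter_imp. intros x [Hcx Hx].
assert (Hcz : forall t, a <= t <= b -> Rcont (f z) t).
{ intros t Ht. exact (filter_prod_slice F t f z _ Hz (H t Ht)). }
assert (HI := is_CInt_minus _ _ _ _ _ _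
  (is_CInt_continuous (f x) a b Hab Hcx) (is_CInt_continuous (f z) a b Hab Hcz)).
eapply Rle_lt_trans.
- refine (CInt_bound _ a b (eps / (1 + (b - a))) _ Hab _ HI).
  intros t Ht. now apply Rlt_le, Hx.
- apply Rmult_lt_reg_r with (1 + (b - a)); [lra|].
  replace ((b - a) * (eps / (1 + (b - a))) * (1 + (b - a))) with ((b - a) * eps)
    by (field; lra). nra.
Qed.

(** The error of the linear approximation of [f . t] at [z] is controlled by the
    oscillation of [df . t], which is small uniformly in [t]. *)
Lemma Cder_CInt (f df : C -> R -> C) (z : C) (a b r : R) :
  a <= b -> 0 < r ->
  (forall w t, Cmod (w - z) < r -> a <= t <= b -> Cder (fun v => f v t) w (df w t)) ->
  (forall w t, Cmod (w - z) < r -> a <= t <= b -> Rcont (f w) t) ->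
  (forall t, a <= t <= b ->
    Clim (filter_prod (nearC z) (nearR t)) (fun p => df (fst p) (snd p)) (df z t)) ->
  Cder (fun w => CInt (f w) a b) z (CInt (df z) a b).
Proof.
intros Hab Hr Hf Hc Hd. apply Cder_iff. intros eps He.
assert (He1 : 0 < eps / (1 + (b - a))) by (apply Rdiv_lt_0_compat; lra).
assert (Hu := uniform_near (nearC z) df z a b _ Hab He1 (nearC_point z) Hd).
apply nearC_iff in Hu. destruct Hu as [d [Hd0 Hu]].
exists (Rmin d r). split; [now apply Rmin_pos|]. intros w Hw.
assert (Hw1 := Rlt_le_trans _ _ _ Hw (Rmin_l _ _)).
assert (Hw2 := Rlt_le_trans _ _ _ Hw (Rmin_r _ _)).
assert (Hzz := Cmod_refl_lt z r Hr).
assert (Hcd : forall t, a <= t <= b -> Rcont (df z) t).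
{ intros t Ht. exact (filter_prod_slice (nearC z) t df z _ (nearC_point z) (Hd t Ht)). }
assert (HI := is_CInt_minus _ _ _ _ _ _
  (is_CInt_minus _ _ _ _ _ _
    (is_CInt_continuous (f w) a b Hab (fun t => Hc w t Hw2))
    (is_CInt_continuous (f z) a b Hab (fun t => Hc z t Hzz)))
  (is_CInt_scal _ (w - z)%C _ _ _ (is_CInt_continuous (df z) a b Hab Hcd))).
eapply Rle_trans.
- refine (CInt_bound _ a b (eps / (1 + (b - a)) * Cmod (w - z)) _ Hab _ HI).
  intros t Ht. apply (Cder_mean_value (fun v => f v t) (fun v => df v t)).
  + intros u Hu'. apply Hf; [|exact Ht].
    eapply Rle_lt_trans; [now apply segment_close | exact Hw2].
  + intros u Hu'. apply Rlt_le, Hu; [|exact Ht].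
    eapply Rle_lt_trans; [now apply segment_close | exact Hw1].
- rewrite <- Rmult_assoc. apply Rmult_le_compat_r; [apply Cmod_ge_0|].
  apply Rmult_le_reg_r with (1 + (b - a)); [lra|].
  replace ((b - a) * (eps / (1 + (b - a))) * (1 + (b - a))) with ((b - a) * eps)
    by (field; lra). nra.
Qed.

(** * The complex exponential *)

Lemma exp_le_compat (x y : R) : x <= y -> exp x <= exp y.
Proof. intros [H|H]; [now apply Rlt_le, exp_increasing | rewrite H; apply Rle_refl]. Qed.

Lemma ln_le_compat (x y : R) : 0 < x -> x <= y -> ln x <= ln y.
Proof. intros Hx [H|H]; [now apply Rlt_le, ln_increasing | rewrite H; apply Rle_refl]. Qed.

Lemma ln_le_minus_1 (x : R) : 0 < x -> ln x <= x - 1.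
Proof. intros Hx. assert (A := exp_ineq1_le (ln x)). rewrite exp_ln in A by exact Hx. lra. Qed.

Lemma RCder_pair (f g : R -> R) (t a b : R) :
  is_derive f t a -> is_derive g t b -> RCder (fun u => (f u, g u)) t (a, b).
Proof.
intros [_ Hf] [_ Hg]. apply RCder_iff. intros eps He.
assert (He2 : 0 < eps / 2) by lra.
destruct (Hf t (fun P HP => HP) (mkposreal _ He2)) as [d1 H1].
destruct (Hg t (fun P HP => HP) (mkposreal _ He2)) as [d2 H2].
exists (Rmin d1 d2). split; [apply Rmin_pos; apply cond_pos|]. intros u Hu.
specialize (H1 u (Rlt_le_trans _ _ _ Hu (Rmin_l _ _))).
specialize (H2 u (Rlt_le_trans _ _ _ Hu (Rmin_r _ _))).
change (Rabs (f u - f t - (u - t) * a) <= eps / 2 * Rabs (u - t)) in H1.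
change (Rabs (g u - g t - (u - t) * b) <= eps / 2 * Rabs (u - t)) in H2.
eapply Rle_trans; [apply Cmod_le_sum|].
unfold Cminus, Cplus, Copp, Cmult, RtoC, Re, Im; simpl.
replace (f u + - f t + - ((u - t) * a - 0 * b)) with (f u - f t - (u - t) * a) by ring.
replace (g u + - g t + - ((u - t) * b + 0 * a)) with (g u - g t - (u - t) * b) by ring.
lra.
Qed.

Lemma RCder_RtoC (t : R) : RCder RtoC t (RtoC 1).
Proof. apply (RCder_pair (fun u => u) (fun _ => 0) t 1 0); auto_derive; trivial. Qed.

Lemma RCder_translate (q : C) (t : R) : RCder (fun u => (q + RtoC u)%C) t (RtoC 1).
Proof.
eapply RCder_eq.
- apply (Cder_RCder_comp (fun v => (q + v)%C) RtoC); [|apply RCder_RtoC].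
  apply (Cder_translate_l (fun v => v)), Cder_id.
- ring.
Qed.

Lemma Cexp_0 : Cexp (RtoC 0) = 1.
Proof.
unfold Cexp, RtoC, Re, Im; simpl. rewrite exp_0, cos_0, sin_0. f_equal; ring.
Qed.

Lemma Cexp_plus (z w : C) : Cexp (z + w)%C = (Cexp z * Cexp w)%C.
Proof.
unfold Cexp, Cmult, Cplus, Re, Im; simpl. rewrite exp_plus, cos_plus, sin_plus.
f_equal; ring.
Qed.

Lemma Cexp_R (x : R) : Cexp (RtoC x) = RtoC (exp x).
Proof. unfold Cexp, RtoC, Re, Im; simpl. rewrite cos_0, sin_0. f_equal; ring. Qed.

Lemma Cexp_opp_l (z : C) : (Cexp (- z) * Cexp z)%C = 1.
Proof. rewrite <- Cexp_plus. replace (- z + z)%C with (RtoC 0) by ring. apply Cexp_0. Qed.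

Lemma Cexp_neq_0 (z : C) : Cexp z <> RtoC 0.
Proof.
intros H. assert (E := Cexp_opp_l z). rewrite H, Cmult_0_r in E.
apply C1_nz. now rewrite E.
Qed.

Lemma Cexp_opp (z : C) : Cexp (- z) = (/ Cexp z)%C.
Proof.
assert (E := Cexp_opp_l z). assert (H := Cexp_neq_0 z).
replace (Cexp (- z)) with (Cexp (- z) * Cexp z * / Cexp z)%C by (field; exact H).
rewrite E. ring.
Qed.

Lemma Cmod_Cexp (z : C) : Cmod (Cexp z) = exp (Re z).
Proof.
unfold Cexp, Cmod; simpl.
replace (exp (Re z) * cos (Im z) * (exp (Re z) * cos (Im z) * 1)
  + exp (Re z) * sin (Im z) * (exp (Re z) * sin (Im z) * 1))
  with (exp (Re z) * exp (Re z) * (Rsqr (sin (Im z)) + Rsqr (cos (Im z))))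
  by (unfold Rsqr; ring).
rewrite sin2_cos2, Rmult_1_r. apply sqrt_square, Rlt_le, exp_pos.
Qed.

Lemma RCder_Cexp_line (w : C) (t : R) :
  RCder (fun u => Cexp (RtoC u * w)) t (w * Cexp (RtoC t * w))%C.
Proof.
destruct w as [x y].
assert (E : forall u, Cexp (RtoC u * (x, y)) = (exp (u * x) * cos (u * y), exp (u * x) * sin (u * y))).
{ intros u. unfold Cexp, RtoC, Cmult, Re, Im; simpl.
  replace (u * x - 0 * y) with (u * x) by ring.
  replace (u * y + 0 * x) with (u * y) by ring. reflexivity. }
rewrite E. apply (is_derive_ext (K := R_AbsRing) (V := C_R_NormedModule)
  (fun u => (exp (u * x) * cos (u * y), exp (u * x) * sin (u * y)))).
{ intros u. now rewrite E. }
unfold Cmult; simpl. apply RCder_pair; auto_derive; trivial; ring.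
Qed.

(** Along the ray [t |-> t w], the derivative of [e^(t w) - t w] is
    [w (e^(t w) - 1)], which is of second order in [w]. *)
Lemma Cder_Cexp_0 : Cder Cexp (RtoC 0) (RtoC 1).
Proof.
apply Cder_iff. intros eps He.
exists (Rmin 1 (eps / exp 1)).
assert (H1 := exp_pos 1).
split. { apply Rmin_pos; [lra|]. now apply Rdiv_lt_0_compat. }
intros w Hw. rewrite Cexp_0.
replace (w - 0)%C with w in * by ring.
assert (Hw1 := Rlt_le_trans _ _ _ Hw (Rmin_l _ _)).
assert (Hw2 := Rlt_le_trans _ _ _ Hw (Rmin_r _ _)).
assert (Hw0 := Cmod_ge_0 w).
assert (B : forall t, 0 <= t <= 1 -> Cmod (Cexp (RtoC t * w)) <= exp 1).
{ intros t Ht. rewrite Cmod_Cexp.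
  assert (Re (RtoC t * w) <= 1).
  { eapply Rle_trans; [apply Re_le_Cmod|].
    rewrite Cmod_mult, Cmod_R, Rabs_pos_eq by lra. nra. }
  now apply exp_le_compat. }
assert (E0 : forall v, Cexp (RtoC 0 * v) = 1).
{ intros v. rewrite Cmult_0_l. apply Cexp_0. }
assert (B2 : forall t, 0 <= t <= 1 -> Cmod (Cexp (RtoC t * w) - 1) <= Cmod w * exp 1).
{ intros t Ht. rewrite <- (E0 w).
  eapply Rle_trans.
  - apply (path_mean_value (fun u => Cexp (RtoC u * w))
      (fun u => (w * Cexp (RtoC u * w))%C) 0 t (Cmod w * exp 1));
      [lra | intros u _; apply RCder_Cexp_line |].
    intros u Hu. rewrite Cmod_mult. apply Rmult_le_compat_l; [exact Hw0 | apply B; lra].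
  - assert (0 <= Cmod w * exp 1) by nra. nra. }
replace (Cexp w - 1 - w * 1)%C
  with ((Cexp (RtoC 1 * w) - (RtoC 0 + 1 * w))
        - (Cexp (RtoC 0 * w) - (RtoC 0 + 0 * w)))%C.
2:{ rewrite E0, Cmult_1_l. ring. }
eapply Rle_trans.
- apply (path_mean_value (fun u => (Cexp (RtoC u * w) - (RtoC 0 + RtoC u * w))%C)
    (fun u => (w * Cexp (RtoC u * w) - w)%C) 0 1 (Cmod w * (Cmod w * exp 1))); [lra | |].
  + intros t _. exact (is_derive_minus (K := R_AbsRing) (V := C_R_NormedModule) _ _ _ _ _
      (RCder_Cexp_line w t) (RCder_line (RtoC 0) w t)).
  + intros t Ht. replace (w * Cexp (RtoC t * w) - w)%C
      with (w * (Cexp (RtoC t * w) - 1))%C by ring.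
    rewrite Cmod_mult. apply Rmult_le_compat_l; [exact Hw0 | now apply B2].
- assert (Cmod w * exp 1 <= eps); [|nra].
  apply Rmult_le_reg_r with (/ exp 1); [now apply Rinv_0_lt_compat|].
  rewrite Rmult_assoc, Rinv_r by lra. unfold Rdiv in Hw2. lra.
Qed.

Lemma Cder_Cexp (z : C) : Cder Cexp z (Cexp z).
Proof.
apply (Cder_ext (fun w => (Cexp z * Cexp (w - z))%C)).
{ apply filter_forall. intros w. rewrite <- Cexp_plus. f_equal. ring. }
apply Cder_eq with (Cexp z * (RtoC 1 * 1))%C; [|ring].
apply (Cder_scal (fun w => Cexp (w - z)%C)), (Cder_comp Cexp (fun w => (w - z)%C)).
- replace (z - z)%C with (RtoC 0) by ring. apply Cder_Cexp_0.
- apply Cder_sub_const.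
Qed.

Lemma Clim_Cexp {T : Type} {F} {FF : @Filter T F} (f : T -> C) (a : C) :
  Clim F f a -> Clim F (fun x => Cexp (f x)) (Cexp a).
Proof.
intros H. apply (Clim_comp f Cexp a); [exact H | exact (Cder_continuous _ _ _ (Cder_Cexp a))].
Qed.

Lemma Cder_Cexp_comp (f : C -> C) (z a : C) :
  Cder f z a -> Cder (fun w => Cexp (f w)) z (a * Cexp (f z))%C.
Proof. intros H. apply (Cder_comp Cexp f); [apply Cder_Cexp | exact H]. Qed.

(** * Goursat's theorem and the identity theorem *)

Definition entire (f : C -> C) : Prop := forall z, exists l, Cder f z l.

Lemma entire_continuous (f : C -> C) (z : C) : entire f -> Clim (nearC z) f (f z).
Proof. intros H. destruct (H z) as [l Hl]. exact (Cder_continuous f z l Hl). Qed.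

Definition ccont (f : C -> C) : Prop := forall z, Clim (nearC z) f (f z).

Lemma RCder_hor (y t : R) : RCder (fun u => (u, y)) t (RtoC 1).
Proof. apply (RCder_pair (fun u => u) (fun _ => y) t 1 0); auto_derive; trivial. Qed.

Lemma RCder_ver (x t : R) : RCder (fun u => (x, u)) t Ci.
Proof. apply (RCder_pair (fun _ => x) (fun u => u) t 0 1); auto_derive; trivial. Qed.

Lemma Rcont_hor (f : C -> C) (y t : R) : ccont f -> Rcont (fun u => f (u, y)) t.
Proof.
intros H. apply (Clim_comp (fun u => (u, y)) f (t, y)); [|apply H].
exact (RCder_continuous _ _ _ (RCder_hor y t)).
Qed.

Lemma Rcont_ver (f : C -> C) (x t : R) : ccont f -> Rcont (fun u => f (x, u)) t.
Proof.
intros H. apply (Clim_comp (fun u => (x, u)) f (x, t)); [|apply H].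
exact (RCder_continuous _ _ _ (RCder_ver x t)).
Qed.

Definition hor (f : C -> C) (a b y : R) : C := CInt (fun x => f (x, y)) a b.
Definition ver (f : C -> C) (x c d : R) : C := CInt (fun y => f (x, y)) c d.

(** The integral along the boundary of [[a, b] x [c, d]], counterclockwise when
    [a <= b] and [c <= d]. *)
Definition rect (f : C -> C) (a b c d : R) : C :=
  (hor f a b c - hor f a b d + Ci * (ver f b c d - ver f a c d))%C.

Lemma ex_CInt_cont (f : R -> C) (a b : R) :
  (forall t, Rcont f t) -> ex_RInt (V := C_R_CompleteNormedModule) f a b.
Proof.
intros H. apply (ex_RInt_continuous (V := C_R_CompleteNormedModule)). intros t _. apply H.
Qed.

Lemma is_hor (f : C -> C) (a b y : R) :
  ccont f -> is_CInt (fun x => f (x, y)) a b (hor f a b y).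
Proof.
intros H. apply (RInt_correct (V := C_R_CompleteNormedModule)).
apply ex_CInt_cont. intros t. now apply Rcont_hor.
Qed.

Lemma is_ver (f : C -> C) (x c d : R) :
  ccont f -> is_CInt (fun y => f (x, y)) c d (ver f x c d).
Proof.
intros H. apply (RInt_correct (V := C_R_CompleteNormedModule)).
apply ex_CInt_cont. intros t. now apply Rcont_ver.
Qed.

Lemma hor_Chasles (f : C -> C) (a m b y : R) :
  ccont f -> hor f a b y = (hor f a m y + hor f m b y)%C.
Proof.
intros H. apply is_CInt_unique. now apply is_CInt_Chasles with m; apply is_hor.
Qed.

Lemma ver_Chasles (f : C -> C) (x c m d : R) :
  ccont f -> ver f x c d = (ver f x c m + ver f x m d)%C.
Proof.
intros H. apply is_CInt_unique. now apply is_CInt_Chasles with m; apply is_ver.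
Qed.

Lemma CInt_bound_abs (f : R -> C) (a b M : R) (l : C) :
  (forall t, Rmin a b <= t <= Rmax a b -> Cmod (f t) <= M) -> is_CInt f a b l ->
  Cmod l <= Rabs (b - a) * M.
Proof.
intros Hf Hl. destruct (Rle_dec a b) as [Hab|Hab].
- rewrite Rmin_left, Rmax_right in Hf by exact Hab.
  rewrite Rabs_pos_eq by lra. now apply (CInt_bound f).
- rewrite Rmin_right, Rmax_left in Hf by lra.
  rewrite Rabs_left by lra. rewrite <- Cmod_opp.
  replace (- (b - a)) with (a - b) by ring.
  apply (CInt_bound f); [lra | exact Hf |].
  exact (is_RInt_swap (V := C_R_NormedModule) f b a l Hl).
Qed.

Lemma rect_minus (f g : C -> C) (a b c d : R) : ccont f -> ccont g ->
  rect (fun z => (f z - g z)%C) a b c d = (rect f a b c d - rect g a b c d)%C.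
Proof.
intros Hf Hg.
assert (H1 : forall y, hor (fun z => (f z - g z)%C) a b y = (hor f a b y - hor g a b y)%C).
{ intros y. apply is_CInt_unique.
  apply (is_CInt_minus (fun x => f (x, y)) (fun x => g (x, y))); now apply is_hor. }
assert (H2 : forall x, ver (fun z => (f z - g z)%C) x c d = (ver f x c d - ver g x c d)%C).
{ intros x. apply is_CInt_unique.
  apply (is_CInt_minus (fun y => f (x, y)) (fun y => g (x, y))); now apply is_ver. }
unfold rect. rewrite !H1, !H2. ring.
Qed.

Lemma rect_primitive (f g : C -> C) (a b c d : R) : a <= b -> c <= d ->
  (forall z, Cder f z (g z)) -> ccont g -> rect g a b c d = 0.
Proof.
intros Hab Hcd Hf Hg.
assert (H1 : forall y, hor g a b y = (f (b, y) - f (a, y))%C).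
{ intros y. apply is_CInt_unique.
  apply (is_CInt_FTC (fun x => f (x, y))); [exact Hab | |].
  - intros t _. eapply RCder_eq.
    + exact (Cder_RCder_comp f (fun u => (u, y)) t _ _ (Hf (t, y)) (RCder_hor y t)).
    + ring.
  - intros t _. now apply Rcont_hor. }
assert (H2 : forall x, (Ci * ver g x c d)%C = (f (x, d) - f (x, c))%C).
{ intros x.
  rewrite <- (is_CInt_unique _ _ _ _ (is_CInt_scal _ Ci _ _ _ (is_ver g x c d Hg))).
  apply is_CInt_unique.
  apply (is_CInt_FTC (fun y => f (x, y))); [exact Hcd | |].
  - intros t _. exact (Cder_RCder_comp f (fun u => (x, u)) t _ _ (Hf (x, t)) (RCder_ver x t)).
  - intros t _. apply Clim_mult; [apply Clim_const | now apply Rcont_ver]. }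
unfold rect.
replace (Ci * (ver g b c d - ver g a c d))%C
  with (Ci * ver g b c d - Ci * ver g a c d)%C by ring.
rewrite !H1, !H2. ring.
Qed.

Lemma rect_bound (f : C -> C) (a b c d M : R) : a <= b -> c <= d -> ccont f ->
  (forall x y, a <= x <= b -> c <= y <= d -> Cmod (f (x, y)) <= M) ->
  Cmod (rect f a b c d) <= 2 * ((b - a) + (d - c)) * M.
Proof.
intros Hab Hcd Hf HM.
assert (H1 : forall y, c <= y <= d -> Cmod (hor f a b y) <= (b - a) * M).
{ intros y Hy. apply (CInt_bound (fun x => f (x, y))); [exact Hab | | now apply is_hor].
  intros t Ht. now apply HM. }
assert (H2 : forall x, a <= x <= b -> Cmod (ver f x c d) <= (d - c) * M).
{ intros x Hx. apply (CInt_bound (fun y => f (x, y))); [exact Hcd | | now apply is_ver].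
  intros t Ht. now apply HM. }
unfold rect, Cminus.
eapply Rle_trans; [apply Cmod_triangle|].
eapply Rle_trans; [apply Rplus_le_compat; [apply Cmod_triangle | apply Req_le, Cmod_mult]|].
rewrite Cmod_Ci, Rmult_1_l.
eapply Rle_trans; [apply Rplus_le_compat_l, Cmod_triangle|].
rewrite !Cmod_opp.
assert (A1 := H1 c ltac:(lra)). assert (A2 := H1 d ltac:(lra)).
assert (A3 := H2 a ltac:(lra)). assert (A4 := H2 b ltac:(lra)). lra.
Qed.

(** The affine approximation of [f] at [z] has a primitive, so only the error of
    the approximation contributes to the integral. *)
Lemma rect_local (f : C -> C) (z : C) (eps : R) : entire f -> 0 < eps ->
  exists r, 0 < r /\ forall a b c d, a <= Re z <= b -> c <= Im z <= d ->
    (b - a) + (d - c) < r ->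
    Cmod (rect f a b c d) <= 2 * eps * ((b - a) + (d - c)) ^ 2.
Proof.
intros Hf He. destruct (Hf z) as [l Hl].
destruct (proj1 (Cder_iff f z l) Hl eps He) as [r [Hr H]].
exists r. split; [exact Hr|]. intros a b c d Hx Hy Hs.
set (P := fun w => ((f z - z * l) * w + l * / RtoC 2 * (w * w))%C).
set (g := fun w => (f z + (w - z) * l)%C).
assert (HP : forall w, Cder P w (g w)).
{ intros w. eapply Cder_eq.
  - apply (Cder_plus (fun w => ((f z - z * l) * w)%C)); apply Cder_scal;
      [apply Cder_id | apply (Cder_mult (fun w => w)); apply Cder_id].
  - unfold g. field. }
assert (Hg : ccont g).
{ intros w. unfold g. apply Clim_plus; [apply Clim_const|].
  apply Clim_mult; [|apply Clim_const].
  apply Clim_minus; [apply filterlim_id | apply Clim_const]. }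
assert (Hfc : ccont f) by (intros w; now apply entire_continuous).
replace (rect f a b c d) with (rect (fun w => (f w - g w)%C) a b c d).
2:{ rewrite rect_minus by assumption.
    rewrite (rect_primitive P g) by (assumption || lra). ring. }
replace (2 * eps * (b - a + (d - c)) ^ 2)
  with (2 * ((b - a) + (d - c)) * (eps * ((b - a) + (d - c)))) by ring.
apply rect_bound; [lra | lra | |].
- intros w. apply Clim_minus; [apply Hfc | apply Hg].
- intros x y Hx' Hy'. unfold g.
  assert (Hw : Cmod ((x, y) - z) <= (b - a) + (d - c)).
  { eapply Rle_trans; [apply Cmod_le_sum|].
    unfold Cminus. rewrite re_plus, im_plus, re_opp, im_opp. unfold Re at 1, Im at 1; simpl.
    apply Rplus_le_compat; apply Rabs_le; lra. }
  replace (f (x, y) - (f z + ((x, y) - z) * l))%C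
    with (f (x, y) - f z - ((x, y) - z) * l)%C by ring.
  eapply Rle_trans; [apply H; lra|]. apply Rmult_le_compat_l; lra.
Qed.

(** The integrals around the four quarters add up to the integral around the
    whole: one of them carries at least a quarter of it. *)
Lemma rect_quarter (f : C -> C) (x y w h : R) : ccont f -> 0 <= w -> 0 <= h ->
  exists x' y', x <= x' /\ x' + w / 2 <= x + w /\ y <= y' /\ y' + h / 2 <= y + h /\
    Cmod (rect f x (x + w) y (y + h))
      <= 4 * Cmod (rect f x' (x' + w / 2) y' (y' + h / 2)).
Proof.
intros Hf Hw Hh. apply NNPP. intros Hn.
set (S := Cmod (rect f x (x + w) y (y + h))) in *.
set (u := x + w / 2). set (v := y + h / 2).
assert (Q : forall x' y', (x' = x \/ x' = u) -> (y' = y \/ y' = v) ->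
  4 * Cmod (rect f x' (x' + w / 2) y' (y' + h / 2)) < S).
{ intros x' y' Hx' Hy'. apply Rnot_le_lt. intros Hle. apply Hn.
  exists x', y'. unfold u, v in *. repeat split; try exact Hle;
    destruct Hx' as [->| ->]; destruct Hy' as [->| ->]; lra. }
assert (Q1 := Q x y ltac:(auto) ltac:(auto)).
assert (Q2 := Q u y ltac:(auto) ltac:(auto)).
assert (Q3 := Q x v ltac:(auto) ltac:(auto)).
assert (Q4 := Q u v ltac:(auto) ltac:(auto)).
replace (u + w / 2) with (x + w) in * by (unfold u; field).
replace (v + h / 2) with (y + h) in * by (unfold v; field).
fold u in Q1, Q3. fold v in Q1, Q2.
assert (E : rect f x (x + w) y (y + h)
  = (rect f x u y v + rect f u (x + w) y v
     + (rect f x u v (y + h) + rect f u (x + w) v (y + h)))%C).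
{ unfold rect.
  rewrite (hor_Chasles f x u (x + w) y), (hor_Chasles f x u (x + w) (y + h)) by exact Hf.
  rewrite (ver_Chasles f (x + w) y v (y + h)), (ver_Chasles f x y v (y + h)) by exact Hf.
  ring. }
assert (B : S <= Cmod (rect f x u y v) + Cmod (rect f u (x + w) y v)
  + (Cmod (rect f x u v (y + h)) + Cmod (rect f u (x + w) v (y + h)))).
{ unfold S. rewrite E. eapply Rle_trans; [apply Cmod_triangle|].
  apply Rplus_le_compat; apply Cmod_triangle. }
lra.
Qed.

Lemma nested_intervals (x : nat -> R) (w : R) :
  (forall n, x n <= x (S n)) ->
  (forall n, x (S n) + w / 2 ^ (S n) <= x n + w / 2 ^ n) -> 0 <= w ->
  exists c, forall n, x n <= c <= x n + w / 2 ^ n.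
Proof.
intros H1 H2 Hw.
assert (M1 : forall n k, x n <= x (n + k)%nat).
{ intros n k. induction k as [|k IH]; [rewrite Nat.add_0_r; lra|].
  rewrite Nat.add_succ_r. eapply Rle_trans; [exact IH | apply H1]. }
assert (M2 : forall n k, x (n + k)%nat + w / 2 ^ (n + k) <= x n + w / 2 ^ n).
{ intros n k. induction k as [|k IH]; [rewrite Nat.add_0_r; lra|].
  rewrite Nat.add_succ_r. eapply Rle_trans; [apply H2 | exact IH]. }
assert (M3 : forall n m, x m <= x n + w / 2 ^ n).
{ intros n m.
  assert (P : forall k, 0 <= w / 2 ^ k).
  { intros k. apply Rdiv_le_0_compat; [exact Hw | apply pow_lt; lra]. }
  destruct (Nat.le_ge_cases n m) as [L|L].
  - replace m with (n + (m - n))%nat by lia. assert (A := M2 n (m - n)%nat).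
    assert (B := P (n + (m - n))%nat). lra.
  - assert (A := M1 m (n - m)%nat). replace (m + (n - m))%nat with n in A by lia.
    assert (B := P n). lra. }
destruct (completeness (fun r => exists n, r = x n)) as [c [Hc1 Hc2]].
- exists (x 0%nat + w / 2 ^ 0). intros r [n ->]. apply M3.
- exists (x 0%nat). now exists 0%nat.
- exists c. intros n. split; [apply Hc1; now exists n|].
  apply Hc2. intros r [m ->]. apply M3.
Qed.

(** If the integral around a rectangle were nonzero, repeated quartering would
    produce rectangles shrinking to a point around which the integral is not
    small compared with the squared size, against differentiability there. *)
Lemma Goursat (f : C -> C) (a b c d : R) :
  entire f -> a <= b -> c <= d -> rect f a b c d = 0.
Proof.
intros Hf Hab Hcd.
assert (Hfc : ccont f) by (intros w; now apply entire_continuous).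
set (w := b - a). set (h := d - c).
assert (Hw : 0 <= w) by (unfold w; lra). assert (Hh : 0 <= h) by (unfold h; lra).
assert (Hp : forall n (s : R), 0 <= s -> 0 <= s / 2 ^ n).
{ intros n s Hs. apply Rdiv_le_0_compat; [exact Hs | apply pow_lt; lra]. }
set (I := fun (n : nat) (p : R * R) =>
  rect f (fst p) (fst p + w / 2 ^ n) (snd p) (snd p + h / 2 ^ n)).
assert (Hhalf : forall n (s : R), s / 2 ^ n / 2 = s / 2 ^ (S n)).
{ intros n s. simpl. field. apply pow_nonzero. lra. }
assert (Step : forall n p, exists p',
  (fst p <= fst p' /\ fst p' + w / 2 ^ (S n) <= fst p + w / 2 ^ n) /\
  (snd p <= snd p' /\ snd p' + h / 2 ^ (S n) <= snd p + h / 2 ^ n) /\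
  Cmod (I n p) <= 4 * Cmod (I (S n) p')).
{ intros n [x y].
  destruct (rect_quarter f x y (w / 2 ^ n) (h / 2 ^ n) Hfc (Hp n w Hw) (Hp n h Hh))
    as [x' [y' H]].
  rewrite !Hhalf in H. exists (x', y'). unfold I; simpl fst; simpl snd. tauto. }
set (next := fun n p => proj1_sig (constructive_indefinite_description _ (Step n p))).
assert (Hnext := fun n p => proj2_sig (constructive_indefinite_description _ (Step n p))).
cbv beta in Hnext. fold next in Hnext.
set (p := fix p (n : nat) : R * R := match n with O => (a, c) | S n => next n (p n) end).
assert (HI : forall n, Cmod (rect f a b c d) <= 4 ^ n * Cmod (I n (p n))).
{ induction n as [|n IH].
  - simpl. unfold I; simpl. replace (a + w / 1) with b by (unfold w; field).
    replace (c + h / 1) with d by (unfold h; field). lra.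
  - eapply Rle_trans; [exact IH|]. destruct (Hnext n (p n)) as [_ [_ H]].
    change (p (S n)) with (next n (p n)). simpl pow.
    assert (0 < 4 ^ n) by (apply pow_lt; lra). unfold next in *. nra. }
destruct (nested_intervals (fun n => fst (p n)) w) as [x Hx];
  [intros n; apply (Hnext n (p n)) | intros n; apply (Hnext n (p n)) | exact Hw |].
destruct (nested_intervals (fun n => snd (p n)) h) as [y Hy];
  [intros n; apply (Hnext n (p n)) | intros n; apply (Hnext n (p n)) | exact Hh |].
apply Cmod_eq_0. set (S := Cmod (rect f a b c d)) in *.
assert (HS : 0 <= S) by apply Cmod_ge_0.
apply NNPP. intros Hne.
set (eps := S / (4 * (w + h) ^ 2 + 4)).
assert (Hden : 0 < 4 * (w + h) ^ 2 + 4) by nra.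
assert (He : 0 < eps) by (apply Rdiv_lt_0_compat; lra).
destruct (rect_local f (x, y) eps Hf He) as [r [Hr Hloc]].
assert (Hn : exists n, (w + h) / 2 ^ n < r).
{ destruct (pow_lt_1_zero (/ 2) ltac:(rewrite Rabs_pos_eq; lra) (r / (w + h + 1)))
    as [n Hn]; [apply Rdiv_lt_0_compat; lra|].
  exists n. specialize (Hn n (Nat.le_refl n)).
  rewrite Rabs_pos_eq in Hn by (apply pow_le; lra). rewrite pow_inv in Hn.
  apply Rmult_lt_compat_l with (r := w + h + 1) in Hn; [|lra].
  replace ((w + h + 1) * (r / (w + h + 1))) with r in Hn by (field; lra).
  assert (0 < / 2 ^ n) by (apply Rinv_0_lt_compat, pow_lt; lra).
  unfold Rdiv. nra. }
destruct Hn as [n Hn]. specialize (HI n).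
assert (H2n : 0 < 2 ^ n) by (apply pow_lt; lra).
assert (E : w / 2 ^ n + h / 2 ^ n = (w + h) / 2 ^ n) by (field; lra).
assert (Hb : Cmod (I n (p n)) <= 2 * eps * ((w + h) / 2 ^ n) ^ 2).
{ rewrite <- E. unfold I.
  replace (w / 2 ^ n) with (fst (p n) + w / 2 ^ n - fst (p n)) at 2 by ring.
  replace (h / 2 ^ n) with (snd (p n) + h / 2 ^ n - snd (p n)) at 2 by ring.
  apply Hloc; [apply Hx | apply Hy |]. lra. }
assert (E4 : 4 ^ n = 2 ^ n * 2 ^ n).
{ replace 4 with (2 * 2) by ring. apply Rpow_mult_distr. }
assert (HSb : S <= 2 * eps * (w + h) ^ 2).
{ eapply Rle_trans; [exact HI|].
  replace (2 * eps * (w + h) ^ 2) with (4 ^ n * (2 * eps * ((w + h) / 2 ^ n) ^ 2)).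
  - apply Rmult_le_compat_l; [apply pow_le; lra | exact Hb].
  - rewrite E4. field. lra. }
assert (Ee : eps * (4 * (w + h) ^ 2 + 4) = S) by (unfold eps; field; lra).
assert (0 <= (w + h) ^ 2) by apply pow2_ge_0. nra.
Qed.

Lemma hor_swap (f : C -> C) (a b y : R) : ccont f -> hor f b a y = (- hor f a b y)%C.
Proof.
intros H. apply is_CInt_unique.
exact (is_RInt_swap (V := C_R_NormedModule) _ _ _ _ (is_hor f a b y H)).
Qed.

Lemma ver_swap (f : C -> C) (x c d : R) : ccont f -> ver f x d c = (- ver f x c d)%C.
Proof.
intros H. apply is_CInt_unique.
exact (is_RInt_swap (V := C_R_NormedModule) _ _ _ _ (is_ver f x c d H)).
Qed.

(** Exchanging two opposite sides changes the sign of the integral; the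
    primitive below is integrated over rectangles with any orientation. *)
Lemma rect_any (f : C -> C) (a b c d : R) : entire f -> rect f a b c d = 0.
Proof.
intros Hf.
assert (Hfc : ccont f) by (intros w; now apply entire_continuous).
assert (Sx : forall a b c d, rect f a b c d = (- rect f b a c d)%C).
{ intros a' b' c' d'. unfold rect. rewrite !(hor_swap f a' b') by exact Hfc. ring. }
assert (Sy : forall a b c d, rect f a b c d = (- rect f a b d c)%C).
{ intros a' b' c' d'. unfold rect. rewrite !(ver_swap f _ c' d') by exact Hfc. ring. }
destruct (Rle_dec a b) as [Hab|Hab]; destruct (Rle_dec c d) as [Hcd|Hcd].
- now apply Goursat.
- rewrite Sy, (Goursat f a b d c Hf Hab ltac:(lra)). ring.
- rewrite Sx, (Goursat f b a c d Hf ltac:(lra) Hcd). ring.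
- rewrite Sx, Sy, (Goursat f b a d c Hf ltac:(lra) ltac:(lra)). ring.
Qed.

(** An entire function that vanishes on the line [Re z = X] has the primitive
    obtained by integrating horizontally from that line: Goursat's theorem
    evaluates its increments in the vertical direction. *)
Lemma horizontal_primitive (k : C -> C) (X : R) :
  entire k -> (forall y, k (X, y) = 0) ->
  forall z, Cder (fun w => hor k X (Re w) (Im w)) z (k z).
Proof.
intros Hk HX z.
assert (Hkc : ccont k) by (intros w; now apply entire_continuous).
apply Cder_iff. intros eps He.
assert (Hc := proj1 (Clim_iff _ _) (Hkc z) (eps / 2) ltac:(lra)).
apply nearC_iff in Hc. destruct Hc as [r [Hr Hc]].
exists (r / 2). split; [lra|]. intros w Hw.
destruct z as [x y]. destruct w as [x' y']. unfold Re, Im; simpl.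
set (D := Cmod ((x', y') - (x, y))) in *.
assert (Dx : Rabs (x' - x) <= D) by exact (Re_Lipschitz (x', y') (x, y)).
assert (Dy : Rabs (y' - y) <= D) by exact (Im_Lipschitz (x', y') (x, y)).
assert (Hclose : forall s t, Rabs (s - x) <= D -> Rabs (t - y) <= D ->
  Cmod (k (s, t) - k (x, y)) <= eps / 2).
{ intros s t Hs Ht. apply Rlt_le, Hc. eapply Rle_lt_trans; [apply Cmod_le_sum|].
  unfold Cminus. rewrite re_plus, im_plus, re_opp, im_opp. unfold Re, Im; simpl.
  unfold Rminus in Hs, Ht. lra. }
assert (Hv0 : ver k X y y' = 0).
{ apply is_CInt_unique. replace (RtoC 0) with (RtoC (y' - y) * 0)%C by ring.
  eapply is_RInt_ext; [|exact (is_CInt_const y y' (RtoC 0))].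
  intros t _. now rewrite HX. }
assert (G := rect_any k x X y y' Hk). unfold rect in G. rewrite Hv0 in G.
rewrite !(hor_swap k X x) in G by exact Hkc.
set (A := hor k x x' y'). set (B := ver k x y y') in *.
assert (E : (hor k X x' y' - hor k X x y)%C = (A + Ci * B)%C).
{ rewrite (hor_Chasles k X x x' y' Hkc). fold A.
  replace (hor k X x y) with (hor k X x y' - Ci * B)%C; [ring|].
  replace (hor k X x y) with (hor k X x y'
    - (- hor k X x y - - hor k X x y' + Ci * (RtoC 0 - B)) - Ci * B)%C by ring.
  rewrite G. ring. }
rewrite E.
replace ((x', y') - (x, y))%C with (RtoC (x' - x) + Ci * RtoC (y' - y))%C.
2:{ unfold RtoC, Ci, Cminus, Cplus, Copp, Cmult; simpl. f_equal; ring. }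
replace (A + Ci * B - (RtoC (x' - x) + Ci * RtoC (y' - y)) * k (x, y))%C
  with ((A - RtoC (x' - x) * k (x, y)) + Ci * (B - RtoC (y' - y) * k (x, y)))%C by ring.
assert (HA : Cmod (A - RtoC (x' - x) * k (x, y)) <= Rabs (x' - x) * (eps / 2)).
{ refine (CInt_bound_abs _ x x' (eps / 2) _ _
    (is_CInt_minus _ _ _ _ _ _ (is_hor k x x' y' Hkc) (is_CInt_const x x' (k (x, y))))).
  intros t Ht. apply Hclose; [|exact Dy].
  eapply Rle_trans; [|exact Dx]. unfold Rmin, Rmax in Ht.
  destruct (Rle_dec x x').
  - rewrite !Rabs_pos_eq by lra. lra.
  - rewrite (Rabs_left1 (t - x)), (Rabs_left1 (x' - x)) by lra. lra. }
assert (HB : Cmod (B - RtoC (y' - y) * k (x, y)) <= Rabs (y' - y) * (eps / 2)).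
{ refine (CInt_bound_abs _ y y' (eps / 2) _ _
    (is_CInt_minus _ _ _ _ _ _ (is_ver k x y y' Hkc) (is_CInt_const y y' (k (x, y))))).
  intros t Ht. apply Hclose.
  - replace (x - x) with 0 by ring. rewrite Rabs_R0. apply Cmod_ge_0.
  - eapply Rle_trans; [|exact Dy]. unfold Rmin, Rmax in Ht.
    destruct (Rle_dec y y').
    + rewrite !Rabs_pos_eq by lra. lra.
    + rewrite (Rabs_left1 (t - y)), (Rabs_left1 (y' - y)) by lra. lra. }
eapply Rle_trans; [apply Cmod_triangle|]. rewrite Cmod_mult.
rewrite Cmod_Ci. fold D. nra.
Qed.

Definition cis (t : R) : C := Cexp (0, t).

Lemma cis_2PI : cis (2 * PI) = cis 0.
Proof.
unfold cis, Cexp, Re, Im; simpl. rewrite cos_2PI, sin_2PI, cos_0, sin_0. reflexivity.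
Qed.

Lemma RCder_cis (t : R) : RCder cis t (Ci * cis t)%C.
Proof.
apply (Cder_RCder_comp Cexp (fun u => (0, u))); [apply Cder_Cexp | apply RCder_ver].
Qed.

Lemma Clim_fst {U T : Type} (F : (U -> Prop) -> Prop) (G : (T -> Prop) -> Prop)
  {FF : Filter F} {FG : Filter G} (f : U -> C) (l : C) :
  Clim F f l -> Clim (filter_prod F G) (fun p => f (fst p)) l.
Proof. intros H. exact (filterlim_comp _ _ _ fst f _ F _ filterlim_fst H). Qed.

Lemma Clim_snd {U T : Type} (F : (U -> Prop) -> Prop) (G : (T -> Prop) -> Prop)
  {FF : Filter F} {FG : Filter G} (f : T -> C) (l : C) :
  Clim G f l -> Clim (filter_prod F G) (fun p => f (snd p)) l.
Proof. intros H. exact (filterlim_comp _ _ _ snd f _ G _ filterlim_snd H). Qed.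

(** The mean over a circle is constant in the radius: its derivative is, up to the
    factor [i r], the integral over a period of the derivative of [g] along
    the circle. *)
Lemma circle_mean (g dg : C -> C) (a : C) (rho : R) :
  (forall z, Cder g z (dg z)) -> ccont dg ->
  is_CInt (fun t => g (a + RtoC rho * cis t)%C) 0 (2 * PI) (RtoC (2 * PI) * g a)%C.
Proof.
intros Hg Hdg. assert (Hpi := PI_RGT_0).
assert (Hgc : ccont g) by (intros z; exact (Cder_continuous _ _ _ (Hg z))).
set (c := fun (r : C) (t : R) => (a + r * cis t)%C).
assert (Hct : forall r t, RCder (c r) t (r * (Ci * cis t))%C).
{ intros r t. apply (RCder_eq _ _ ((Ci * cis t) * r)%C); [|ring].
  apply (Cder_RCder_comp (fun w => (a + r * w)%C) cis); [|apply RCder_cis].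
  eapply Cder_eq.
  - apply Cder_plus; [apply Cder_const | apply Cder_scal, Cder_id].
  - ring. }
assert (Hcr : forall r t, Cder (fun w => c w t) r (cis t)).
{ intros r t. eapply Cder_eq.
  - apply Cder_plus; [apply Cder_const |].
    apply (Cder_mult (fun w => w) (fun _ => cis t)); [apply Cder_id | apply Cder_const].
  - ring. }
assert (Hcis : forall t, Rcont cis t) by (intros t; exact (RCder_continuous _ _ _ (RCder_cis t))).
assert (Hcj : forall r t, Clim (filter_prod (nearC r) (nearR t))
  (fun p => c (fst p) (snd p)) (c r t)).
{ intros r t. apply Clim_plus; [apply Clim_const|]. apply Clim_mult.
  - apply (Clim_fst _ _ (fun w => w)), filterlim_id.
  - apply (Clim_snd _ _ cis), Hcis. }
set (D := fun r => CInt (fun t => (cis t * dg (c r t))%C) 0 (2 * PI)).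
assert (HD : forall r, Cder (fun w => CInt (fun t => g (c w t)) 0 (2 * PI)) r (D r)).
{ intros r.
  apply (Cder_CInt (fun w t => g (c w t)) (fun w t => (cis t * dg (c w t))%C) r 0 (2 * PI) 1); try lra.
  - intros w t _ _. apply (Cder_comp g (fun v => c v t)); [apply Hg | apply Hcr].
  - intros w t _ _. apply (Clim_comp (c w) g (c w t)); [|apply Hgc].
    exact (RCder_continuous _ _ _ (Hct w t)).
  - intros t _. apply Clim_mult; [apply (Clim_snd _ _ cis), Hcis |].
    exact (Clim_comp _ _ _ _ (Hcj r t) (Hdg (c r t))). }
assert (Hint : forall r, is_CInt (fun t => (cis t * dg (c r t))%C) 0 (2 * PI) (D r)).
{ intros r. apply is_CInt_continuous; [lra|]. intros t _.
  apply Clim_mult; [apply Hcis|]. apply (Clim_comp (c r) dg (c r t)); [|apply Hdg].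
  exact (RCder_continuous _ _ _ (Hct r t)). }
assert (HD0 : forall r, D r = RtoC 0).
{ intros r. destruct (Ceq_dec r (RtoC 0)) as [->|Hr].
  - assert (H1 : is_CInt (fun t => (Ci * cis t)%C) 0 (2 * PI) (cis (2 * PI)%R - cis 0%R)%C).
    { apply is_CInt_FTC; [lra | intros t _; apply RCder_cis |].
      intros t _. apply Clim_mult; [apply Clim_const | apply Hcis]. }
    rewrite cis_2PI in H1. replace (cis 0%R - cis 0%R)%C with (RtoC 0) in H1 by ring.
    unfold D. apply is_CInt_unique.
    apply (is_CInt_scal _ (- Ci * dg a)%C) in H1.
    rewrite Cmult_0_r in H1. eapply is_CInt_ext; [lra | | exact H1].
    intros t _. unfold c. simpl. replace (a + 0 * cis t)%C with a by ring.
    replace (- Ci * dg a * (Ci * cis t))%C with (- (Ci * Ci) * (cis t * dg a))%C by ring.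
    replace (Ci * Ci)%C with (- RtoC 1)%C; [ring|].
    unfold Ci, RtoC, Cmult, Copp; simpl. f_equal; ring.
  - assert (H1 : is_CInt (fun t => (r * (Ci * cis t) * dg (c r t))%C) 0 (2 * PI)
      (g (c r (2 * PI)%R) - g (c r 0%R))%C).
    { apply (is_CInt_FTC (fun t => g (c r t))); [lra | |].
      - intros t _. apply (Cder_RCder_comp g (c r)); [apply Hg | apply Hct].
      - intros t _. apply Clim_mult.
        + apply Clim_mult; [apply Clim_const|].
          apply Clim_mult; [apply Clim_const | apply Hcis].
        + apply (Clim_comp (c r) dg (c r t)); [|apply Hdg].
          exact (RCder_continuous _ _ _ (Hct r t)). }
    unfold c in H1 at 2 3. rewrite cis_2PI in H1.
    replace (g (a + r * cis 0%R) - g (a + r * cis 0%R))%C with (RtoC 0) in H1 by ring.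
    assert (H2 := is_CInt_scal _ (r * Ci)%C _ _ _ (Hint r)).
    assert (E : (r * Ci * D r)%C = 0).
    { rewrite <- (is_CInt_unique _ _ _ _ H1), <- (is_CInt_unique _ _ _ _ H2).
      apply (RInt_ext (V := C_R_CompleteNormedModule)). intros t _. Cring. }
    assert (Hci := Ci_nz).
    replace (D r) with (/ (r * Ci) * (r * Ci * D r))%C by (field; auto).
    rewrite E. Cring. }
replace (RtoC (2 * PI) * g a)%C with (CInt (fun t => g (c (RtoC rho) t)) 0 (2 * PI)).
- apply is_CInt_continuous; [lra|]. intros t _.
  apply (Clim_comp (c (RtoC rho)) g (c (RtoC rho) t)); [|apply Hgc].
  exact (RCder_continuous _ _ _ (Hct (RtoC rho) t)).
- replace (RtoC (2 * PI) * g a)%C with (CInt (fun t => g (c (RtoC 0) t)) 0 (2 * PI)).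
  + apply Ceq_minus, Cmod_eq_0, Rle_antisym; [|apply Cmod_ge_0].
    apply Rle_trans with (0 * Cmod (RtoC rho - 0)); [|rewrite Rmult_0_l; apply Rle_refl].
    apply (Cder_Lipschitz (fun w => CInt (fun t => g (c w t)) 0 (2 * PI)) D).
    * intros t _. apply HD.
    * intros t _. rewrite HD0, Cmod_0. lra.
  + apply is_CInt_unique. eapply is_CInt_ext; [lra | | ].
    2:{ replace (2 * PI) with (2 * PI - 0) at 2 by ring. apply is_CInt_const. }
    intros t _. unfold c. f_equal. ring.
Qed.

(** On the circle of radius [rho = 4 delta] around [a], either
    [Re (z - a) >= delta] and [K] vanishes, or [p z = (z - a) + (z - a)^2 / (2 rho)] has real part at
    most [- 3 rho / 16]; since [p a = 0], the mean value of [K e^(lam p)]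
    forces [K a] to be as small as [e^(- 3 lam rho / 16)]. *)
Lemma vanishing_half_plane_C1 (K dK : C -> C) (sigma : R) :
  (forall z, Cder K z (dK z)) -> ccont dK ->
  (forall z, sigma < Re z -> K z = 0) -> forall a, K a = 0.
Proof.
intros HK HdK H0 a. assert (Hpi := PI_RGT_0).
assert (HKc : ccont K) by (intros z; exact (Cder_continuous _ _ _ (HK z))).
destruct (Rlt_dec sigma (Re a)) as [Ha|Ha]; [now apply H0|].
set (delta := sigma + 1 - Re a). assert (Hd : 0 < delta) by (unfold delta; lra).
set (rho := 4 * delta). assert (Hrho : 0 < rho) by (unfold rho; lra).
set (p := fun z => ((z - a) + RtoC (/ (2 * rho)) * ((z - a) * (z - a)))%C).
set (dp := fun z => (RtoC 1 + RtoC (/ rho) * (z - a))%C).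
assert (Hp : forall z, Cder p z (dp z)).
{ intros z. eapply Cder_eq.
  - apply (Cder_plus (fun w => (w - a)%C)); [apply Cder_sub_const |].
    apply Cder_scal, (Cder_mult (fun w => (w - a)%C)); apply Cder_sub_const.
  - unfold dp. replace (/ rho) with (/ (2 * rho) + / (2 * rho)) by (field; lra).
    rewrite RtoC_plus. ring. }
set (z_ := fun t => (a + RtoC rho * cis t)%C).
assert (Hzc : forall t, Rcont z_ t).
{ intros t. apply Clim_plus; [apply Clim_const|]. apply Clim_mult; [apply Clim_const|].
  exact (RCder_continuous _ _ _ (RCder_cis t)). }
destruct (bounded_continuity (V := C_R_NormedModule) (fun t => K (z_ t)) 0 (2 * PI)) as [M HM].
{ intros t _. exact (Clim_comp z_ K _ _ (Hzc t) (HKc (z_ t))). }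
assert (HM' : forall t, 0 <= t <= 2 * PI -> Cmod (K (z_ t)) <= M).
{ intros t Ht. rewrite Cmod_norm. now apply Rlt_le, HM. }
assert (HM0 : 0 <= M) by (eapply Rle_trans; [apply Cmod_ge_0 | apply (HM' 0); lra]).
assert (Key : forall lam, 0 <= lam -> Cmod (K a) <= M * exp (- (3 * rho / 16 * lam))).
{ intros lam Hlam.
  set (g := fun z => (K z * Cexp (RtoC lam * p z))%C).
  set (dg := fun z => (dK z * Cexp (RtoC lam * p z)
    + K z * (RtoC lam * dp z * Cexp (RtoC lam * p z)))%C).
  assert (Hpc : forall z, Clim (nearC z) (fun w => Cexp (RtoC lam * p w)) (Cexp (RtoC lam * p z))).
  { intros z. apply Clim_Cexp, Clim_mult; [apply Clim_const|].
    exact (Cder_continuous _ _ _ (Hp z)). }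
  assert (Hg : forall z, Cder g z (dg z)).
  { intros z. apply (Cder_mult K (fun w => Cexp (RtoC lam * p w))); [apply HK|].
    apply (Cder_Cexp_comp (fun w => (RtoC lam * p w)%C)), Cder_scal, Hp. }
  assert (Hdg : ccont dg).
  { intros z. apply Clim_plus.
    - apply Clim_mult; [apply HdK | apply Hpc].
    - apply Clim_mult; [apply HKc|]. apply Clim_mult; [|apply Hpc].
      apply Clim_mult; [apply Clim_const|]. unfold dp.
      apply Clim_plus; [apply Clim_const|]. apply Clim_mult; [apply Clim_const|].
      apply Clim_minus; [apply filterlim_id | apply Clim_const]. }
  assert (Hm := circle_mean g dg a rho Hg Hdg).
  assert (Hb : Cmod (RtoC (2 * PI) * g a) <= (2 * PI - 0) * (M * exp (- (3 * rho / 16 * lam)))).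
  { refine (CInt_bound _ 0 (2 * PI) _ _ _ _ Hm); [lra|].
    intros t Ht. unfold g. fold (z_ t). rewrite Cmod_mult, Cmod_Cexp.
    set (c := cos t).
    assert (Hc : -1 <= c <= 1) by apply COS_bound.
    assert (Ez : (z_ t - a)%C = (rho * c, rho * sin t)).
    { unfold z_, cis, Cexp, c, RtoC, Re, Im, Cminus, Cplus, Copp, Cmult; simpl.
      rewrite exp_0. destruct a; simpl. f_equal; ring. }
    assert (Hs : sin t * sin t = 1 - c * c).
    { assert (A := sin2_cos2 t). unfold Rsqr in A. unfold c. lra. }
    assert (Ep : Re (RtoC lam * p (z_ t)) = lam * (rho * (c + c * c - 1 / 2))).
    { rewrite re_scal_l. f_equal. unfold p. rewrite Ez, re_plus, re_scal_l, re_mult.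
      unfold Re, Im; simpl.
      replace (rho * c * (rho * c) - rho * sin t * (rho * sin t))
        with (rho * rho * (c * c - sin t * sin t)) by ring.
      rewrite Hs. field. lra. }
    rewrite Ep. destruct (Rle_dec (1 / 4) c) as [Hcc|Hcc].
    - rewrite H0.
      + rewrite Cmod_0, Rmult_0_l. assert (A := exp_pos (- (3 * rho / 16 * lam))). nra.
      + assert (A : Re (z_ t - a) = rho * c) by now rewrite Ez.
        unfold Cminus in A. rewrite re_plus, re_opp in A. unfold rho, delta in *. nra.
    - apply Rmult_le_compat; [apply Cmod_ge_0 | apply Rlt_le, exp_pos | now apply HM' |].
      assert (A : c + c * c - 1 / 2 <= - (3 / 16)) by nra.
      assert (B : lam * (rho * (c + c * c - 1 / 2)) <= - (3 * rho / 16 * lam)).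
      { assert (0 <= lam * rho) by nra. nra. }
      now apply exp_le_compat. }
  rewrite Cmod_mult, Cmod_R, Rabs_pos_eq in Hb by lra.
  replace (g a) with (K a) in Hb.
  - apply Rmult_le_reg_l with (2 * PI); lra.
  - unfold g, p. replace (a - a)%C with (RtoC 0) by ring.
    rewrite !Cmult_0_r, Cplus_0_r, Cmult_0_r, Cexp_0. ring. }
apply Cmod_eq_0. apply NNPP. intros Hne.
set (k := Cmod (K a)) in *. assert (Hk : 0 <= k) by apply Cmod_ge_0.
assert (Hk0 : 0 < k) by lra.
specialize (Key (M / k * (16 / (3 * rho)))).
assert (HMk : 0 <= M / k) by (apply Rdiv_le_0_compat; lra).
assert (Hl : 0 <= M / k * (16 / (3 * rho))).
{ apply Rmult_le_pos; [exact HMk|]. apply Rdiv_le_0_compat; lra. }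
specialize (Key Hl).
replace (3 * rho / 16 * (M / k * (16 / (3 * rho)))) with (M / k) in Key by (field; lra).
rewrite exp_Ropp in Key.
assert (He := exp_ineq1_le (M / k)).
assert (Hexp := exp_pos (M / k)).
apply Rmult_le_compat_r with (r := exp (M / k)) in Key; [|lra].
rewrite Rmult_assoc, Rinv_l in Key by lra.
assert (k * (M / k) = M) by (field; lra). nra.
Qed.

(** Passing to a primitive, which vanishes on the same half-plane, reduces to
    the case of a continuous derivative. *)
Theorem vanishing_half_plane (k : C -> C) (sigma : R) :
  entire k -> (forall z, sigma < Re z -> k z = 0) -> forall z, k z = 0.
Proof.
intros Hk H0 z.
set (K := fun w => hor k (sigma + 1) (Re w) (Im w)).
assert (HK : forall w, Cder K w (k w)).
{ apply (horizontal_primitive k (sigma + 1) Hk).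
  intros y. apply H0. unfold Re; simpl. lra. }
assert (HK0 : forall w, sigma < Re w -> K w = 0).
{ intros w Hw. unfold K, hor. apply is_CInt_unique.
  replace (RtoC 0) with (RtoC (Re w - (sigma + 1)) * 0)%C by ring.
  eapply is_RInt_ext; [|apply is_CInt_const].
  intros t Ht. symmetry. apply H0. unfold Re at 1; simpl.
  assert (sigma < Rmin (sigma + 1) (Re w)) by (apply Rmin_glb_lt; lra). lra. }
assert (HKz := vanishing_half_plane_C1 K k sigma HK
  (fun w => entire_continuous k w Hk) HK0).
apply (Cder_unique K z); [apply HK|].
apply (Cder_ext (fun _ => RtoC 0)); [|apply Cder_const].
apply filter_forall. intros w. now rewrite HKz.
Qed.

(** The difference of two continuations, multiplied by [(z - 1)^2] to remove
    the pole, is entire and vanishes for [Re z > 1]. *)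
Theorem hurwitz_zeta_unique (theta : R) (q : C) (f g : C -> C) :
  is_hurwitz_zeta theta q f -> is_hurwitz_zeta theta q g ->
  forall z, z <> RtoC 1 -> f z = g z.
Proof.
intros [Hf1 [Hf2 Hf3]] [Hg1 [Hg2 Hg3]] z Hz.
set (k := fun w => ((w - 1) * ((w - 1) * (f w - g w)))%C).
assert (Hk : entire k).
{ intros w. destruct (Ceq_dec w (RtoC 1)) as [->|Hw].
  - exists (RtoC 0). apply Cder_quotient.
    apply (Clim_ext (fun v => ((v - 1) * f v - (v - 1) * g v)%C)).
    + apply nearC_iff. exists 1. split; [lra|]. intros v _ Hv. unfold k. field.
      now apply Cminus_eq_contra.
    + replace (RtoC 0) with (RtoC 1 - 1)%C by ring.
      apply Clim_minus; assumption.
  - destruct (Hf2 w Hw) as [a Ha]. destruct (Hg2 w Hw) as [b Hb].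
    eexists. apply (Cder_mult (fun v => (v - 1)%C)); [apply Cder_sub_const|].
    apply (Cder_mult (fun v => (v - 1)%C)); [apply Cder_sub_const|].
    apply Cder_minus; eassumption. }
assert (Hk0 : k z = 0).
{ apply (vanishing_half_plane k 1 Hk). intros w Hw. unfold k.
  rewrite (Cser_unique _ _ _ (Hf1 w Hw) (Hg1 w Hw)). ring. }
assert (Hz1 : (z - 1)%C <> RtoC 0) by now apply Cminus_eq_contra.
apply Ceq_minus.
replace (f z - g z)%C with (/ (z - 1) * (/ (z - 1) * k z))%C
  by (unfold k; field; exact Hz1).
rewrite Hk0. ring.
Qed.

Lemma hurwitz_zeta_eq (theta : R) (q : C) (f : C -> C) :
  is_hurwitz_zeta theta q f -> forall z, z <> RtoC 1 -> hurwitz_zeta theta z q = f z.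
Proof.
intros Hf. apply (hurwitz_zeta_unique theta q); [|exact Hf].
apply (epsilon_spec (inhabits (fun _ : C => RtoC 0)) (is_hurwitz_zeta theta q)).
now exists f.
Qed.

(** * Branches of the logarithm *)

Lemma cis_plus (s t : R) : cis (s + t) = (cis s * cis t)%C.
Proof.
unfold cis. rewrite <- Cexp_plus. f_equal. unfold Cplus; simpl. f_equal. ring.
Qed.

Lemma cis_eq (t : R) : cis t = (cos t, sin t).
Proof. unfold cis, Cexp, Re, Im; simpl. rewrite exp_0. f_equal; ring. Qed.

Lemma cis_period (t : R) : cis (t + 2 * PI) = cis t.
Proof. rewrite !cis_eq, cos_plus, sin_plus, cos_2PI, sin_2PI. f_equal; ring. Qed.

Lemma cis_inj_small (s t : R) : cis s = cis t -> -2 * PI < s - t < 2 * PI -> s = t.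
Proof.
assert (Main : forall x, 0 < x < 2 * PI -> cos x <> 1).
{ intros x Hx H.
  assert (A := cos_2a_sin (x / 2)). replace (2 * (x / 2)) with x in A by field.
  assert (B : 0 < sin (x / 2)) by (apply sin_gt_0; lra). nra. }
intros H Hst.
assert (E : cos (s - t) = 1).
{ rewrite !cis_eq in H. injection H as H1 H2. rewrite cos_minus, H1, H2.
  assert (A := sin2_cos2 t). unfold Rsqr in A. lra. }
destruct (Rtotal_order s t) as [L|[L|L]]; [|exact L|].
- exfalso. apply (Main (t - s)); [lra|].
  rewrite <- E, <- cos_neg. f_equal. ring.
- exfalso. apply (Main (s - t)); [lra | exact E].
Qed.

Lemma polar_form (w : C) : w <> RtoC 0 ->
  exists phi, - PI <= phi <= PI /\ w = (RtoC (Cmod w) * cis phi)%C.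
Proof.
intros Hw. apply Cmod_gt_0 in Hw. set (r := Cmod w) in *.
destruct w as [x y].
assert (Hr : r * r = x * x + y * y).
{ unfold r, Cmod; simpl. rewrite sqrt_sqrt by nra. ring. }
set (c := x / r). set (s := y / r).
assert (Hx : x = r * c) by (unfold c; field; lra).
assert (Hy : y = r * s) by (unfold s; field; lra).
assert (Hcs : c * c + s * s = 1).
{ apply Rmult_eq_reg_l with (r * r); [|nra].
  replace (r * r * (c * c + s * s)) with ((r * c) * (r * c) + (r * s) * (r * s)) by ring.
  rewrite <- Hx, <- Hy. lra. }
assert (Hc : -1 <= c <= 1) by (split; nra).
assert (Ha := acos_bound c).
assert (Hcos := cos_acos c Hc).
assert (Hsin := sin_acos c Hc).
destruct (Rle_dec 0 s) as [Hs|Hs].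
- exists (acos c). split; [lra|]. rewrite cis_eq, Hcos, Hsin.
  replace (1 - Rsqr c) with (s * s) by (unfold Rsqr; lra).
  rewrite sqrt_square by exact Hs.
  unfold RtoC, Cmult; simpl. f_equal; lra.
- exists (- acos c). split; [lra|]. rewrite cis_eq, cos_neg, sin_neg, Hcos, Hsin.
  replace (1 - Rsqr c) with ((- s) * (- s)) by (unfold Rsqr; lra).
  rewrite sqrt_square by lra.
  unfold RtoC, Cmult; simpl. f_equal; lra.
Qed.

Definition theta_ok (theta : R) : Prop := 0 < theta < 2 * PI.

Lemma Carg_spec (theta : R) (w : C) : theta_ok theta -> w <> RtoC 0 ->
  theta - 2 * PI < Carg theta w <= theta /\ w = (RtoC (Cmod w) * cis (Carg theta w))%C.
Proof.
intros Ht Hw. unfold theta_ok in Ht.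
apply (epsilon_spec (inhabits 0) (fun phi : R =>
    theta - 2 * PI < phi <= theta /\ w = (RtoC (Cmod w) * Cexp (0, phi))%C)).
destruct (polar_form w Hw) as [phi [Hphi E]].
destruct (Rlt_dec theta phi) as [H1|H1].
- exists (phi - 2 * PI). split; [lra|]. fold (cis (phi - 2 * PI)).
  rewrite <- (cis_period (phi - 2 * PI)).
  replace (phi - 2 * PI + 2 * PI) with phi by ring. exact E.
- destruct (Rlt_dec (theta - 2 * PI) phi) as [H2|H2].
  + exists phi. split; [lra | exact E].
  + exists (phi + 2 * PI). split; [lra|]. fold (cis (phi + 2 * PI)).
    rewrite cis_period. exact E.
Qed.

Lemma Carg_unique (theta : R) (w : C) (phi : R) : theta_ok theta -> w <> RtoC 0 ->
  theta - 2 * PI < phi <= theta -> w = (RtoC (Cmod w) * cis phi)%C -> Carg theta w = phi.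
Proof.
intros Ht Hw Hphi E. destruct (Carg_spec theta w Ht Hw) as [H1 H2].
apply cis_inj_small; [|lra].
assert (Hm : RtoC (Cmod w) <> RtoC 0).
{ intros A. apply RtoC_inj in A. apply Cmod_gt_0 in Hw. lra. }
rewrite H2 in E at 1.
replace (cis (Carg theta w)) with (/ RtoC (Cmod w) * (RtoC (Cmod w) * cis (Carg theta w)))%C
  by (field; exact Hm).
rewrite E. field. exact Hm.
Qed.

Lemma Cexp_Clog (theta : R) (w : C) : theta_ok theta -> w <> RtoC 0 -> Cexp (Clog theta w) = w.
Proof.
intros Ht Hw. destruct (Carg_spec theta w Ht Hw) as [_ E]. rewrite E at 2.
apply Cmod_gt_0 in Hw.
rewrite cis_eq. unfold Clog, Cexp, RtoC, Cmult, Re, Im; simpl.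
rewrite exp_ln by exact Hw. f_equal; ring.
Qed.

Lemma polar_right (w : C) : 0 < Re w -> w = (RtoC (Cmod w) * cis (atan (Im w / Re w)))%C.
Proof.
intros Hw. destruct w as [x y]. unfold Re, Im in *; simpl in *.
assert (E : Cmod (x, y) = x * sqrt (1 + Rsqr (y / x))).
{ replace (x * sqrt (1 + Rsqr (y / x))) with (sqrt (x * x) * sqrt (1 + Rsqr (y / x)))
    by (rewrite sqrt_square by lra; reflexivity).
  rewrite <- sqrt_mult_alt by nra. unfold Cmod; simpl. f_equal. unfold Rsqr. field. lra. }
assert (Hs : 0 < sqrt (1 + Rsqr (y / x))).
{ apply sqrt_lt_R0. assert (A := Rle_0_sqr (y / x)). lra. }
rewrite E, cis_eq, cos_atan, sin_atan. unfold RtoC, Cmult; simpl.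
f_equal; field; lra.
Qed.

Lemma PI_ok : theta_ok PI.
Proof. unfold theta_ok. assert (H := PI_RGT_0). lra. Qed.

Lemma Re_pos_neq_0 (w : C) : 0 < Re w -> w <> RtoC 0.
Proof. intros H ->. unfold Re, RtoC in H; simpl in H. lra. Qed.

Lemma Carg_right (theta : R) (w : C) : theta_ok theta -> 0 < Re w ->
  theta - 2 * PI < atan (Im w / Re w) <= theta -> Carg theta w = atan (Im w / Re w).
Proof.
intros Ht Hw Ha. apply Carg_unique; [exact Ht | now apply Re_pos_neq_0 | exact Ha |].
now apply polar_right.
Qed.

Lemma Carg_PI_right (w : C) : 0 < Re w -> Carg PI w = atan (Im w / Re w).
Proof.
intros Hw. apply Carg_right; [exact PI_ok | exact Hw |].
assert (H := atan_bound (Im w / Re w)). assert (Hpi := PI_RGT_0). lra.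
Qed.

Lemma Carg_PI_bound (w : C) : 0 < Re w -> Rabs (Carg PI w) <= PI.
Proof.
intros Hw. rewrite Carg_PI_right by exact Hw. assert (Hpi := PI_RGT_0).
assert (A := atan_bound (Im w / Re w)). apply Rabs_le. lra.
Qed.

Lemma atan_abs (x : R) : Rabs (atan x) <= Rabs x.
Proof.
assert (P : forall x, 0 <= x -> 0 <= atan x <= x).
{ intros y Hy. destruct (Req_dec y 0) as [->|Hne]; [rewrite atan_0; lra|].
  split; [rewrite <- atan_0; apply Rlt_le, atan_increasing; lra|].
  destruct (MVT_gen atan 0 y (fun t => / (1 + t ^ 2))) as [c [Hc E]].
  - intros t _. auto_derive; [trivial|]. field. nra.
  - intros t _. apply derivable_continuous_pt, derivable_pt_atan.
  - rewrite atan_0 in E. assert (/ (1 + c ^ 2) <= 1).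
    { rewrite <- Rinv_1. apply Rinv_le_contravar; [lra | nra]. }
    nra. }
destruct (Rle_dec 0 x) as [H|H].
- specialize (P x H). rewrite !Rabs_pos_eq by lra. lra.
- specialize (P (- x) ltac:(lra)). rewrite atan_opp in P.
  rewrite !Rabs_left1 by lra. lra.
Qed.

(** An explicit Lipschitz bound, which gives the continuity of the logarithm at [1]
    with the rate needed for its derivative. *)
Lemma Clog_PI_near_1 (u : C) : Cmod (u - 1) <= 1 / 2 ->
  Cmod (Clog PI u) <= 4 * Cmod (u - 1).
Proof.
intros Hu. set (d := Cmod (u - 1)) in *.
assert (Hre := Re_Lipschitz u (RtoC 1)). rewrite re_RtoC in Hre. fold d in Hre.
assert (Him := Im_Lipschitz u (RtoC 1)). rewrite im_RtoC, Rminus_0_r in Him. fold d in Him.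
apply Rabs_le_between in Hre.
assert (Hpos : 0 < Re u) by lra.
assert (Hd : 0 <= d) by apply Cmod_ge_0.
eapply Rle_trans; [apply Cmod_le_sum|]. unfold Clog, Re at 1, Im at 1; simpl fst; simpl snd.
assert (H1 : Rabs (Carg PI u) <= 2 * d).
{ rewrite Carg_PI_right by exact Hpos. eapply Rle_trans; [apply atan_abs|].
  unfold Rdiv. rewrite Rabs_mult, Rabs_inv, (Rabs_pos_eq (Re u)) by lra.
  apply Rmult_le_reg_r with (Re u); [exact Hpos|].
  rewrite Rmult_assoc, Rinv_l by lra. nra. }
assert (Hm : 1 - d <= Cmod u <= 1 + d).
{ split.
  - assert (A := Cmod_triangle u (- (u - 1))). rewrite Cmod_opp in A. fold d in A.
    replace (u + - (u - 1))%C with (RtoC 1) in A by ring. rewrite Cmod_1 in A. lra.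
  - assert (A := Cmod_triangle (RtoC 1) (u - 1)). fold d in A.
    replace (RtoC 1 + (u - 1))%C with u in A by ring. rewrite Cmod_1 in A. lra. }
set (m := Cmod u) in *.
assert (H2 : Rabs (ln m) <= 2 * d).
{ assert (A := ln_le_minus_1 m ltac:(lra)).
  assert (B := ln_le_minus_1 (/ m) ltac:(apply Rinv_0_lt_compat; lra)).
  rewrite ln_Rinv in B by lra.
  assert (D : / m - 1 <= 2 * d).
  { apply Rmult_le_reg_r with m; [lra|].
    rewrite Rmult_minus_distr_r, Rinv_l by lra. nra. }
  apply Rabs_le. lra. }
lra.
Qed.

Lemma Clog_PI_R (x : R) : 0 < x -> Clog PI (RtoC x) = RtoC (ln x).
Proof.
intros Hx. unfold Clog. rewrite Carg_PI_right by (rewrite re_RtoC; exact Hx).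
rewrite im_RtoC, Cmod_R, Rabs_pos_eq by lra.
replace (0 / Re (RtoC x)) with 0 by (unfold Rdiv; ring). now rewrite atan_0.
Qed.

Lemma Clog_1 : Clog PI (RtoC 1) = 0.
Proof.
now rewrite Clog_PI_R, ln_1 by lra.
Qed.

(** The logarithm is a right inverse of the exponential, whose derivative at
    [0] is [1]. *)
Lemma Cder_Clog_1 : Cder (Clog PI) (RtoC 1) (RtoC 1).
Proof.
apply Cder_iff. intros eps He.
assert (He4 : 0 < eps / 4) by lra.
destruct (proj1 (Cder_iff _ _ _) Cder_Cexp_0 (eps / 4) He4) as [d [Hd H]].
exists (Rmin (1 / 2) (d / 4)). split; [apply Rmin_pos; lra|].
intros u Hu.
assert (Hu1 := Rlt_le_trans _ _ _ Hu (Rmin_l _ _)).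
assert (Hu2 := Rlt_le_trans _ _ _ Hu (Rmin_r _ _)).
assert (B := Clog_PI_near_1 u (Rlt_le _ _ Hu1)).
assert (Hu0 : u <> RtoC 0).
{ intros ->. replace (RtoC 0 - RtoC 1)%C with (- RtoC 1)%C in Hu1 by ring.
  rewrite Cmod_opp, Cmod_1 in Hu1. lra. }
specialize (H (Clog PI u)).
replace (Clog PI u - 0)%C with (Clog PI u) in H by ring.
specialize (H ltac:(lra)).
rewrite Cexp_Clog, Cexp_0 in H by (exact PI_ok || exact Hu0).
rewrite Clog_1.
replace (Clog PI u - 0 - (u - 1) * 1)%C
  with (- (u - 1 - Clog PI u * 1))%C by ring.
rewrite Cmod_opp. nra.
Qed.

Definition off_ray (theta : R) (w : C) : Prop :=
  forall t, 0 <= t -> w <> (RtoC t * cis theta)%C.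

Lemma off_ray_neq_0 (theta : R) (w : C) : off_ray theta w -> w <> RtoC 0.
Proof. intros H ->. apply (H 0); [lra|]. ring. Qed.

Lemma Carg_off_ray (theta : R) (w : C) : theta_ok theta -> off_ray theta w -> Carg theta w < theta.
Proof.
intros Ht Hw. destruct (Carg_spec theta w Ht (off_ray_neq_0 _ _ Hw)) as [H1 H2].
destruct (Req_dec (Carg theta w) theta) as [E|E]; [|lra].
rewrite E in H2. exfalso. apply (Hw (Cmod w)); [apply Cmod_ge_0 | exact H2].
Qed.

(** Multiplying [w] by a number close to [1] adds a small angle to its argument;
    off the cut, the sum stays in the interval where [Carg theta] takes its values. *)
Lemma Clog_local (theta : R) (w : C) : theta_ok theta -> off_ray theta w ->
  nearC w (fun v => Clog theta v = (Clog theta w + Clog PI (v / w))%C).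
Proof.
intros Ht Hw. assert (Hw0 := off_ray_neq_0 _ _ Hw).
assert (Ha := Carg_off_ray theta w Ht Hw).
destruct (Carg_spec theta w Ht Hw0) as [H1 H2].
assert (Hm := Hw0). apply Cmod_gt_0 in Hm.
set (phi := Carg theta w) in *.
set (e := Rmin (theta - phi) (phi - (theta - 2 * PI))).
assert (He : 0 < e) by (apply Rmin_pos; lra).
assert (Hel : e <= theta - phi) by apply Rmin_l.
assert (Her : e <= phi - (theta - 2 * PI)) by apply Rmin_r.
apply nearC_iff. exists (Cmod w * Rmin (1 / 2) (e / 8)).
split; [apply Rmult_lt_0_compat; [exact Hm | apply Rmin_pos; lra]|].
intros v Hv.
assert (Hu : Cmod (v / w - 1) < Rmin (1 / 2) (e / 8)).
{ replace (v / w - 1)%C with ((v - w) / w)%C by (field; exact Hw0).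
  rewrite Cmod_div by exact Hw0. apply Rmult_lt_reg_r with (Cmod w); [exact Hm|].
  unfold Rdiv. rewrite Rmult_assoc, Rinv_l by lra. unfold Rdiv in Hv. lra. }
assert (Hu1 := Rlt_le_trans _ _ _ Hu (Rmin_l _ _)).
assert (Hu2 := Rlt_le_trans _ _ _ Hu (Rmin_r _ _)).
set (u := (v / w)%C) in *.
assert (Ev : v = (u * w)%C) by (unfold u; field; exact Hw0).
assert (Hu0 : u <> RtoC 0).
{ intros E. rewrite E in Hu1. replace (RtoC 0 - RtoC 1)%C with (- RtoC 1)%C in Hu1 by ring.
  rewrite Cmod_opp, Cmod_1 in Hu1. lra. }
assert (Hum := Hu0). apply Cmod_gt_0 in Hum.
assert (B := Clog_PI_near_1 u (Rlt_le _ _ Hu1)).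
assert (Hal : Rabs (Carg PI u) <= e / 2).
{ eapply Rle_trans; [exact (Im_le_Cmod (Clog PI u))|]. lra. }
apply Rabs_le_between in Hal.
destruct (Carg_spec PI u PI_ok Hu0) as [_ Eu].
assert (EC : Carg theta v = phi + Carg PI u).
{ apply Carg_unique; [exact Ht | rewrite Ev; now apply Cmult_neq_0 | lra |].
  rewrite cis_plus, Ev, Cmod_mult, RtoC_mult. rewrite Eu at 1. rewrite H2 at 1. ring. }
unfold Clog. rewrite EC. unfold Cplus; simpl. f_equal.
rewrite Ev, Cmod_mult, ln_mult by assumption. ring.
Qed.

Lemma Cder_Clog (theta : R) (w : C) : theta_ok theta -> off_ray theta w ->
  Cder (Clog theta) w (/ w)%C.
Proof.
intros Ht Hw. assert (Hw0 := off_ray_neq_0 _ _ Hw).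
apply (Cder_ext (fun v => (Clog theta w + Clog PI (/ w * v))%C)).
- generalize (Clog_local theta w Ht Hw). apply filter_imp. intros v ->.
  unfold Cdiv. now rewrite Cmult_comm.
- eapply Cder_eq.
  + apply Cder_plus; [apply Cder_const|].
    apply (Cder_comp (Clog PI) (fun v => (/ w * v)%C)).
    * rewrite Cinv_l by exact Hw0. apply Cder_Clog_1.
    * apply Cder_scal, Cder_id.
  + ring.
Qed.

Lemma off_ray_PI (w : C) : 0 < Re w -> off_ray PI w.
Proof.
intros Hw t Ht ->. rewrite cis_eq, cos_PI in Hw.
rewrite re_scal_l in Hw. unfold Re in Hw; simpl in Hw. lra.
Qed.

(** * The Hurwitz series *)

(** The power [w^(-s)]. *)
Definition pw (theta : R) (w s : C) : C := Cexp (- s * Clog theta w).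

Lemma pw_Cpower (theta : R) (w s : C) : (/ Cpower theta w s)%C = pw theta w s.
Proof. unfold pw, Cpower. rewrite <- Cexp_opp. f_equal. ring. Qed.

Lemma pw_plus (theta : R) (w s t : C) : pw theta w (s + t) = (pw theta w s * pw theta w t)%C.
Proof. unfold pw. rewrite <- Cexp_plus. f_equal. ring. Qed.

Lemma pw_0 (theta : R) (w : C) : pw theta w (RtoC 0) = 1.
Proof.
unfold pw. replace (- 0 * Clog theta w)%C with (RtoC 0) by ring. apply Cexp_0.
Qed.

Lemma pw_1 (theta : R) (w : C) : theta_ok theta -> w <> RtoC 0 -> pw theta w (RtoC 1) = (/ w)%C.
Proof.
intros Ht Hw. unfold pw. replace (- RtoC 1 * Clog theta w)%C with (- Clog theta w)%C by ring.
now rewrite Cexp_opp, Cexp_Clog.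
Qed.

Lemma pw_nat (theta : R) (w : C) (m : nat) : theta_ok theta -> w <> RtoC 0 ->
  pw theta w (RtoC (INR m)) = (/ w ^ m)%C.
Proof.
intros Ht Hw. induction m as [|m IH].
- simpl. rewrite pw_0. field.
- rewrite S_INR, RtoC_plus, pw_plus, IH, pw_1, Cpow_S by assumption.
  field. split; (exact Hw || now apply Cpow_nz).
Qed.

Lemma Cder_pw_exponent (theta : R) (w s : C) :
  Cder (fun v => pw theta w v) s (- Clog theta w * pw theta w s)%C.
Proof.
apply (Cder_Cexp_comp (fun v => (- v * Clog theta w)%C)).
eapply Cder_eq.
- apply (Cder_mult (fun v => (- v)%C) (fun _ => Clog theta w)).
  + apply Cder_opp, Cder_id.
  + apply Cder_const.
- ring.
Qed.

Lemma Cder_pw_base (theta : R) (w s : C) : theta_ok theta -> off_ray theta w ->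
  Cder (fun v => pw theta v s) w (- s * pw theta w (s + 1))%C.
Proof.
intros Ht Hw. assert (Hw0 := off_ray_neq_0 _ _ Hw).
rewrite pw_plus, pw_1 by assumption. eapply Cder_eq.
- apply (Cder_Cexp_comp (fun v => (- s * Clog theta v)%C)), Cder_scal, Cder_Clog; assumption.
- unfold pw. field. exact Hw0.
Qed.

(** Joint continuity at one point, as a limit along a product of filters. *)
Definition jcont (A : C -> C -> C) (s q : C) : Prop :=
  Clim (filter_prod (nearC s) (nearC q)) (fun p => A (fst p) (snd p)) (A s q).

Lemma jcont_fst (f : C -> C) (s q : C) : Clim (nearC s) f (f s) -> jcont (fun s _ => f s) s q.
Proof. intros H. exact (Clim_fst _ _ f _ H). Qed.

Lemma jcont_snd (f : C -> C) (s q : C) : Clim (nearC q) f (f q) -> jcont (fun _ q => f q) s q.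
Proof. intros H. exact (Clim_snd _ _ f _ H). Qed.

Lemma jcont_Clog (theta : R) (a s q : C) : theta_ok theta -> off_ray theta (a + q)%C ->
  jcont (fun s q => Clog theta (a + q)) s q.
Proof.
intros Ht Hq. apply (jcont_snd (fun q => Clog theta (a + q)%C)).
apply (Clim_comp (fun q => (a + q)%C) (Clog theta) (a + q)%C).
- apply Clim_plus; [apply Clim_const | apply filterlim_id].
- exact (Cder_continuous _ _ _ (Cder_Clog theta _ Ht Hq)).
Qed.

Lemma jcont_pw (theta : R) (a s q : C) : theta_ok theta -> off_ray theta (a + q)%C ->
  jcont (fun s q => pw theta (a + q) s) s q.
Proof.
intros Ht Hq. apply Clim_Cexp, Clim_mult.
- apply Clim_opp. apply (Clim_fst _ _ (fun v => v)), filterlim_id.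
- now apply jcont_Clog.
Qed.

Lemma Cmod_pw (w s : C) : 0 < Re w ->
  Cmod (pw PI w s) <= exp (Rabs (Im s) * PI) * Rpower (Cmod w) (- Re s).
Proof.
intros Hw. assert (Hpi := PI_RGT_0).
unfold pw. rewrite Cmod_Cexp. unfold Rpower. rewrite <- exp_plus.
assert (E : Re (- s * Clog PI w) = - (Re s * ln (Cmod w)) + Im s * Carg PI w).
{ rewrite re_mult, re_opp, im_opp. unfold Clog, Re at 2, Im at 2; simpl. ring. }
assert (Hi : Im s * Carg PI w <= Rabs (Im s) * PI).
{ eapply Rle_trans; [apply Rle_abs|]. rewrite Rabs_mult.
  apply Rmult_le_compat_l; [apply Rabs_pos | now apply Carg_PI_bound]. }
rewrite E. apply exp_le_compat. lra.
Qed.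

Lemma Rpower_opp_le (x y r a b B : R) : 0 < x -> x <= y -> y <= r -> 0 <= b -> b <= a -> a <= B ->
  Rpower r (- a) <= exp (B * Rabs (ln x)) * Rpower y (- b).
Proof.
intros Hx Hxy Hyr Hb Hba HaB. unfold Rpower. rewrite <- exp_plus. apply exp_le_compat.
assert (H1 := ln_le_compat x y Hx Hxy). assert (H2 := ln_le_compat y r ltac:(lra) Hyr).
assert (H3 := Rle_abs (- ln x)). rewrite Rabs_Ropp in H3. assert (H4 := Rabs_pos (ln x)).
assert (H5 : (a - b) * - ln y <= (a - b) * Rabs (ln x)) by (apply Rmult_le_compat_l; lra).
assert (H6 : (a - b) * Rabs (ln x) <= B * Rabs (ln x)) by (apply Rmult_le_compat_r; lra).
assert (H7 : a * ln y <= a * ln r) by (apply Rmult_le_compat_l; lra). lra.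
Qed.

Lemma Cmod_pw_le (w s : C) (y : R) : 0 < y -> y <= Re w -> 0 <= Re s ->
  Cmod (pw PI w s) <= exp (Rabs (Im s) * PI) * Rpower y (- Re s).
Proof.
intros Hy Hw Hs. eapply Rle_trans; [apply Cmod_pw; lra|].
apply Rmult_le_compat_l; [apply Rlt_le, exp_pos|]. unfold Rpower. apply exp_le_compat.
assert (Hl : Re s * ln y <= Re s * ln (Cmod w)).
{ apply Rmult_le_compat_l; [exact Hs|]. apply ln_le_compat; [exact Hy|].
  eapply Rle_trans; [exact Hw | apply Re_le_Cmod]. }
lra.
Qed.

(** [|ln r| <= (r^e + r^(- e)) / e]: in the estimates below, a logarithm is absorbed
    by an arbitrarily small change of the exponent. *)
Lemma Cmod_Clog_le (w : C) (e : R) : 0 < Re w -> 0 < e ->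
  Cmod (Clog PI w) <= / e * (Rpower (Cmod w) e + Rpower (Cmod w) (- e)) + PI.
Proof.
intros Hw He. eapply Rle_trans; [apply Cmod_le_sum|].
apply Rplus_le_compat; [|now apply Carg_PI_bound].
unfold Clog, Re; simpl fst. apply Rmult_le_reg_l with e; [exact He|].
rewrite <- Rmult_assoc, Rinv_r, Rmult_1_l by lra.
rewrite <- (Rabs_pos_eq e) at 1 by lra. rewrite <- Rabs_mult. unfold Rpower.
assert (A := exp_ineq1_le (e * ln (Cmod w))). assert (B := exp_ineq1_le (- e * ln (Cmod w))).
assert (A' := exp_pos (e * ln (Cmod w))). assert (B' := exp_pos (- e * ln (Cmod w))).
apply Rabs_le. lra.
Qed.

(** The dominating series for [sum (n + q)^(-s)] and its derivatives, locally uniformly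
    in [Re s > 1], [Re q > 0].  All the exponents that occur stay at distance from
    [1], and one third of the distance of [Re s0] to [1] pays for the logarithm. *)
Lemma term_bounds (s0 q0 : C) : 1 < Re s0 -> 0 < Re q0 ->
  exists r M, 0 < r /\ ex_series M /\
    (forall s, Cmod (s - s0) < r -> 1 < Re s) /\
    (forall q, Cmod (q - q0) < r -> 0 < Re q) /\
    (forall n s q, Cmod (s - s0) < r -> Cmod (q - q0) < r ->
      Cmod (pw PI (RtoC (INR n) + q) s) <= M n) /\
    (forall n s q, Cmod (s - s0) < r -> Cmod (q - q0) < r ->
      Cmod (- Clog PI (RtoC (INR n) + q) * pw PI (RtoC (INR n) + q) s) <= M n) /\
    (forall n s q, Cmod (s - s0) < r -> Cmod (q - q0) < r ->
      Cmod (- s * pw PI (RtoC (INR n) + q) (s + 1)) <= M n).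
Proof.
intros Hs0 Hq0. assert (Hpi := PI_RGT_0).
set (e := (Re s0 - 1) / 3). assert (He : 0 < e) by (unfold e; lra).
set (x := Re q0 / 2). assert (Hx : 0 < x) by (unfold x; lra).
set (r := Rmin e (Rmin x 1)).
assert (Hr : 0 < r) by (unfold r; repeat apply Rmin_pos; lra).
assert (Hre : r <= e) by apply Rmin_l.
assert (Hrx : r <= x) by (eapply Rle_trans; [apply Rmin_r | apply Rmin_l]).
assert (Hr1 : r <= 1) by (eapply Rle_trans; [apply Rmin_r | apply Rmin_r]).
set (B := Cmod s0 + 2 + e).
set (E := exp (B * PI)). set (K := exp (B * Rabs (ln x))).
assert (HE : 0 < E) by apply exp_pos. assert (HK : 0 < K) by apply exp_pos.
set (c := 1 + (/ e * 2 + PI) + B).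
exists r, (fun n => c * (E * K) * Rpower (INR n + x) (- (1 + e))).
split; [exact Hr|]. split.
{ refine (ex_series_scal (K := R_AbsRing) (V := R_NormedModule) (c * (E * K)) _ _).
  now apply ex_series_power. }
assert (HRs : forall s, Cmod (s - s0) < r -> 1 + 2 * e < Re s).
{ intros s Hs. assert (Rs := Rle_lt_trans _ _ _ (Re_Lipschitz s s0) Hs).
  apply Rabs_def2 in Rs. unfold e in *; lra. }
assert (HRq : forall q, Cmod (q - q0) < r -> x < Re q).
{ intros q Hq. assert (Rq := Rle_lt_trans _ _ _ (Re_Lipschitz q q0) Hq).
  apply Rabs_def2 in Rq. unfold x in *; lra. }
split; [intros s Hs; specialize (HRs s Hs); lra|].
split; [intros q Hq; specialize (HRq q Hq); lra|].
assert (HsB : forall s, Cmod (s - s0) < r -> Cmod s + 1 + e <= B).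
{ intros s Hs. assert (A := Cmod_triangle s0 (s - s0)).
  replace (s0 + (s - s0))%C with s in A by ring. unfold B. lra. }
assert (HB : 0 < B) by (unfold B; assert (A := Cmod_ge_0 s0); lra).
assert (Hei : 0 < / e) by now apply Rinv_0_lt_compat.
(* every power of [w = n + q] that occurs has an exponent at most [- (1 + e)] *)
assert (Hw : forall n q, Cmod (q - q0) < r -> 0 < Re (RtoC (INR n) + q) /\
  forall a, 1 + e <= a -> a <= B ->
    Rpower (Cmod (RtoC (INR n) + q)) (- a) <= K * Rpower (INR n + x) (- (1 + e))).
{ intros n q Hq. assert (Hn := pos_INR n). specialize (HRq q Hq).
  assert (Hre' : Re (RtoC (INR n) + q) = INR n + Re q) by (rewrite re_plus, re_RtoC; reflexivity).
  split; [lra|]. intros a Ha1 Ha2. apply Rpower_opp_le; try lra.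
  eapply Rle_trans; [|apply Re_le_Cmod]. lra. }
assert (Hpw : forall n s q, Cmod (s - s0) < r -> Cmod (q - q0) < r ->
  Cmod (pw PI (RtoC (INR n) + q) s) <= E * Rpower (Cmod (RtoC (INR n) + q)) (- Re s)).
{ intros n s q Hs Hq. eapply Rle_trans; [apply Cmod_pw, Hw, Hq|].
  apply Rmult_le_compat_r; [apply Rlt_le, exp_pos|]. apply exp_le_compat.
  apply Rmult_le_compat_r; [lra|]. assert (A := Im_le_Cmod s). specialize (HsB s Hs). lra. }
split; [|split]; intros n s q Hs Hq; specialize (Hpw n s q Hs Hq); destruct (Hw n q Hq) as [Hw0 Hp];
  specialize (HRs s Hs); specialize (HsB s Hs); assert (HRe := Re_le_Cmod s);
  set (w := (RtoC (INR n) + q)%C) in *; set (y := Rpower (INR n + x) (- (1 + e))) in *;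
  assert (Hy : 0 < y) by apply exp_pos;
  assert (HEy : 0 < E * K * y) by (repeat apply Rmult_lt_0_compat; assumption);
  assert (Hc : forall a, a <= c -> a * (E * K * y) <= c * (E * K) * y)
    by (intros a Ha; replace (c * (E * K) * y) with (c * (E * K * y)) by ring;
        apply Rmult_le_compat_r; lra).
- assert (A := Hp (Re s) ltac:(lra) ltac:(lra)).
  eapply Rle_trans; [|apply (Hc 1); unfold c; lra]. nra.
- rewrite Cmod_mult, Cmod_opp.
  assert (A1 := Hp (Re s) ltac:(lra) ltac:(lra)).
  assert (A2 := Hp (Re s - e) ltac:(lra) ltac:(lra)).
  assert (A3 := Hp (Re s + e) ltac:(lra) ltac:(lra)).
  set (p := Rpower (Cmod w) (- Re s)) in *.
  replace (Rpower (Cmod w) (- (Re s - e))) with (Rpower (Cmod w) e * p) in A2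
    by (unfold p; rewrite <- Rpower_plus; f_equal; ring).
  replace (Rpower (Cmod w) (- (Re s + e))) with (Rpower (Cmod w) (- e) * p) in A3
    by (unfold p; rewrite <- Rpower_plus; f_equal; ring).
  eapply Rle_trans; [|apply (Hc (/ e * 2 + PI)); unfold c; lra].
  eapply Rle_trans.
  { apply Rmult_le_compat; [apply Cmod_ge_0 | apply Cmod_ge_0 | | exact Hpw].
    exact (Cmod_Clog_le w e Hw0 He). }
  replace ((/ e * (Rpower (Cmod w) e + Rpower (Cmod w) (- e)) + PI) * (E * p))
    with (E * (/ e * (Rpower (Cmod w) e * p + Rpower (Cmod w) (- e) * p) + PI * p)) by ring.
  replace ((/ e * 2 + PI) * (E * K * y))
    with (E * (/ e * (K * y + K * y) + PI * (K * y))) by ring.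
  apply Rmult_le_compat_l; [lra|].
  apply Rplus_le_compat; apply Rmult_le_compat_l; lra.
- assert (Hwne := Re_pos_neq_0 w Hw0). assert (Hwm := proj1 (Cmod_gt_0 w) Hwne).
  rewrite pw_plus, pw_1 by (exact PI_ok || exact Hwne).
  rewrite !Cmod_mult, Cmod_opp, Cmod_inv by exact Hwne.
  assert (A := Hp (Re s + 1) ltac:(lra) ltac:(lra)).
  replace (Rpower (Cmod w) (- (Re s + 1))) with (Rpower (Cmod w) (- Re s) * / Cmod w) in A.
  2:{ replace (- (Re s + 1)) with (- Re s + - (1)) by ring.
      now rewrite Rpower_plus, (Rpower_Ropp _ 1), Rpower_1 by exact Hwm. }
  eapply Rle_trans; [|apply (Hc B); unfold c; lra].
  replace (B * (E * K * y)) with (B * (E * (K * y))) by ring.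
  apply Rmult_le_compat; [apply Cmod_ge_0 | | lra |].
  + apply Rmult_le_pos; [apply Cmod_ge_0 | apply Rlt_le, Rinv_0_lt_compat, Hwm].
  + eapply Rle_trans.
    * apply Rmult_le_compat_r; [apply Rlt_le, Rinv_0_lt_compat, Hwm | exact Hpw].
    * rewrite Rmult_assoc. apply Rmult_le_compat_l; lra.
Qed.

(** The series [zeta(s, q)], with principal powers, and its derivative in [s]. *)
Definition hsum (s q : C) : C := Cseries (fun n => pw PI (RtoC (INR n) + q) s).

Definition hsum' (s q : C) : C :=
  Cseries (fun n => (- Clog PI (RtoC (INR n) + q) * pw PI (RtoC (INR n) + q) s)%C).

Lemma shift_right (n : nat) (q : C) : 0 < Re q -> 0 < Re (RtoC (INR n) + q).
Proof.
intros H. rewrite re_plus. assert (A := pos_INR n). unfold Re at 1, RtoC; simpl. lra.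
Qed.

Lemma hsum_series (s q : C) : 1 < Re s -> 0 < Re q ->
  Cser (fun n => pw PI (RtoC (INR n) + q) s) (hsum s q).
Proof.
intros Hs Hq. destruct (term_bounds s q Hs Hq) as [r [M [Hr [HM [HS [HQ [H1 [H2 H3]]]]]]]].
apply (Cseries_dominated _ M); [|exact HM]. intros n.
apply H1; now apply Cmod_refl_lt.
Qed.

Lemma hsum'_series (s q : C) : 1 < Re s -> 0 < Re q ->
  Cser (fun n => (- Clog PI (RtoC (INR n) + q) * pw PI (RtoC (INR n) + q) s)%C) (hsum' s q).
Proof.
intros Hs Hq. destruct (term_bounds s q Hs Hq) as [r [M [Hr [HM [HS [HQ [H1 [H2 H3]]]]]]]].
apply (Cseries_dominated _ M); [|exact HM]. intros n.
apply H2; now apply Cmod_refl_lt.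
Qed.

Lemma near2 (s q : C) (r : R) : 0 < r ->
  filter_prod (nearC s) (nearC q) (fun p => Cmod (fst p - s) < r /\ Cmod (snd p - q) < r).
Proof.
intros Hr. exists (fun w => Cmod (w - s) < r) (fun w => Cmod (w - q) < r).
- now apply Cball_near.
- now apply Cball_near.
- auto.
Qed.

Lemma jcont_hsum (s q : C) : 1 < Re s -> 0 < Re q -> jcont hsum s q.
Proof.
intros Hs Hq. destruct (term_bounds s q Hs Hq) as [r [M [Hr [HM [HS [HQ [H1 [H2 H3]]]]]]]].
apply (Tannery (fun n p => pw PI (RtoC (INR n) + snd p)%C (fst p))
  (fun n => pw PI (RtoC (INR n) + q)%C s) M); [exact HM | | | | |].
- intros n. apply (jcont_pw PI _ s q PI_ok), off_ray_PI. now apply shift_right.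
- generalize (near2 s q r Hr). apply filter_imp. intros p [Hp1 Hp2] n. now apply H1.
- intros n. apply H1; now apply Cmod_refl_lt.
- generalize (near2 s q r Hr). apply filter_imp. intros p [Hp1 Hp2].
  apply hsum_series; auto.
- now apply hsum_series.
Qed.

Lemma jcont_hsum' (s q : C) : 1 < Re s -> 0 < Re q -> jcont hsum' s q.
Proof.
intros Hs Hq. destruct (term_bounds s q Hs Hq) as [r [M [Hr [HM [HS [HQ [H1 [H2 H3]]]]]]]].
apply (Tannery (fun n p => (- Clog PI (RtoC (INR n) + snd p) * pw PI (RtoC (INR n) + snd p) (fst p))%C)
  (fun n => (- Clog PI (RtoC (INR n) + q) * pw PI (RtoC (INR n) + q) s)%C) M); [exact HM | | | | |].
- intros n. assert (Ho := off_ray_PI _ (shift_right n q Hq)). apply Clim_mult.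
  + apply Clim_opp. exact (jcont_Clog PI _ s q PI_ok Ho).
  + exact (jcont_pw PI _ s q PI_ok Ho).
- generalize (near2 s q r Hr). apply filter_imp. intros p [Hp1 Hp2] n. now apply H2.
- intros n. apply H2; now apply Cmod_refl_lt.
- generalize (near2 s q r Hr). apply filter_imp. intros p [Hp1 Hp2].
  apply hsum'_series; auto.
- now apply hsum'_series.
Qed.

Lemma Cder_hsum_s (s q : C) : 1 < Re s -> 0 < Re q -> Cder (fun v => hsum v q) s (hsum' s q).
Proof.
intros Hs Hq. destruct (term_bounds s q Hs Hq) as [r [M [Hr [HM [HS [HQ [H1 [H2 H3]]]]]]]].
apply (Cder_series (fun n v => pw PI (RtoC (INR n) + q) v)
  (fun n v => (- Clog PI (RtoC (INR n) + q) * pw PI (RtoC (INR n) + q) v)%C) M s r); auto.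
- intros n w _. apply Cder_pw_exponent.
- intros n w Hw. apply H2; [exact Hw | now apply Cmod_refl_lt].
- intros w Hw. apply hsum_series; [now apply HS | exact Hq].
- now apply hsum'_series.
Qed.

Lemma Cder_pw_translate (theta : R) (a s q : C) : theta_ok theta -> off_ray theta (a + q)%C ->
  Cder (fun w => pw theta (a + w) s) q (- s * pw theta (a + q) (s + 1))%C.
Proof. intros Ht Hq. now apply (Cder_translate_l (fun v => pw theta v s)), Cder_pw_base. Qed.

Lemma Cder_pw_shift (n : nat) (s q : C) : 0 < Re q ->
  Cder (fun v => pw PI (RtoC (INR n) + v) s) q (- s * pw PI (RtoC (INR n) + q) (s + 1))%C.
Proof. intros Hq. apply Cder_pw_translate; [exact PI_ok|]. now apply off_ray_PI, shift_right. Qed.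

Lemma Cder_hsum_q (s q : C) : 1 < Re s -> 0 < Re q ->
  Cder (fun v => hsum s v) q (- s * hsum (s + 1) q)%C.
Proof.
intros Hs Hq. destruct (term_bounds s q Hs Hq) as [r [M [Hr [HM [HS [HQ [H1 [H2 H3]]]]]]]].
assert (Hss := Cmod_refl_lt s r Hr).
apply (Cder_series (fun n v => pw PI (RtoC (INR n) + v) s)
  (fun n v => (- s * pw PI (RtoC (INR n) + v) (s + 1))%C) M q r); auto.
- intros n w Hw. apply Cder_pw_shift. now apply HQ.
- intros w Hw. apply hsum_series; [exact Hs | now apply HQ].
- apply Cser_scal, hsum_series; [|exact Hq]. rewrite re_plus. unfold Re at 2; simpl. lra.
Qed.

Lemma pw_tends_0 (s q : C) : 0 < Re s -> 0 < Re q ->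
  Clim eventually (fun n => pw PI (RtoC (INR n) + q) s) (RtoC 0).
Proof.
intros Hs Hq. apply Clim_iff. intros eps He.
set (c := exp (Rabs (Im s) * PI)). assert (Hc : 0 < c) by apply exp_pos.
set (B := exp (/ Re s * ln (c / eps))).
destruct (INR_unbounded B) as [N HN]. exists N. intros n Hn.
replace (pw PI (RtoC (INR n) + q) s - 0)%C with (pw PI (RtoC (INR n) + q) s) by ring.
assert (HnN := le_INR _ _ Hn). assert (HB : 0 < B) by apply exp_pos.
eapply Rle_lt_trans; [apply (Cmod_pw_le _ s (INR n)); [lra | | lra]|].
- rewrite re_plus. unfold Re at 1, RtoC; simpl. lra.
- fold c. assert (A : / Re s * ln (c / eps) < ln (INR n)).
  { rewrite <- (ln_exp (/ Re s * ln (c / eps))). apply ln_increasing; [exact HB | fold B; lra]. }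
  assert (A2 : ln (c / eps) < Re s * ln (INR n)).
  { apply Rmult_lt_compat_l with (r := Re s) in A; [|exact Hs].
    rewrite <- Rmult_assoc, Rinv_r, Rmult_1_l in A by lra. exact A. }
  apply Rlt_le_trans with (c * exp (- ln (c / eps))).
  + apply Rmult_lt_compat_l; [exact Hc|]. apply exp_increasing. lra.
  + rewrite exp_Ropp, exp_ln by (apply Rdiv_lt_0_compat; lra). right. field. lra.
Qed.

(** Integrating the Hurwitz series over a period: the primitives of the terms
    telescope. *)
Lemma hsum_period (s q : C) : 1 < Re s -> 0 < Re q ->
  is_CInt (fun t => ((s - 1) * hsum s (q + RtoC t))%C) 0 1 (pw PI q (s - 1)).
Proof.
intros Hs Hq.
assert (Hqt : forall t, 0 <= t <= 1 -> 0 < Re (q + RtoC t)).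
{ intros t Ht. rewrite re_plus. unfold Re at 2, RtoC; simpl. lra. }
assert (Hline := RCder_translate q).
assert (Hc : forall t, 0 <= t <= 1 ->
  Rcont (fun t => ((s - 1) * hsum s (q + RtoC t))%C) t).
{ intros t Ht. apply Clim_mult; [apply Clim_const|].
  exact (RCder_continuous _ _ _ (Cder_RCder_comp (hsum s) _ t _ _
    (Cder_hsum_q s _ Hs (Hqt t Ht)) (Hline t))). }
assert (HI := is_CInt_continuous _ 0 1 Rle_0_1 Hc).
set (I := CInt (fun t => ((s - 1) * hsum s (q + RtoC t))%C) 0 1) in *.
assert (Hterm : forall n, is_CInt (fun t => ((s - 1) * pw PI (RtoC (INR n) + (q + RtoC t)) s)%C)
  0 1 (pw PI (RtoC (INR n) + q) (s - 1) - pw PI (RtoC (INR (S n)) + q) (s - 1))%C).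
{ intros n.
  set (P := fun t => (- pw PI (RtoC (INR n) + (q + RtoC t)) (s - 1))%C).
  replace (pw PI (RtoC (INR n) + q) (s - 1) - pw PI (RtoC (INR (S n)) + q) (s - 1))%C
    with (P 1 - P 0)%C.
  2:{ unfold P. rewrite S_INR, RtoC_plus.
      replace (RtoC (INR n) + 1 + q)%C with (RtoC (INR n) + (q + 1))%C by ring.
      replace (q + 0)%C with q by ring. ring. }
  apply is_CInt_FTC; [lra | |].
  - intros t Ht. eapply RCder_eq.
    + apply (Cder_RCder_comp (fun v => (- pw PI (RtoC (INR n) + v) (s - 1))%C)
        (fun t => (q + RtoC t)%C)); [|apply Hline].
      apply Cder_opp, Cder_pw_shift. now apply Hqt.
    + replace (s - 1 + 1)%C with s by ring. ring.
  - intros t Ht. apply Clim_mult; [apply Clim_const|].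
    exact (RCder_continuous _ _ _ (Cder_RCder_comp (fun v => pw PI (RtoC (INR n) + v) s) _ t _ _
      (Cder_pw_shift n s _ (Hqt t Ht)) (Hline t))). }
assert (Hsum : forall N, is_CInt
  (fun t => ((s - 1) * Csum_n (fun n => pw PI (RtoC (INR n) + (q + RtoC t)) s) N)%C) 0 1
  (pw PI q (s - 1) - pw PI (RtoC (INR (S N)) + q) (s - 1))%C).
{ induction N as [|N IH].
  - assert (H := Hterm 0%nat). simpl INR in H.
    replace (RtoC 0 + q)%C with q in H by ring.
    eapply is_CInt_ext; [lra | | exact H]. intros t _. now rewrite Csum_O.
  - assert (H := is_CInt_plus _ _ _ _ _ _ IH (Hterm (S N))).
    match type of H with is_RInt _ _ _ ?x =>
      replace x with (pw PI q (s - 1) - pw PI (RtoC (INR (S (S N))) + q) (s - 1))%C in H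
        by Cring end.
    eapply is_CInt_ext; [lra | | exact H]. intros t _. cbv beta. rewrite Csum_Sn. Cring. }
set (x := Re q). set (M := fun n => exp (Rabs (Im s) * PI) * Rpower (INR n + x) (- Re s)).
assert (HM : ex_series M).
{ refine (ex_series_scal (K := R_AbsRing) (V := R_NormedModule) _ _ _).
  replace (Re s) with (1 + (Re s - 1)) by ring. apply ex_series_power; unfold x; lra. }
assert (Hdom : forall t n, 0 <= t <= 1 -> Cmod (pw PI (RtoC (INR n) + (q + RtoC t)) s) <= M n).
{ intros t n Ht. apply Cmod_pw_le; try lra.
  - unfold x. assert (A := pos_INR n). lra.
  - rewrite !re_plus, !re_RtoC. unfold x. lra. }
assert (Htail : forall N, Cmod (I - (pw PI q (s - 1) - pw PI (RtoC (INR (S N)) + q) (s - 1)))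
  <= Cmod (s - 1) * (Series M - sum_n M N)).
{ intros N. replace (Cmod (s - 1) * (Series M - sum_n M N))
    with ((1 - 0) * (Cmod (s - 1) * (Series M - sum_n M N))) by ring.
  refine (CInt_bound _ 0 1 _ _ Rle_0_1 _ (is_CInt_minus _ _ _ _ _ _ HI (Hsum N))).
  intros t Ht. simpl.
  match goal with |- Cmod ?z <= _ => replace z with
    ((s - 1) * (hsum s (q + RtoC t)
      - Csum_n (fun n => pw PI (RtoC (INR n) + (q + RtoC t)) s) N))%C by Cring end.
  rewrite Cmod_mult. apply Rmult_le_compat_l; [apply Cmod_ge_0|].
  apply Cser_tail; [intros n; now apply Hdom | exact HM |].
  apply hsum_series; [exact Hs | now apply Hqt]. }
replace (pw PI q (s - 1)) with I; [exact HI|].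
apply (Clim_unique (F := eventually) (fun _ => I)); [apply Clim_const|].
apply Clim_iff. intros eps He.
assert (Hlim := proj1 (Clim_iff (F := eventually) _ _) (pw_tends_0 (s - 1) q
  ltac:(unfold Cminus; rewrite re_plus, re_opp; unfold Re at 2, RtoC; simpl; lra) Hq)
  (eps / 2) ltac:(lra)).
destruct Hlim as [N1 HN1].
set (k := Cmod (s - 1)) in *. assert (Hk : 0 <= k) by apply Cmod_ge_0.
assert (He' : 0 < eps / 2 / (1 + k)) by (repeat apply Rdiv_lt_0_compat; lra).
destruct (proj1 (is_series_Reals M _) (Series_correct M HM) _ He') as [N2 HN2].
exists (N1 + N2)%nat. intros N HN.
specialize (HN1 (S N) ltac:(lia)). specialize (HN2 N ltac:(lia)).
rewrite <- sum_n_Reals in HN2. unfold Rdist in HN2. apply Rabs_def2 in HN2.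
specialize (Htail N).
replace (I - pw PI q (s - 1))%C
  with ((I - (pw PI q (s - 1) - pw PI (RtoC (INR (S N)) + q) (s - 1)))
    + - (pw PI (RtoC (INR (S N)) + q) (s - 1) - 0))%C by Cring.
eapply Rle_lt_trans; [apply Cmod_triangle|]. rewrite Cmod_opp.
assert (k * (Series M - sum_n M N) <= eps / 2); [|lra].
replace (eps / 2) with ((1 + k) * (eps / 2 / (1 + k))) by (field; lra).
apply Rle_trans with (k * (eps / 2 / (1 + k))); [apply Rmult_le_compat_l; lra | nra].
Qed.

(** * Continuation in the right half-plane *)

(** [A] has the analytic properties of [(s - 1) * zeta(s, q)] for [Re s > c] and [Re q > 0],
    [A'] being its derivative in [s]. *)
Record hurwitz_like (c : R) (A A' : C -> C -> C) : Prop := {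
  hl_cont : forall s q, c < Re s -> 0 < Re q -> jcont A s q;
  hl_cont' : forall s q, c < Re s -> 0 < Re q -> jcont A' s q;
  hl_ds : forall s q, c < Re s -> 0 < Re q -> Cder (fun v => A v q) s (A' s q);
  hl_dq : forall s q, c < Re s -> 0 < Re q ->
    Cder (fun v => A s v) q (- (s - 1) * A (s + 1)%C q)%C }.

Definition num0 (s q : C) : C := ((s - 1) * hsum s q)%C.
Definition num0' (s q : C) : C := (hsum s q + (s - 1) * hsum' s q)%C.

Lemma jcont_minus_1 (s q : C) : jcont (fun s _ => (s - 1)%C) s q.
Proof.
apply (jcont_fst (fun s => (s - 1)%C)), Clim_minus; [apply filterlim_id | apply Clim_const].
Qed.

Lemma jcont_mult (A B : C -> C -> C) (s q : C) :
  jcont A s q -> jcont B s q -> jcont (fun s q => (A s q * B s q)%C) s q.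
Proof. intros HA HB. exact (Clim_mult _ _ _ _ HA HB). Qed.

Lemma jcont_plus (A B : C -> C -> C) (s q : C) :
  jcont A s q -> jcont B s q -> jcont (fun s q => (A s q + B s q)%C) s q.
Proof. intros HA HB. exact (Clim_plus _ _ _ _ HA HB). Qed.

Lemma num0_hurwitz_like : hurwitz_like 1 num0 num0'.
Proof.
split; intros s q Hs Hq.
- apply jcont_mult; [apply jcont_minus_1 | now apply jcont_hsum].
- apply jcont_plus; [now apply jcont_hsum|].
  apply jcont_mult; [apply jcont_minus_1 | now apply jcont_hsum'].
- eapply Cder_eq.
  + apply (Cder_mult (fun v => (v - 1)%C)); [apply Cder_sub_const | now apply Cder_hsum_s].
  + unfold num0'. ring.
- eapply Cder_eq; [apply Cder_scal; now apply Cder_hsum_q|]. unfold num0. ring.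
Qed.

(** Let [zeta(s, q)] be given by its series.  Since its derivative in [q] is
    [- s zeta(s + 1, q)], integrating [(1 - t) zeta(s, q + t)] by parts
    and using [int_0^1 zeta(s, q + t) dt = q^(1 - s) / (s - 1)] gives
    [(s - 1) zeta(s, q) = q^(1 - s) + (s - 1) int_0^1 (1 - t) s zeta(s + 1, q + t) dt].
    For [A s q = (s - 1) zeta(s, q)] the integrand is [kernel A s q t]: the
    right-hand side, [step A s q], makes sense one unit further to the left than [A]. *)
Definition kernel (A : C -> C -> C) (s q : C) (t : R) : C :=
  (RtoC (1 - t) * A (s + 1) (q + RtoC t))%C.

Definition avg (A : C -> C -> C) (s q : C) : C := CInt (kernel A s q) 0 1.

Definition step (A : C -> C -> C) (s q : C) : C :=
  (pw PI q (s - 1) + (s - 1) * avg A s q)%C.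

Definition step' (A A' : C -> C -> C) (s q : C) : C :=
  (- Clog PI q * pw PI q (s - 1) + (avg A s q + (s - 1) * avg A' s q))%C.

Lemma Re_plus_R (q : C) (t : R) : Re (q + RtoC t) = Re q + t.
Proof. rewrite re_plus, re_RtoC. reflexivity. Qed.

Lemma Rcont_RtoC (t : R) : Rcont RtoC t.
Proof.
exact (RCder_continuous RtoC t (RtoC 1) (RCder_RtoC t)).
Qed.

Lemma Clim_kernel (c : R) (A : C -> C -> C) {T : Type} (F : (T -> Prop) -> Prop) {FF : Filter F}
  (f g : T -> C) (s q : C) (t : R) :
  (forall s q, c < Re s -> 0 < Re q -> jcont A s q) ->
  c - 1 < Re s -> 0 < Re q -> 0 <= t ->
  Clim F f s -> Clim F g q ->
  Clim (filter_prod F (nearR t)) (fun p => kernel A (f (fst p)) (g (fst p)) (snd p))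
    (kernel A s q t).
Proof.
intros A_cont Hs Hq Ht Hf Hg. apply Clim_mult.
- apply (Clim_snd _ _ (fun t => RtoC (1 - t))).
  apply (filterlim_comp _ _ _ (fun t => 1 - t) RtoC _ (nearR (1 - t))).
  + apply (continuous_minus (K := R_AbsRing) (V := R_NormedModule) (fun _ => 1) (fun t => t));
      [apply continuous_const | apply continuous_id].
  + apply Rcont_RtoC.
- assert (H1 : Clim (filter_prod F (nearR t)) (fun p => (f (fst p) + 1)%C) (s + 1)%C).
  { apply Clim_plus; [exact (Clim_fst _ _ f s Hf) | apply Clim_const]. }
  assert (H2 : Clim (filter_prod F (nearR t)) (fun p => (g (fst p) + RtoC (snd p))%C) (q + RtoC t)%C).
  { apply Clim_plus; [exact (Clim_fst _ _ g q Hg) |].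
    apply (Clim_snd _ _ RtoC), Rcont_RtoC. }
  refine (filterlim_comp_2 (G := nearC (s + 1)%C) (H := nearC (q + RtoC t)%C)
    _ _ A H1 H2 _).
  apply A_cont; rewrite Re_plus_R; lra.
Qed.

Lemma Rcont_kernel (c : R) (A : C -> C -> C) (s q : C) (t : R) :
  (forall s q, c < Re s -> 0 < Re q -> jcont A s q) ->
  c - 1 < Re s -> 0 < Re q -> 0 <= t ->
  Rcont (kernel A s q) t.
Proof.
intros A_cont Hs Hq Ht.
apply (filter_prod_slice (nearC s) t (fun v => kernel A v q) s); [apply nearC_point|].
exact (Clim_kernel c A (nearC s) (fun v => v) (fun _ => q) s q t A_cont Hs Hq Ht
  (filterlim_id _ _) (Clim_const q)).
Qed.

Lemma near_Re (z : C) (x : R) : x < Re z -> nearC z (fun w => x < Re w).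
Proof.
intros H. apply nearC_iff. exists (Re z - x). split; [lra|]. intros w Hw.
assert (A1 := Re_Lipschitz w z). apply Rabs_le_between in A1. lra.
Qed.

Lemma jcont_avg (c : R) (A : C -> C -> C) (s q : C) :
  (forall s q, c < Re s -> 0 < Re q -> jcont A s q) ->
  c - 1 < Re s -> 0 < Re q -> jcont (avg A) s q.
Proof.
intros A_cont Hs Hq.
apply (CInt_param_continuous (filter_prod (nearC s) (nearC q))
  (fun p => kernel A (fst p) (snd p)) (s, q) 0 1); [lra | | |].
- intros P [Q1 Q2 H1 H2 H]. apply H; now apply nearC_point.
- exists (fun w => c - 1 < Re w) (fun w => 0 < Re w); [now apply near_Re | now apply near_Re |].
  intros v w Hv Hw t Ht. apply (Rcont_kernel c); (assumption || lra).
- intros t Ht. exact (Clim_kernel c A (filter_prod (nearC s) (nearC q)) fst snd s q t A_cont Hs Hq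
    (proj1 Ht) filterlim_fst filterlim_snd).
Qed.

Lemma is_avg (c : R) (A : C -> C -> C) (s q : C) :
  (forall s q, c < Re s -> 0 < Re q -> jcont A s q) -> c - 1 < Re s -> 0 < Re q ->
  is_CInt (kernel A s q) 0 1 (avg A s q).
Proof.
intros H Hs Hq. apply is_CInt_continuous; [lra|]. intros t Ht.
apply (Rcont_kernel c); (assumption || lra).
Qed.

Lemma Cder_avg_s (c : R) (A A' : C -> C -> C) (s q : C) : hurwitz_like c A A' ->
  c - 1 < Re s -> 0 < Re q -> Cder (fun v => avg A v q) s (avg A' s q).
Proof.
intros H Hs Hq.
destruct (proj1 (nearC_iff _ _) (near_Re s (c - 1) Hs)) as [r [Hr Hnear]].
apply (Cder_CInt (fun v t => kernel A v q t) (fun v t => kernel A' v q t) s 0 1 r); try lra.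
- intros w t Hw Ht. specialize (Hnear w Hw).
  apply (Cder_scal (fun v => A (v + 1)%C (q + RtoC t)%C)).
  apply (Cder_translate (fun v => A v (q + RtoC t)%C)).
  apply (hl_ds _ _ _ H); rewrite Re_plus_R; lra.
- intros w t Hw Ht. specialize (Hnear w Hw).
  apply (Rcont_kernel c); [apply (hl_cont _ _ _ H) | lra | lra | lra].
- intros t Ht.
  exact (Clim_kernel c A' (nearC s) (fun v => v) (fun _ => q) s q t (hl_cont' _ _ _ H) Hs Hq
    (proj1 Ht) (filterlim_id _ _) (Clim_const q)).
Qed.

Lemma Cder_avg_q (c : R) (A A' : C -> C -> C) (s q : C) : hurwitz_like c A A' ->
  c - 1 < Re s -> 0 < Re q -> Cder (fun v => avg A s v) q (- s * avg A (s + 1) q)%C.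
Proof.
intros H Hs Hq.
destruct (proj1 (nearC_iff _ _) (near_Re q 0 Hq)) as [r [Hr Hnear]].
assert (Hs1 : c - 1 < Re (s + 1)) by (rewrite Re_plus_R; lra).
replace (- s * avg A (s + 1) q)%C
  with (CInt (fun t => (- s * kernel A (s + 1) q t)%C) 0 1).
2:{ apply is_CInt_unique, is_CInt_scal, (is_avg c); [apply (hl_cont _ _ _ H) | exact Hs1 | exact Hq]. }
apply (Cder_CInt (fun v t => kernel A s v t)
  (fun v t => (- s * kernel A (s + 1) v t)%C) q 0 1 r); try lra.
- intros w t Hw Ht. specialize (Hnear w Hw).
  eapply Cder_eq.
  + apply (Cder_scal (fun v => A (s + 1)%C (v + RtoC t)%C)).
    apply (Cder_translate (A (s + 1)%C)).
    apply (hl_dq _ _ _ H); rewrite Re_plus_R; lra.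
  + unfold kernel. ring.
- intros w t Hw Ht. specialize (Hnear w Hw).
  apply (Rcont_kernel c); [apply (hl_cont _ _ _ H) | lra | lra | lra].
- intros t Ht. apply Clim_mult; [apply Clim_const|].
  exact (Clim_kernel c A (nearC q) (fun _ => (s + 1)%C) (fun v => v)
    (s + 1)%C q t (hl_cont _ _ _ H) Hs1 Hq (proj1 Ht) (Clim_const _) (filterlim_id _ _)).
Qed.

Lemma jcont_pw_shift (s q : C) : 0 < Re q -> jcont (fun s q => pw PI q (s - 1)) s q.
Proof.
intros Hq. apply Clim_Cexp, Clim_mult.
- apply Clim_opp, (jcont_minus_1 s q).
- apply (jcont_snd (Clog PI)).
  exact (Cder_continuous _ _ _ (Cder_Clog PI q PI_ok (off_ray_PI q Hq))).
Qed.

Lemma step_hurwitz_like (c : R) (A A' : C -> C -> C) :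
  hurwitz_like c A A' -> hurwitz_like (c - 1) (step A) (step' A A').
Proof.
intros H. split; intros s q Hs Hq.
- apply jcont_plus; [now apply jcont_pw_shift|].
  apply jcont_mult; [apply jcont_minus_1|].
  apply (jcont_avg c); [apply (hl_cont _ _ _ H) | exact Hs | exact Hq].
- assert (HA := jcont_avg c A s q (hl_cont _ _ _ H) Hs Hq).
  assert (HA' := jcont_avg c A' s q (hl_cont' _ _ _ H) Hs Hq).
  apply jcont_plus.
  + apply (jcont_mult (fun _ q => (- Clog PI q)%C)); [|now apply jcont_pw_shift].
    apply (jcont_snd (fun q => (- Clog PI q)%C)), Clim_opp.
    exact (Cder_continuous _ _ _ (Cder_Clog PI q PI_ok (off_ray_PI q Hq))).
  + apply jcont_plus; [exact HA|].
    apply jcont_mult; [apply jcont_minus_1 | exact HA'].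
- eapply Cder_eq.
  + apply Cder_plus.
    * apply (Cder_comp (fun v => pw PI q v) (fun v => (v - 1)%C));
        [apply Cder_pw_exponent | apply Cder_sub_const].
    * apply (Cder_mult (fun v => (v - 1)%C));
        [apply Cder_sub_const | exact (Cder_avg_s c A A' s q H Hs Hq)].
  + unfold step'. ring.
- eapply Cder_eq.
  + apply Cder_plus.
    * apply Cder_pw_base; [exact PI_ok | now apply off_ray_PI].
    * apply Cder_scal. exact (Cder_avg_q c A A' s q H Hs Hq).
  + unfold step. replace (s + 1 - 1)%C with s by ring.
    replace (s - 1 + 1)%C with s by ring. ring.
Qed.

(** The integration by parts that motivates [step]. *)
Lemma step_num0 (s q : C) : 1 < Re s -> 0 < Re q -> step num0 s q = num0 s q.
Proof.
intros Hs Hq. assert (H := num0_hurwitz_like).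
assert (Hqt : forall t, 0 <= t <= 1 -> 0 < Re (q + RtoC t)) by (intros t Ht; rewrite Re_plus_R; lra).
assert (Hline := RCder_translate q).
assert (Hd : forall t, 0 <= t <= 1 ->
  RCder (fun t => num0 s (q + RtoC t)) t (- (s - 1) * num0 (s + 1) (q + RtoC t))%C).
{ intros t Ht. eapply RCder_eq.
  - apply (Cder_RCder_comp (num0 s) (fun t => (q + RtoC t)%C)); [|apply Hline].
    apply (hl_dq _ _ _ H); [exact Hs | now apply Hqt].
  - ring. }
assert (Hk : is_CInt (kernel num0 s q) 0 1 (avg num0 s q)).
{ apply (is_avg 1); [apply (hl_cont _ _ _ H) | lra | exact Hq]. }
assert (Hp := hsum_period s q Hs Hq).
change (is_CInt (fun t => num0 s (q + RtoC t)%C) 0 1 (pw PI q (s - 1))) in Hp.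
set (f := fun t => (- ((RtoC 1 - RtoC t) * num0 s (q + RtoC t)))%C).
assert (Hf : is_CInt (fun t => (num0 s (q + RtoC t) + (s - 1) * kernel num0 s q t)%C) 0 1
  (f 1 - f 0)%C).
{ apply is_CInt_FTC; [lra | |].
  - intros t Ht. eapply RCder_eq.
    + apply (Cder_RCder_comp (fun v => (- ((RtoC 1 - v) * num0 s (q + v)))%C) RtoC);
        [|apply RCder_RtoC].
      apply Cder_opp, (Cder_mult (fun v => (RtoC 1 - v)%C)).
      * apply Cder_minus; [apply Cder_const | apply Cder_id].
      * apply (Cder_translate_l (num0 s)), (hl_dq _ _ _ H); [exact Hs | now apply Hqt].
    + unfold kernel. rewrite RtoC_minus. ring.
  - intros t Ht. apply Clim_plus.
    + exact (RCder_continuous _ _ _ (Hd t Ht)).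
    + apply Clim_mult; [apply Clim_const|].
      apply (Rcont_kernel 1); [apply (hl_cont _ _ _ H) | lra | exact Hq | lra]. }
assert (Hsum := is_CInt_plus _ _ _ _ _ _ Hp (is_CInt_scal _ (s - 1)%C _ _ _ Hk)).
assert (E1 := is_CInt_unique _ _ _ _ Hf). rewrite (is_CInt_unique _ _ _ _ Hsum) in E1.
unfold step. transitivity (f 1 - f 0)%C; [exact E1|].
unfold f. replace (q + 0)%C with q by ring. ring.
Qed.

(** [num k] is [(s - 1) zeta(s, q)] for [Re s > 1 - k]. *)
Fixpoint num (k : nat) : C -> C -> C :=
  match k with O => num0 | S k => step (num k) end.

Fixpoint num' (k : nat) : C -> C -> C :=
  match k with O => num0' | S k => step' (num k) (num' k) end.

Lemma num_hurwitz_like (k : nat) : hurwitz_like (1 - INR k) (num k) (num' k).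
Proof.
induction k as [|k IH].
- simpl. rewrite Rminus_0_r. apply num0_hurwitz_like.
- rewrite S_INR. replace (1 - (INR k + 1)) with (1 - INR k - 1) by ring.
  now apply step_hurwitz_like.
Qed.

(** [step A s] depends only on the values of [A (s + 1)], where the induction
    hypothesis applies. *)
Lemma num_S (k : nat) (s q : C) : 1 - INR k < Re s -> 0 < Re q ->
  num (S k) s q = num k s q.
Proof.
revert s q. induction k as [|k IH]; intros s q Hs Hq.
- simpl in *. apply step_num0; lra.
- rewrite S_INR in Hs.
  assert (E : avg (num (S k)) s q = avg (num k) s q).
  { apply (RInt_ext (V := C_R_CompleteNormedModule)). intros t Ht.
    rewrite Rmin_left, Rmax_right in Ht by lra. unfold kernel.
    rewrite IH; [reflexivity | |]; rewrite Re_plus_R; lra. }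
  change (step (num (S k)) s q = step (num k) s q). unfold step at 1. now rewrite E.
Qed.

Lemma num_le (j k : nat) (s q : C) : (j <= k)%nat -> 1 - INR j < Re s -> 0 < Re q ->
  num k s q = num j s q.
Proof.
intros Hjk Hs Hq. induction Hjk as [|k Hjk IH]; [reflexivity|].
rewrite num_S; [exact IH | | exact Hq]. apply le_INR in Hjk. lra.
Qed.

Lemma num_agree (j k : nat) (s q : C) : 1 - INR j < Re s -> 1 - INR k < Re s -> 0 < Re q ->
  num k s q = num j s q.
Proof.
intros Hj Hk Hq. destruct (Nat.le_ge_cases j k) as [L|L].
- now apply num_le.
- symmetry. now apply num_le.
Qed.

Definition level (s : C) : nat := Z.to_nat (up (1 - Re s)).

Lemma level_spec (s : C) : 1 - INR (level s) < Re s.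
Proof.
unfold level. destruct (archimed (1 - Re s)) as [H _].
destruct (Z.le_gt_cases 0 (up (1 - Re s))) as [Hz|Hz].
- rewrite INR_IZR_INZ, Z2Nat.id by exact Hz. lra.
- assert (IZR (up (1 - Re s)) <= 0) by (apply IZR_le; lia).
  assert (A := pos_INR (Z.to_nat (up (1 - Re s)))). lra.
Qed.

(** [(s - 1) * zeta(s, q)] for [Re q > 0] and all [s], and its derivative in [s]. *)
Definition num_right (s q : C) : C := num (level s) s q.
Definition num_right' (s q : C) : C := num' (level s) s q.

Lemma num_right_eq (k : nat) (s q : C) : 1 - INR k < Re s -> 0 < Re q -> num_right s q = num k s q.
Proof. intros Hs Hq. apply num_agree; [exact Hs | apply level_spec | exact Hq]. Qed.

Lemma Cder_num_right_s (s q : C) : 0 < Re q -> Cder (fun v => num_right v q) s (num_right' s q).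
Proof.
intros Hq. apply (Cder_ext (fun v => num (level s) v q)).
- generalize (near_Re s _ (level_spec s)). apply filter_imp. intros v Hv.
  symmetry. now apply num_right_eq.
- apply (hl_ds _ _ _ (num_hurwitz_like (level s))); [apply level_spec | exact Hq].
Qed.

Lemma num_right'_eq (k : nat) (s q : C) : 1 - INR k < Re s -> 0 < Re q -> num_right' s q = num' k s q.
Proof.
intros Hs Hq. apply (Cder_unique (fun v => num_right v q) s); [now apply Cder_num_right_s|].
apply (Cder_ext (fun v => num k v q)).
- generalize (near_Re s _ Hs). apply filter_imp. intros v Hv.
  symmetry. now apply num_right_eq.
- now apply (hl_ds _ _ _ (num_hurwitz_like k)).
Qed.

Lemma jcont_ext (A B : C -> C -> C) (s q : C) (x y : R) : x < Re s -> y < Re q ->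
  (forall v w, x < Re v -> y < Re w -> A v w = B v w) -> jcont A s q -> jcont B s q.
Proof.
intros Hs Hq H HA. unfold jcont. rewrite <- (H s q Hs Hq).
apply (Clim_ext (fun p => A (fst p) (snd p))); [|exact HA].
exists (fun v => x < Re v) (fun w => y < Re w); [now apply near_Re | now apply near_Re |].
intros v w Hv Hw. now apply H.
Qed.

Theorem num_right_hurwitz_like (c : R) : hurwitz_like c num_right num_right'.
Proof.
split; intros s q _ Hq.
- apply (jcont_ext (num (level s)) num_right s q _ 0 (level_spec s) Hq).
  + intros v w Hv Hw. symmetry. now apply num_right_eq.
  + apply (hl_cont _ _ _ (num_hurwitz_like (level s))); [apply level_spec | exact Hq].
- apply (jcont_ext (num' (level s)) num_right' s q _ 0 (level_spec s) Hq).
  + intros v w Hv Hw. symmetry. now apply num_right'_eq.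
  + apply (hl_cont' _ _ _ (num_hurwitz_like (level s))); [apply level_spec | exact Hq].
- now apply Cder_num_right_s.
- assert (Hs := level_spec s). set (k := level s) in *.
  rewrite (num_right_eq k (s + 1) q) by (rewrite ?Re_plus_R; lra).
  apply (Cder_ext (fun v => num k s v)).
  + generalize (near_Re q 0 Hq). apply filter_imp. intros v Hv.
    symmetry. now apply num_right_eq.
  + apply (hl_dq _ _ _ (num_hurwitz_like k)); [exact Hs | exact Hq].
Qed.

Lemma num_right_series (s q : C) : 1 < Re s -> 0 < Re q -> num_right s q = ((s - 1) * hsum s q)%C.
Proof. intros Hs Hq. rewrite (num_right_eq 0); [reflexivity | simpl; lra | exact Hq]. Qed.

Lemma num_right_1 (q : C) : 0 < Re q -> num_right (RtoC 1) q = 1.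
Proof.
intros Hq. rewrite (num_right_eq 1); [|change (INR 1) with 1; rewrite re_RtoC; lra | exact Hq].
change (step num0 (RtoC 1) q = 1). unfold step.
replace (RtoC 1 - 1)%C with (RtoC 0) by ring. rewrite pw_0. ring.
Qed.

(** * The Hurwitz zeta function for an arbitrary branch *)

(** Exchange of two partial derivatives: the second difference of [A] is estimated
    in one variable after the other. *)
Lemma Cder_swap (A A' D D' : C -> C -> C) (s q : C) (r : R) : 0 < r ->
  (forall w, Cmod (w - q) < r -> Cder (fun v => A v w) s (A' s w)) ->
  (forall v w, Cmod (v - s) < r -> Cmod (w - q) < r -> Cder (fun w => A v w) w (D v w)) ->
  (forall v w, Cmod (v - s) < r -> Cmod (w - q) < r -> Cder (fun v => D v w) v (D' v w)) ->
  jcont D' s q -> Cder (fun w => A' s w) q (D' s q).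
Proof.
intros Hr HA HD HD' Hc. apply Cder_iff. intros eps He.
destruct (proj1 (Clim_iff _ _) Hc eps He) as [P1 P2 HP1 HP2 HP].
apply nearC_iff in HP1. destruct HP1 as [r1 [Hr1 HP1]].
apply nearC_iff in HP2. destruct HP2 as [r2 [Hr2 HP2]].
exists (Rmin r r2). split; [now apply Rmin_pos|]. intros w Hw.
assert (Hw1 := Rlt_le_trans _ _ _ Hw (Rmin_l _ _)).
assert (Hw2 := Rlt_le_trans _ _ _ Hw (Rmin_r _ _)).
assert (HW := Cmod_ge_0 (w - q)).
assert (Hdiff : forall v, Cmod (v - s) < Rmin r r1 ->
  Cmod ((A v w - A s w) - (A v q - A s q) - (w - q) * ((v - s) * D' s q))
    <= eps * Cmod (v - s) * Cmod (w - q)).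
{ intros v Hv.
  assert (Hv1 := Rlt_le_trans _ _ _ Hv (Rmin_l _ _)).
  assert (Hv2 := Rlt_le_trans _ _ _ Hv (Rmin_r _ _)).
  assert (Hss := Cmod_refl_lt s r Hr).
  assert (Hseg : forall t, 0 <= t <= 1 -> Cmod (segment q w t - q) < Rmin r r2).
  { intros t Ht. eapply Rle_lt_trans; [now apply segment_close | exact Hw]. }
  apply (Cder_mean_value (fun w => (A v w - A s w)%C) (fun w => (D v w - D s w)%C)).
  - intros t Ht. specialize (Hseg t Ht).
    assert (Hs1 := Rlt_le_trans _ _ _ Hseg (Rmin_l _ _)).
    apply Cder_minus; now apply HD.
  - intros t Ht. specialize (Hseg t Ht).
    assert (Hs1 := Rlt_le_trans _ _ _ Hseg (Rmin_l _ _)).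
    assert (Hs2 := Rlt_le_trans _ _ _ Hseg (Rmin_r _ _)).
    apply (Cder_mean_value (fun v => D v (segment q w t)) (fun v => D' v (segment q w t))).
    + intros u Hu. apply HD'; [|exact Hs1].
      eapply Rle_lt_trans; [now apply segment_close | exact Hv1].
    + intros u Hu. apply Rlt_le, HP; [apply HP1 | now apply HP2].
      eapply Rle_lt_trans; [now apply segment_close | exact Hv2]. }
apply le_epsilon. intros eta Heta.
assert (He2 : 0 < eta / 2) by lra.
destruct (proj1 (Cder_iff _ _ _) (HA w Hw1) _ He2) as [d1 [Hd1 H1]].
destruct (proj1 (Cder_iff _ _ _) (HA q (Cmod_refl_lt q r Hr)) _ He2) as [d2 [Hd2 H2]].
set (h := Rmin (Rmin d1 d2) (Rmin r r1) / 2).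
assert (Hh : 0 < h).
{ unfold h. assert (0 < Rmin (Rmin d1 d2) (Rmin r r1)) by (repeat apply Rmin_pos; assumption). lra. }
assert (Hh1 : h < Rmin d1 d2).
{ assert (B := Rmin_l (Rmin d1 d2) (Rmin r r1)). unfold h in *. lra. }
assert (Hh2 : h < Rmin r r1).
{ assert (B := Rmin_r (Rmin d1 d2) (Rmin r r1)). unfold h in *. lra. }
set (v := (s + RtoC h)%C).
assert (Ev : (v - s)%C = RtoC h) by (unfold v; ring).
assert (Em : Cmod (v - s) = h) by (rewrite Ev, Cmod_R; apply Rabs_pos_eq; lra).
specialize (H1 v). specialize (H2 v). specialize (Hdiff v).
rewrite Em in *. rewrite Ev in *.
specialize (H1 (Rlt_le_trans _ _ _ Hh1 (Rmin_l _ _))).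
specialize (H2 (Rlt_le_trans _ _ _ Hh1 (Rmin_r _ _))).
specialize (Hdiff Hh2).
apply Rmult_le_reg_l with h; [exact Hh|].
assert (E : h * Cmod (A' s w - A' s q - (w - q) * D' s q)
  = Cmod (RtoC h * (A' s w - A' s q - (w - q) * D' s q))).
{ rewrite Cmod_mult, Cmod_R, Rabs_pos_eq by lra. reflexivity. }
rewrite E.
replace (RtoC h * (A' s w - A' s q - (w - q) * D' s q))%C
  with (((A v w - A s w) - (A v q - A s q) - (w - q) * (RtoC h * D' s q))
    + (- (A v w - A s w - RtoC h * A' s w) + (A v q - A s q - RtoC h * A' s q)))%C by ring.
eapply Rle_trans; [apply Cmod_triangle|].
eapply Rle_trans; [apply Rplus_le_compat_l, Cmod_triangle|].
rewrite Cmod_opp. lra.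
Qed.

(** The mixed derivative, from the derivative in [q] of [num_right], which is again
    expressed by [num_right]. *)
Lemma Cder_num_right'_q (s q : C) : 0 < Re q ->
  Cder (fun w => num_right' s w) q
    (- num_right (s + 1) q + - (s - 1) * num_right' (s + 1) q)%C.
Proof.
intros Hq.
destruct (proj1 (nearC_iff _ _) (near_Re q 0 Hq)) as [r [Hr Hnear]].
assert (H := num_right_hurwitz_like (Re s)). assert (H0 := num_right_hurwitz_like (Re s - 1)).
apply (Cder_swap num_right num_right' (fun v w => (- (v - 1) * num_right (v + 1) w)%C)
  (fun v w => (- num_right (v + 1) w + - (v - 1) * num_right' (v + 1) w)%C) s q r Hr).
- intros w Hw. apply Cder_num_right_s. now apply Hnear.
- intros v w _ Hw. apply (hl_dq _ _ _ (num_right_hurwitz_like (Re v - 1))); [lra | now apply Hnear].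
- intros v w _ Hw. eapply Cder_eq.
  + apply (Cder_mult (fun v => (- (v - 1))%C)).
    * apply Cder_opp, Cder_sub_const.
    * apply (Cder_translate (fun v => num_right v w)), Cder_num_right_s. now apply Hnear.
  + cbv beta. ring.
- assert (Hs1 : Re s < Re (s + 1)) by (rewrite Re_plus_R; lra).
  assert (Hf : Clim (filter_prod (nearC s) (nearC q)) (fun p => (fst p + 1)%C) (s + 1)%C).
  { apply (Clim_fst _ _ (fun v => (v + 1)%C)), Clim_plus; [apply filterlim_id | apply Clim_const]. }
  assert (J1 : jcont (fun v w => num_right (v + 1) w) s q).
  { exact (filterlim_comp_2 (G := nearC (s + 1)%C) (H := nearC q) _ _ num_right Hf filterlim_snd
      (hl_cont _ _ _ H _ _ Hs1 Hq)). }
  assert (J2 : jcont (fun v w => num_right' (v + 1) w) s q).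
  { exact (filterlim_comp_2 (G := nearC (s + 1)%C) (H := nearC q) _ _ num_right' Hf filterlim_snd
      (hl_cont' _ _ _ H _ _ Hs1 Hq)). }
  apply (jcont_plus (fun v w => (- num_right (v + 1) w)%C)).
  + apply Clim_opp, J1.
  + apply (jcont_mult (fun v _ => (- (v - 1))%C)); [|exact J2].
    apply Clim_opp, (jcont_minus_1 s q).
Qed.

Lemma Cder_sum_lt (f df : nat -> C -> C) (z : C) (N : nat) :
  (forall n, (n < N)%nat -> Cder (f n) z (df n z)) ->
  Cder (fun v => Csum_lt (fun n => f n v) N) z (Csum_lt (fun n => df n z) N).
Proof.
intros H. induction N as [|N IH]; [exact (Cder_const (RtoC 0) z)|].
simpl. apply Cder_plus; [apply IH; intros n Hn; apply H; lia | apply H; lia].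
Qed.

Lemma Csum_lt_scal (c : C) (a : nat -> C) (N : nat) :
  Csum_lt (fun n => (c * a n)%C) N = (c * Csum_lt a N)%C.
Proof. induction N as [|N IH]; simpl; [ring|]. rewrite IH. ring. Qed.

Lemma Csum_lt_plus (a b : nat -> C) (N : nat) :
  Csum_lt (fun n => (a n + b n)%C) N = (Csum_lt a N + Csum_lt b N)%C.
Proof. induction N as [|N IH]; simpl; [ring|]. rewrite IH. ring. Qed.

(** [(s - 1) * zeta(s, q)], where the first [N] terms of the series follow the branch
    [theta] and the others the principal branch; and its derivative in [s]. *)
Definition num_branch (theta : R) (N : nat) (s q : C) : C :=
  ((s - 1) * Csum_lt (fun n => pw theta (RtoC (INR n) + q) s) N + num_right s (q + RtoC (INR N)))%C.

Definition num_branch' (theta : R) (N : nat) (s q : C) : C :=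
  (Csum_lt (fun n => pw theta (RtoC (INR n) + q) s) N
   + (s - 1) * Csum_lt (fun n => - Clog theta (RtoC (INR n) + q)
       * pw theta (RtoC (INR n) + q) s) N
   + num_right' s (q + RtoC (INR N)))%C.

Lemma Cder_num_branch_s (theta : R) (N : nat) (s q : C) : 0 < Re (q + RtoC (INR N)) ->
  Cder (fun v => num_branch theta N v q) s (num_branch' theta N s q).
Proof.
intros Hq. eapply Cder_eq.
- apply Cder_plus; [|now apply Cder_num_right_s].
  apply (Cder_mult (fun v => (v - 1)%C)); [apply Cder_sub_const|].
  apply (Cder_sum_lt (fun n v => pw theta (RtoC (INR n) + q) v)
    (fun n v => (- Clog theta (RtoC (INR n) + q) * pw theta (RtoC (INR n) + q) v)%C)).
  intros n _. apply Cder_pw_exponent.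
- unfold num_branch'. ring.
Qed.

Lemma Cder_num_branch_q (theta : R) (N : nat) (s q : C) : theta_ok theta ->
  0 < Re (q + RtoC (INR N)) -> off_cuts theta q ->
  Cder (fun w => num_branch theta N s w) q (- (s - 1) * num_branch theta N (s + 1) q)%C.
Proof.
intros Ht Hq Ho. eapply Cder_eq.
- apply Cder_plus.
  + apply Cder_scal.
    apply (Cder_sum_lt (fun n w => pw theta (RtoC (INR n) + w) s)
      (fun n w => (- s * pw theta (RtoC (INR n) + w) (s + 1))%C)).
    intros n _. apply Cder_pw_translate; [exact Ht | exact (Ho n)].
  + apply (Cder_translate (num_right s)).
    apply (hl_dq _ _ _ (num_right_hurwitz_like (Re s - 1))); [lra | exact Hq].
- rewrite Csum_lt_scal. unfold num_branch. ring.
Qed.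

Lemma Cder_num_branch'_q (theta : R) (N : nat) (s q : C) : theta_ok theta ->
  0 < Re (q + RtoC (INR N)) -> off_cuts theta q ->
  Cder (fun w => num_branch' theta N s w) q
    (- num_branch theta N (s + 1) q - (s - 1) * num_branch' theta N (s + 1) q)%C.
Proof.
intros Ht Hq Ho. eapply Cder_eq.
- apply Cder_plus; [apply Cder_plus|].
  + apply (Cder_sum_lt (fun n w => pw theta (RtoC (INR n) + w) s)
      (fun n w => (- s * pw theta (RtoC (INR n) + w) (s + 1))%C)).
    intros n _. apply Cder_pw_translate; [exact Ht | exact (Ho n)].
  + apply Cder_scal.
    apply (Cder_sum_lt (fun n w => - Clog theta (RtoC (INR n) + w) * pw theta (RtoC (INR n) + w) s)%C
      (fun n w => (- 1 * pw theta (RtoC (INR n) + w) (s + 1)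
        + - s * (- Clog theta (RtoC (INR n) + w) * pw theta (RtoC (INR n) + w) (s + 1)))%C)).
    intros n _. assert (Hn : off_ray theta (RtoC (INR n) + q)) by exact (Ho n).
    assert (Hn0 := off_ray_neq_0 _ _ Hn).
    eapply Cder_eq.
    * apply (Cder_mult (fun w => (- Clog theta (RtoC (INR n) + w))%C)).
      -- now apply Cder_opp, (Cder_translate_l (Clog theta)), Cder_Clog.
      -- now apply Cder_pw_translate.
    * rewrite pw_plus, pw_1 by assumption. field. exact Hn0.
  + apply (Cder_translate (num_right' s)), Cder_num_right'_q, Hq.
- rewrite Csum_lt_plus, !Csum_lt_scal. unfold num_branch, num_branch'.
  replace (q + RtoC (INR N))%C with (q + RtoC (INR N))%C by ring. ring.
Qed.

(** [N] is where the series can be split: from there on, its terms are those of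
    the principal branch, and [num_right] applies. *)
Definition principal_from (theta : R) (N : nat) (q : C) : Prop :=
  0 < Re (q + RtoC (INR N)) /\
  forall n, (N <= n)%nat -> Clog theta (RtoC (INR n) + q) = Clog PI (RtoC (INR n) + q).

(** The argument of [n + w] tends to [0], which lies inside the interval
    of the arguments for the branch [theta]. *)
Lemma principal_from_near (theta : R) (q : C) : theta_ok theta ->
  exists N, nearC q (principal_from theta N).
Proof.
intros Ht. destruct Ht as [Ht1 Ht2].
set (e := Rmin theta (2 * PI - theta)).
assert (He : 0 < e) by (apply Rmin_pos; lra).
assert (He1 : e <= theta) by apply Rmin_l.
assert (He2 : e <= 2 * PI - theta) by apply Rmin_r.
set (b := Rabs (Im q) + 1).
assert (Hb : 0 < b) by (unfold b; assert (A := Rabs_pos (Im q)); lra).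
destruct (INR_unbounded (2 - Re q + 2 * b / e)) as [N HN].
assert (Hbe : 0 < 2 * b / e) by (apply Rdiv_lt_0_compat; lra).
exists N. apply nearC_iff. exists 1. split; [lra|]. intros w Hw.
assert (Hre := Rle_lt_trans _ _ _ (Re_Lipschitz w q) Hw).
assert (Him := Rle_lt_trans _ _ _ (Im_Lipschitz w q) Hw).
apply Rabs_def2 in Hre.
assert (Hiw : Rabs (Im w) <= b).
{ unfold b. replace (Im w) with ((Im w - Im q) + Im q) by ring.
  eapply Rle_trans; [apply Rabs_triang|]. lra. }
split; [rewrite Re_plus_R; lra|].
intros n Hn. apply le_INR in Hn.
set (u := (RtoC (INR n) + w)%C).
assert (Hru : Re u = INR n + Re w) by (unfold u; rewrite re_plus, re_RtoC; reflexivity).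
assert (Hiu : Im u = Im w) by (unfold u; rewrite im_plus, im_RtoC; ring).
assert (Hpos : 0 < Re u) by lra.
assert (Hat : Rabs (atan (Im u / Re u)) <= e / 2).
{ eapply Rle_trans; [apply atan_abs|]. unfold Rdiv.
  rewrite Rabs_mult, Rabs_inv, (Rabs_pos_eq (Re u)) by lra.
  apply Rmult_le_reg_r with (Re u); [exact Hpos|].
  rewrite Rmult_assoc, Rinv_l by lra. rewrite Rmult_1_r, Hiu.
  assert (E : 2 * b / e * (e / 2) = b) by (field; lra).
  assert (e / 2 * (2 * b / e) <= e / 2 * Re u) by (apply Rmult_le_compat_l; lra).
  unfold Rdiv in *. lra. }
apply Rabs_le_between in Hat.
unfold Clog. rewrite (Carg_right theta), Carg_PI_right; try lra.
- reflexivity.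
- split; assumption.
Qed.

Lemma Clim_punctured (f : C -> C) (z l : C) :
  Clim (nearC z) f l -> Clim (locally' (T := C_UniformSpace) z) f l.
Proof.
intros H P HP. generalize (H P HP). unfold filtermap, locally', within.
apply filter_imp. intros w Hw _. exact Hw.
Qed.

Lemma Cder_inv (a : C) : a <> RtoC 0 -> Cder Cinv a (- / (a * a))%C.
Proof.
intros Ha. apply Cder_quotient.
apply (Clim_ext (fun w => (- (/ w * / a))%C)).
- assert (Hnz : nearC a (fun w => w <> RtoC 0)).
  { apply nearC_iff. exists (Cmod a). split; [now apply Cmod_gt_0|].
    intros w Hw ->. replace (RtoC 0 - a)%C with (- a)%C in Hw by ring.
    rewrite Cmod_opp in Hw. lra. }
  revert Hnz. unfold locally', within. apply filter_imp. intros w Hw0 Hwa.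
  apply Cminus_eq_contra in Hwa. field. auto.
- replace (- / (a * a))%C with (- (/ a * / a))%C by (field; exact Ha).
  apply Clim_opp, Clim_mult; [|apply Clim_const].
  apply Clim_inv; [exact Ha | apply Clim_punctured, filterlim_id].
Qed.

(** The residue is the value at [s = 1] of the numerator, which [step] makes
    equal to [q^0]. *)
Lemma num_branch_hurwitz (theta : R) (N : nat) (q : C) : principal_from theta N q ->
  is_hurwitz_zeta theta q (fun s => (num_branch theta N s q / (s - 1))%C).
Proof.
intros [Hq HN]. split; [|split].
- intros s Hs.
  assert (Hs1 : (s - 1)%C <> RtoC 0).
  { intros E. apply Ceq_minus in E. subst s. rewrite re_RtoC in Hs. lra. }
  apply (Cser_ext (fun n => pw theta (RtoC (INR n) + q) s)).
  { intros n. now rewrite pw_Cpower. }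
  replace (num_branch theta N s q / (s - 1))%C
    with (Csum_lt (fun n => pw theta (RtoC (INR n) + q) s) N + hsum s (q + RtoC (INR N)))%C.
  + apply (Cser_shift (fun n => pw theta (RtoC (INR n) + q) s)).
    apply (Cser_ext (fun n => pw PI (RtoC (INR n) + (q + RtoC (INR N))) s)).
    * intros n. unfold pw.
      replace (RtoC (INR n) + (q + RtoC (INR N)))%C with (RtoC (INR (N + n)) + q)%C
        by (rewrite plus_INR, RtoC_plus; ring).
      rewrite HN by lia. reflexivity.
    * now apply hsum_series.
  + unfold num_branch. rewrite num_right_series by assumption. field. exact Hs1.
- intros s Hs. assert (Hs1 : (s - 1)%C <> RtoC 0) by now apply Cminus_eq_contra.
  exists ((num_branch' theta N s q * / (s - 1)
    + num_branch theta N s q * (RtoC 1 * - / ((s - 1) * (s - 1))))%C).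
  apply (Cder_mult (fun v => num_branch theta N v q) (fun v => (/ (v - 1))%C)).
  + now apply Cder_num_branch_s.
  + apply (Cder_comp Cinv (fun v => (v - 1)%C)); [|apply Cder_sub_const].
    now apply Cder_inv.
- apply (Clim_ext (fun s => num_branch theta N s q)).
  + apply nearC_iff. exists 1. split; [lra|]. intros s _ Hs.
    apply Cminus_eq_contra in Hs. field. exact Hs.
  + apply Clim_punctured. replace (RtoC 1) with (num_branch theta N (RtoC 1) q) at 2.
    * exact (Cder_continuous _ _ _ (Cder_num_branch_s theta N (RtoC 1) q Hq)).
    * unfold num_branch. rewrite num_right_1 by exact Hq. ring.
Qed.

Theorem hurwitz_zeta_branch (theta : R) (N : nat) (s q : C) : principal_from theta N q ->
  s <> RtoC 1 -> hurwitz_zeta theta s q = (num_branch theta N s q / (s - 1))%C.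
Proof. intros H. apply (hurwitz_zeta_eq theta q _ (num_branch_hurwitz theta N q H)). Qed.

(** * The gamma function *)

(** The sequence whose limit defines [Gamma z]. *)
Definition gauss (z : C) (n : nat) : C :=
  (RtoC (INR (fact n)) * Cexp (z * RtoC (ln (INR n))) / rising z (S n))%C.

Lemma Gamma_eq (z l : C) : Clim eventually (gauss z) l -> Gamma z = l.
Proof.
intros H.
assert (HR : forall (p : C -> R), (forall w, Rabs (p w - p l) <= Cmod (w - l)) ->
  real (Lim_seq (fun n => p (gauss z n))) = p l).
{ intros p Hp. rewrite (is_lim_seq_unique _ (p l)); [reflexivity|].
  apply is_lim_seq_spec. intros eps.
  generalize (proj1 (Clim_iff (F := eventually) _ _) H eps (cond_pos eps)).
  apply filter_imp. intros n Hn. eapply Rle_lt_trans; [apply Hp | exact Hn]. }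
unfold Gamma. fold (gauss z). rewrite (surjective_pairing l).
change (fst l) with (Re l). change (snd l) with (Im l). f_equal; apply HR; intros w.
- apply Re_Lipschitz.
- apply Im_Lipschitz.
Qed.

(** The increments of [n |-> log (gauss z (n + 1))], in the right half-plane. *)
Definition dlog (n : nat) (z : C) : C :=
  (RtoC (ln (INR (n + 2))) + z * RtoC (ln (INR (n + 2)) - ln (INR (n + 1)))
   - Clog PI (RtoC (INR (n + 2)) + z))%C.

Definition dlog' (n : nat) (z : C) : C :=
  (RtoC (ln (INR (n + 2)) - ln (INR (n + 1))) - / (RtoC (INR (n + 2)) + z))%C.

Definition log0 (z : C) : C := (- Clog PI z - Clog PI (RtoC 1 + z))%C.

Lemma Cder_Clog_shift (a z : C) : 0 < Re (a + z) ->
  Cder (fun v => Clog PI (a + v)) z (/ (a + z))%C.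
Proof.
intros H. apply (Cder_translate_l (Clog PI)), Cder_Clog; [exact PI_ok | now apply off_ray_PI].
Qed.

Lemma Cder_inv_shift (a z : C) : (a + z)%C <> RtoC 0 ->
  Cder (fun v => (/ (a + v))%C) z (- / ((a + z) * (a + z)))%C.
Proof. intros H. now apply (Cder_translate_l Cinv), Cder_inv. Qed.

Lemma Cder_dlog (n : nat) (z : C) : 0 < Re z -> Cder (dlog n) z (dlog' n z).
Proof.
intros Hz. eapply Cder_eq.
- apply Cder_minus; [apply Cder_plus; [apply Cder_const|]|].
  + apply (Cder_mult (fun v => v) (fun _ => RtoC (ln (INR (n + 2)) - ln (INR (n + 1)))));
      [apply Cder_id | apply Cder_const].
  + apply Cder_Clog_shift. now apply shift_right.
- unfold dlog'. ring.
Qed.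

Lemma Cder_dlog' (n : nat) (z : C) : 0 < Re z ->
  Cder (dlog' n) z (/ ((RtoC (INR (n + 2)) + z) * (RtoC (INR (n + 2)) + z)))%C.
Proof.
intros Hz. eapply Cder_eq.
- apply Cder_minus; [apply Cder_const|].
  apply Cder_inv_shift, Re_pos_neq_0. now apply shift_right.
- ring.
Qed.

Definition sq_term (n : nat) : R := Rpower (INR n + 1) (- (1 + 1)).

Lemma sq_term_eq (n : nat) : sq_term n = / (INR (n + 1) * INR (n + 1)).
Proof.
unfold sq_term. rewrite plus_INR. change (INR 1) with 1.
assert (H := pos_INR n).
rewrite Rpower_Ropp. f_equal. rewrite Rpower_plus, Rpower_1 by lra. reflexivity.
Qed.

Lemma ex_series_sq (c : R) : ex_series (fun n => c * sq_term n).
Proof.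
refine (ex_series_scal (K := R_AbsRing) (V := R_NormedModule) c _ _).
apply ex_series_power; lra.
Qed.

Lemma INR_S_pos (n : nat) : 0 < INR (n + 1).
Proof. apply lt_0_INR. lia. Qed.

Lemma Cmod_shift_ge (n : nat) (z : C) : 0 < Re z -> INR (n + 1) <= Cmod (RtoC (INR (n + 2)) + z).
Proof.
intros Hz. eapply Rle_trans; [|apply Re_le_Cmod].
rewrite re_plus, re_RtoC, !plus_INR. simpl. lra.
Qed.

Lemma dlog'_bound (n : nat) (z : C) : 0 < Re z -> Cmod (dlog' n z) <= (2 + Cmod z) * sq_term n.
Proof.
intros Hz. rewrite sq_term_eq. assert (Hm := INR_S_pos n). set (m := INR (n + 1)) in *.
assert (E2 : INR (n + 2) = m + 1) by (unfold m; rewrite !plus_INR; simpl; ring).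
assert (Hw := Cmod_shift_ge n z Hz). fold m in Hw.
assert (Hw0 : (RtoC (INR (n + 2)) + z)%C <> RtoC 0).
{ apply Cmod_gt_0. lra. }
assert (Hl : Rabs (ln (m + 1) - ln m - / m) <= / (m * m)).
{ assert (A := ln_le_minus_1 ((m + 1) / m) ltac:(apply Rdiv_lt_0_compat; lra)).
  assert (B := ln_le_minus_1 (m / (m + 1)) ltac:(apply Rdiv_lt_0_compat; lra)).
  rewrite ln_div in A, B by lra.
  replace ((m + 1) / m - 1) with (/ m) in A by (field; lra).
  replace (m / (m + 1) - 1) with (- / (m + 1)) in B by (field; lra).
  assert (D : / m - / (m + 1) <= / (m * m)).
  { replace (/ m - / (m + 1)) with (/ (m * (m + 1))) by (field; lra).
    apply Rinv_le_contravar; nra. }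
  assert (P : 0 < / (m * m)) by (apply Rinv_0_lt_compat; nra).
  apply Rabs_le. lra. }
assert (Hm0 : RtoC m <> RtoC 0) by (intros E; apply RtoC_inj in E; lra).
replace (dlog' n z) with (RtoC (ln (m + 1) - ln m - / m)
  + (z + 1) * / (RtoC m * (RtoC (INR (n + 2)) + z)))%C.
2:{ unfold dlog'. fold m. rewrite !RtoC_minus, RtoC_inv by lra.
    rewrite E2 in *. rewrite RtoC_plus in *. field. auto. }
eapply Rle_trans; [apply Cmod_triangle|].
rewrite Cmod_R, Cmod_mult, Cmod_inv by now apply Cmult_neq_0.
rewrite Cmod_mult, Cmod_R, (Rabs_pos_eq m) by lra.
assert (H1 : Cmod (z + 1) <= Cmod z + 1).
{ eapply Rle_trans; [apply Cmod_triangle|]. rewrite Cmod_1. lra. }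
assert (H2 : / (m * Cmod (RtoC (INR (n + 2)) + z)) <= / (m * m)).
{ apply Rinv_le_contravar; nra. }
assert (H3 : Cmod (z + 1) * / (m * Cmod (RtoC (INR (n + 2)) + z)) <= (Cmod z + 1) * / (m * m)).
{ apply Rmult_le_compat; [apply Cmod_ge_0 | | exact H1 | exact H2].
  apply Rlt_le, Rinv_0_lt_compat. nra. }
lra.
Qed.

Lemma dlog''_bound (n : nat) (z : C) : 0 < Re z ->
  Cmod (/ ((RtoC (INR (n + 2)) + z) * (RtoC (INR (n + 2)) + z))) <= 1 * sq_term n.
Proof.
intros Hz. rewrite sq_term_eq. assert (Hm := INR_S_pos n).
assert (Hw := Cmod_shift_ge n z Hz).
assert (Hw0 : (RtoC (INR (n + 2)) + z)%C <> RtoC 0) by (apply Cmod_gt_0; lra).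
rewrite Cmod_inv by now apply Cmult_neq_0. rewrite Cmod_mult, Rmult_1_l.
apply Rinv_le_contravar; nra.
Qed.

Lemma dlog_1_bound (n : nat) : Cmod (dlog n (RtoC 1)) <= 1 * sq_term n.
Proof.
rewrite sq_term_eq. assert (Hm := INR_S_pos n). unfold dlog. set (m := INR (n + 1)) in *.
assert (E2 : INR (n + 2) = m + 1) by (unfold m; rewrite !plus_INR; simpl; ring).
rewrite E2, <- RtoC_plus, Clog_PI_R, <- RtoC_mult, <- RtoC_plus, <- RtoC_minus, Cmod_R by lra.
set (x := (m + 1) * (m + 1) / (m * (m + 1 + 1))).
assert (Hx : 0 < x) by (unfold x; apply Rdiv_lt_0_compat; nra).
assert (Ex : ln (m + 1) + 1 * (ln (m + 1) - ln m) - ln (m + 1 + 1) = ln x).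
{ unfold x. rewrite ln_div, !ln_mult by nra. ring. }
rewrite Ex. assert (A := ln_le_minus_1 x Hx).
assert (B := ln_le_minus_1 (/ x) ltac:(now apply Rinv_0_lt_compat)).
rewrite ln_Rinv in B by exact Hx.
assert (D1 : x - 1 = / (m * (m + 1 + 1))) by (unfold x; field; lra).
assert (D2 : / x - 1 = - / ((m + 1) * (m + 1))) by (unfold x; field; lra).
assert (D3 : / (m * (m + 1 + 1)) <= / (m * m)) by (apply Rinv_le_contravar; nra).
assert (D4 : 0 < / ((m + 1) * (m + 1))) by (apply Rinv_0_lt_compat; nra).
rewrite Rmult_1_l. rewrite Rabs_pos_eq by lra. lra.
Qed.

Lemma segment_right (z w : C) (t : R) : 0 <= t <= 1 -> 0 < Re z -> 0 < Re w ->
  0 < Re (segment z w t).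
Proof.
intros Ht Hz Hw. unfold segment, Cminus. rewrite re_plus, re_scal_l, re_plus, re_opp. nra.
Qed.

(** [dlog n] is [O(1 / n^2)] at the point [1], and so is its derivative in the
    half-plane: the mean value inequality carries the bound from [1] to [z]. *)
Lemma dlog_bound (n : nat) (z : C) : 0 < Re z ->
  Cmod (dlog n z) <= (1 + (3 + Cmod (z - 1)) * Cmod (z - 1)) * sq_term n.
Proof.
intros Hz. set (d := Cmod (z - 1)). assert (Hd : 0 <= d) by apply Cmod_ge_0.
assert (Hs : 0 < sq_term n) by apply exp_pos.
replace (dlog n z) with (dlog n (RtoC 1) + (dlog n z - dlog n (RtoC 1)))%C by ring.
eapply Rle_trans; [apply Cmod_triangle|].
assert (H1 := dlog_1_bound n).
assert (Hone : 0 < Re (RtoC 1)) by (rewrite re_RtoC; lra).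
assert (H2 : Cmod (dlog n z - dlog n (RtoC 1)) <= (3 + d) * sq_term n * d).
{ apply (Cder_Lipschitz (dlog n) (dlog' n)).
  - intros t Ht. apply Cder_dlog. now apply segment_right.
  - intros t Ht. eapply Rle_trans; [apply dlog'_bound; now apply segment_right|].
    apply Rmult_le_compat_r; [lra|].
    assert (A := segment_close (RtoC 1) z t Ht). fold d in A.
    replace (segment (RtoC 1) z t) with ((segment (RtoC 1) z t - 1) + 1)%C by ring.
    assert (B := Cmod_triangle (segment (RtoC 1) z t - 1) (RtoC 1)).
    rewrite Cmod_1 in B. lra. }
lra.
Qed.

(** [log Gamma], its derivative and its second derivative, for [Re z > 0]. *)
Definition lgam (z : C) : C := (log0 z + Cseries (fun n => dlog n z))%C.
Definition lgam' (z : C) : C :=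
  ((- / z - / (RtoC 1 + z)) + Cseries (fun n => dlog' n z))%C.
Definition lgam'' (z : C) : C :=
  (/ (z * z) + / ((RtoC 1 + z) * (RtoC 1 + z))
   + Cseries (fun n => / ((RtoC (INR (n + 2)) + z) * (RtoC (INR (n + 2)) + z))))%C.

Lemma dlog_series (z : C) : 0 < Re z -> Cser (fun n => dlog n z) (Cseries (fun n => dlog n z)).
Proof.
intros Hz. eapply Cseries_dominated; [intros n; now apply dlog_bound | apply ex_series_sq].
Qed.

Lemma dlog'_series (z : C) : 0 < Re z -> Cser (fun n => dlog' n z) (Cseries (fun n => dlog' n z)).
Proof.
intros Hz. eapply Cseries_dominated; [intros n; now apply dlog'_bound | apply ex_series_sq].
Qed.

Lemma dlog''_series (z : C) : 0 < Re z ->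
  Cser (fun n => / ((RtoC (INR (n + 2)) + z) * (RtoC (INR (n + 2)) + z)))%C
    (Cseries (fun n => / ((RtoC (INR (n + 2)) + z) * (RtoC (INR (n + 2)) + z))))%C.
Proof.
intros Hz. eapply Cseries_dominated; [intros n; now apply dlog''_bound | apply ex_series_sq].
Qed.

Lemma Re_1_plus (z : C) : Re (RtoC 1 + z) = 1 + Re z.
Proof. rewrite re_plus, re_RtoC. reflexivity. Qed.

Lemma Cder_lgam (z : C) : 0 < Re z -> Cder lgam z (lgam' z).
Proof.
intros Hz.
destruct (proj1 (nearC_iff _ _) (near_Re z 0 Hz)) as [r [Hr Hnear]].
apply Cder_plus.
- apply Cder_minus.
  + apply Cder_opp, Cder_Clog; [exact PI_ok | now apply off_ray_PI].
  + apply Cder_Clog_shift. rewrite Re_1_plus. lra.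
- apply (Cder_series dlog dlog' (fun n => (2 + (Cmod z + r)) * sq_term n) z r); auto.
  + apply ex_series_sq.
  + intros n w Hw. now apply Cder_dlog, Hnear.
  + intros n w Hw. eapply Rle_trans; [apply dlog'_bound; now apply Hnear|].
    apply Rmult_le_compat_r; [apply Rlt_le, exp_pos|].
    assert (A := Cmod_triangle (w - z) z). replace (w - z + z)%C with w in A by ring. lra.
  + intros w Hw. now apply dlog_series, Hnear.
  + now apply dlog'_series.
Qed.

Lemma Cder_lgam' (z : C) : 0 < Re z -> Cder lgam' z (lgam'' z).
Proof.
intros Hz. assert (Hz0 := Re_pos_neq_0 z Hz).
assert (Hz1 : (RtoC 1 + z)%C <> RtoC 0) by (apply Re_pos_neq_0; rewrite Re_1_plus; lra).
destruct (proj1 (nearC_iff _ _) (near_Re z 0 Hz)) as [r [Hr Hnear]].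
apply Cder_plus.
- eapply Cder_eq.
  + apply Cder_minus; [apply Cder_opp; now apply Cder_inv | now apply Cder_inv_shift].
  + ring.
- apply (Cder_series dlog'
    (fun n z => / ((RtoC (INR (n + 2)) + z) * (RtoC (INR (n + 2)) + z)))%C
    (fun n => 1 * sq_term n) z r); auto.
  + apply ex_series_sq.
  + intros n w Hw. now apply Cder_dlog', Hnear.
  + intros n w Hw. now apply dlog''_bound, Hnear.
  + intros w Hw. now apply dlog'_series, Hnear.
  + now apply dlog''_series.
Qed.

Lemma lgam''_series (z : C) : 0 < Re z ->
  Cser (fun n => / ((RtoC (INR n) + z) * (RtoC (INR n) + z)))%C (lgam'' z).
Proof.
intros Hz.
replace (lgam'' z) with
  (Csum_lt (fun n => / ((RtoC (INR n) + z) * (RtoC (INR n) + z)))%C 2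
   + Cseries (fun n => / ((RtoC (INR (n + 2)) + z) * (RtoC (INR (n + 2)) + z))))%C.
- apply (Cser_shift (fun n => / ((RtoC (INR n) + z) * (RtoC (INR n) + z)))%C).
  eapply Cser_ext; [|now apply dlog''_series]. intros n. now rewrite Nat.add_comm.
- unfold lgam''. simpl Csum_lt. change (INR 1) with 1. change (INR 0) with 0.
  replace (RtoC 0 + z)%C with z by ring. ring.
Qed.

Lemma rising_S (z : C) (n : nat) : rising z (S n) = (rising z n * (z + RtoC (INR n)))%C.
Proof. reflexivity. Qed.

Lemma rising_neq_0 (z : C) (n : nat) :
  (forall k, (k < n)%nat -> (z + RtoC (INR k))%C <> RtoC 0) -> rising z n <> RtoC 0.
Proof.
intros H. induction n as [|n IH].
- exact C1_nz.
- rewrite rising_S. apply Cmult_neq_0; [apply IH; intros k Hk; apply H; lia | apply H; lia].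
Qed.

Lemma nonpos_shift (z : C) (k : nat) : ~ nonpos_int z -> (z + RtoC (INR k))%C <> RtoC 0.
Proof.
intros H E. apply H. exists k. rewrite RtoC_opp.
replace z with (z + RtoC (INR k) - RtoC (INR k))%C by ring. rewrite E. ring.
Qed.

Lemma nonpos_right (z : C) : 0 < Re z -> ~ nonpos_int z.
Proof.
intros H [n ->]. rewrite re_RtoC in H. assert (A := pos_INR n). lra.
Qed.

Lemma gauss_log (z : C) (n : nat) : 0 < Re z ->
  Cexp (log0 z + Csum_lt (fun n => dlog n z) n) = gauss z (S n).
Proof.
intros Hz. assert (Hnz := nonpos_right z Hz).
assert (HC : forall k, (z + RtoC (INR k))%C <> RtoC 0) by (intros k; now apply nonpos_shift).
assert (HL : forall k, Cexp (- Clog PI (RtoC (INR k) + z)) = (/ (z + RtoC (INR k)))%C).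
{ intros k. rewrite Cexp_opp, Cexp_Clog, Cplus_comm; [reflexivity | exact PI_ok |].
  rewrite Cplus_comm. apply HC. }
induction n as [|n IH].
- simpl Csum_lt. unfold gauss. rewrite !rising_S.
  assert (H0 := HL 0%nat). assert (H1 := HL 1%nat).
  assert (C0 := HC 0%nat). assert (C1 := HC 1%nat).
  change (INR 1) with 1 in *. change (INR 0) with 0 in *.
  replace (RtoC 0 + z)%C with z in H0 by ring.
  change (fact 1) with 1%nat. change (INR 1) with 1. rewrite ln_1.
  unfold log0, Cminus. rewrite Cplus_0_r, Cexp_plus, H0, H1, Cmult_0_r, Cexp_0.
  change (rising z 0) with (RtoC 1). rewrite Cplus_0_r in C0. field. split; assumption.
- change (Csum_lt (fun n => dlog n z) (S n))
    with (Csum_lt (fun n => dlog n z) n + dlog n z)%C.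
  rewrite Cplus_assoc, Cexp_plus, IH. unfold gauss, dlog, Cminus.
  replace (n + 2)%nat with (S (S n)) by lia. replace (n + 1)%nat with (S n) by lia.
  rewrite !Cexp_plus, HL, Cexp_R, exp_ln by (apply lt_0_INR; lia).
  rewrite (rising_S z (S (S n))).
  assert (Hr : rising z (S (S n)) <> RtoC 0) by (apply rising_neq_0; intros k _; apply HC).
  assert (Hk := HC (S (S n))).
  replace (z * RtoC (ln (INR (S (S n)))))%C
    with (z * RtoC (ln (INR (S n))) + z * RtoC (ln (INR (S (S n))) - ln (INR (S n))))%C
    by (rewrite RtoC_minus; ring).
  rewrite Cexp_plus. change (fact (S (S n))) with ((S (S n)) * fact (S n))%nat.
  rewrite mult_INR, RtoC_mult. field. auto.
Qed.

Lemma Clim_eventually_S (u : nat -> C) (l : C) :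
  Clim eventually (fun n => u (S n)) l -> Clim eventually u l.
Proof.
intros H P HP. destruct (H P HP) as [N HN]. exists (S N). intros n Hn.
destruct n as [|n]; [lia|]. apply HN. lia.
Qed.

Lemma gauss_right (z : C) : 0 < Re z -> Clim eventually (gauss z) (Cexp (lgam z)).
Proof.
intros Hz. apply Clim_eventually_S, Clim_eventually_S.
apply (Clim_ext (fun n => Cexp (log0 z + Csum_n (fun n => dlog n z) n))).
- apply filter_forall. intros n. rewrite Csum_lt_S. now apply gauss_log.
- apply Clim_Cexp, Clim_plus; [apply Clim_const | exact (dlog_series z Hz)].
Qed.

Lemma Clim_inv_nat : Clim eventually (fun n => RtoC (/ INR (S n))) (RtoC 0).
Proof.
apply Clim_iff. intros eps He. destruct (INR_unbounded (/ eps)) as [N HN].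
exists N. intros n Hn. apply le_INR in Hn.
assert (H0 : 0 < / eps) by now apply Rinv_0_lt_compat.
replace (RtoC (/ INR (S n)) - 0)%C with (RtoC (/ INR (S n))) by ring.
rewrite S_INR, Cmod_R, Rabs_pos_eq by (apply Rlt_le, Rinv_0_lt_compat; lra).
rewrite <- (Rinv_inv eps). apply Rinv_lt_contravar; nra.
Qed.

Lemma rising_shift (z : C) (n : nat) : (z * rising (z + 1) n)%C = rising z (S n).
Proof.
induction n as [|n IH].
- simpl. ring.
- rewrite rising_S, Cmult_assoc, IH, (rising_S z (S n)), S_INR, RtoC_plus. ring.
Qed.

(** [Gamma(z) = Gamma(z + 1) / z], read on the defining sequences: it
    propagates convergence from the right half-plane to the left. *)
Lemma gauss_shift (z l : C) : ~ nonpos_int z ->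
  Clim eventually (gauss (z + 1)) l -> Clim eventually (gauss z) (l / z)%C.
Proof.
intros Hz H. apply Clim_eventually_S.
assert (HC : forall k, (z + RtoC (INR k))%C <> RtoC 0) by (intros k; now apply nonpos_shift).
assert (Hz0 : z <> RtoC 0).
{ assert (A := HC 0%nat). simpl in A. replace (z + 0)%C with z in A by ring. exact A. }
apply (Clim_ext (fun n => gauss (z + 1) (S n)
  * (/ z * ((z + 1) * RtoC (/ INR (S n)) + 1)))%C).
- apply filter_forall. intros n. unfold gauss.
  assert (Hn : 0 < INR (S n)) by (apply lt_0_INR; lia).
  assert (Hn0 : RtoC (INR (S n)) <> RtoC 0) by (intros E; apply RtoC_inj in E; lra).
  assert (Hr : rising z (S (S n)) <> RtoC 0) by (apply rising_neq_0; intros k _; apply HC).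
  assert (E : rising (z + 1) (S (S n))
    = (/ z * (rising z (S (S n)) * (z + RtoC (INR (S (S n))))))%C).
  { rewrite <- rising_S, <- (rising_shift z). field. exact Hz0. }
  rewrite E. rewrite RtoC_inv by lra.
  replace ((z + 1) * RtoC (ln (INR (S n))))%C
    with (z * RtoC (ln (INR (S n))) + RtoC (ln (INR (S n))))%C by ring.
  rewrite Cexp_plus, Cexp_R, exp_ln by exact Hn.
  assert (HSS := HC (S (S n))). rewrite (S_INR (S n)), RtoC_plus in HSS |- *.
  field. auto.
- replace (l / z)%C with (l * (/ z * ((z + 1) * 0 + 1)))%C by (field; exact Hz0).
  apply Clim_mult.
  + intros P HP. destruct (H P HP) as [N HN]. exists N. intros n Hn. apply HN. lia.
  + apply Clim_mult; [apply Clim_const|]. apply Clim_plus; [|apply Clim_const].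
    apply Clim_mult; [apply Clim_const | apply Clim_inv_nat].
Qed.

Lemma lgam_shift (z : C) : 0 < Re z ->
  Cexp (- lgam z) = (z * Cexp (- lgam (z + 1)))%C.
Proof.
intros Hz. assert (Hz0 := Re_pos_neq_0 z Hz).
assert (E : Cexp (lgam z) = (Cexp (lgam (z + 1)) / z)%C).
{ apply (Clim_unique (F := eventually) (gauss z)); [now apply gauss_right|].
  apply gauss_shift; [now apply nonpos_right|]. apply gauss_right. rewrite Re_plus_R. lra. }
rewrite !Cexp_opp, E. assert (A := Cexp_neq_0 (lgam (z + 1))). field. auto.
Qed.

Fixpoint rising' (z : C) (n : nat) : C :=
  match n with
  | O => RtoC 0
  | S k => (rising' z k * (z + RtoC (INR k)) + rising z k)%C
  end.

Lemma Cder_rising (n : nat) (z : C) : Cder (fun v => rising v n) z (rising' z n).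
Proof.
induction n as [|n IH]; [exact (Cder_const (RtoC 1) z)|].
eapply Cder_eq.
- apply (Cder_mult (fun v => rising v n) (fun v => (v + RtoC (INR n))%C)); [exact IH|].
  apply Cder_plus; [apply Cder_id | apply Cder_const].
- simpl. ring.
Qed.

Lemma ccont_rising (n : nat) : ccont (fun v => rising v n).
Proof. intros z. exact (Cder_continuous _ _ _ (Cder_rising n z)). Qed.

Lemma ccont_rising' (n : nat) : ccont (fun v => rising' v n).
Proof.
induction n as [|n IH]; intros z; [exact (Clim_const (RtoC 0))|].
apply (Clim_plus (fun v => (rising' v n * (v + RtoC (INR n)))%C)); [|apply ccont_rising].
apply Clim_mult; [apply IH | apply Clim_plus; [apply filterlim_id | apply Clim_const]].
Qed.

(** The value of [1 / Gamma z] obtained from [Gamma (z + k)], for [Re z > - k]. *)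
Definition rgam_from (k : nat) (z : C) : C :=
  (rising z k * Cexp (- lgam (z + RtoC (INR k))))%C.

Definition rgam_from' (k : nat) (z : C) : C :=
  (rising' z k * Cexp (- lgam (z + RtoC (INR k)))
   + rising z k * (- lgam' (z + RtoC (INR k)) * Cexp (- lgam (z + RtoC (INR k)))))%C.

Lemma Cder_rgam_from (k : nat) (z : C) : 0 < Re (z + RtoC (INR k)) ->
  Cder (rgam_from k) z (rgam_from' k z).
Proof.
intros Hz.
apply (Cder_mult (fun v => rising v k) (fun v => Cexp (- lgam (v + RtoC (INR k)))));
  [apply Cder_rising|].
apply (Cder_Cexp_comp (fun v => (- lgam (v + RtoC (INR k)))%C)), Cder_opp.
now apply (Cder_translate lgam), Cder_lgam.
Qed.

Lemma Clim_rgam_from' (k : nat) (z : C) : 0 < Re (z + RtoC (INR k)) ->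
  Clim (nearC z) (rgam_from' k) (rgam_from' k z).
Proof.
intros Hz.
assert (H1 := Cder_continuous _ _ _ (Cder_translate lgam _ z _ (Cder_lgam _ Hz))).
assert (H2 := Cder_continuous _ _ _ (Cder_translate lgam' _ z _ (Cder_lgam' _ Hz))).
assert (H3 := Clim_Cexp _ _ (Clim_opp _ _ H1)).
apply Clim_plus; apply Clim_mult.
- apply ccont_rising'.
- exact H3.
- apply ccont_rising.
- apply Clim_mult; [exact (Clim_opp _ _ H2) | exact H3].
Qed.

Lemma rgam_from_S (k : nat) (z : C) : 0 < Re (z + RtoC (INR k)) ->
  rgam_from (S k) z = rgam_from k z.
Proof.
intros Hz. unfold rgam_from. rewrite rising_S, S_INR, RtoC_plus, Cplus_assoc.
rewrite (lgam_shift _ Hz). ring.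
Qed.

Lemma rgam_from_agree (j k : nat) (z : C) : 0 < Re (z + RtoC (INR j)) ->
  0 < Re (z + RtoC (INR k)) -> rgam_from j z = rgam_from k z.
Proof.
assert (L : forall j k, (j <= k)%nat -> 0 < Re (z + RtoC (INR j)) -> rgam_from k z = rgam_from j z).
{ intros i l Hil Hi. induction Hil as [|l Hil IH]; [reflexivity|].
  rewrite rgam_from_S; [exact IH|]. apply le_INR in Hil. rewrite Re_plus_R in *. lra. }
intros Hj Hk. destruct (Nat.le_ge_cases j k) as [H|H]; [symmetry|]; now apply L.
Qed.

Definition depth (z : C) : nat := level (z + 1).

Lemma depth_spec (z : C) : 0 < Re (z + RtoC (INR (depth z))).
Proof.
assert (H := level_spec (z + 1)). rewrite Re_plus_R in *. unfold depth. lra.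
Qed.

Definition rgam (z : C) : C := rgam_from (depth z) z.
Definition rgam' (z : C) : C := rgam_from' (depth z) z.

Lemma rgam_eq (k : nat) (z : C) : 0 < Re (z + RtoC (INR k)) -> rgam z = rgam_from k z.
Proof. intros Hz. apply rgam_from_agree; [apply depth_spec | exact Hz]. Qed.

Lemma near_shift (k : nat) (z : C) : 0 < Re (z + RtoC (INR k)) ->
  nearC z (fun w => 0 < Re (w + RtoC (INR k))).
Proof.
intros Hz. rewrite Re_plus_R in Hz.
generalize (near_Re z (- INR k) ltac:(lra)). apply filter_imp. intros w Hw.
rewrite Re_plus_R. lra.
Qed.

Lemma Cder_rgam_any (k : nat) (z : C) : 0 < Re (z + RtoC (INR k)) ->
  Cder rgam z (rgam_from' k z).
Proof.
intros Hz. apply (Cder_ext (rgam_from k)); [|now apply Cder_rgam_from].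
generalize (near_shift k z Hz). apply filter_imp. intros w Hw. symmetry. now apply rgam_eq.
Qed.

Lemma Cder_rgam (z : C) : Cder rgam z (rgam' z).
Proof. apply Cder_rgam_any, depth_spec. Qed.

Lemma ccont_rgam' : ccont rgam'.
Proof.
intros z. assert (Hz := depth_spec z).
apply (Clim_ext (rgam_from' (depth z))); [|exact (Clim_rgam_from' (depth z) z Hz)].
generalize (near_shift _ z Hz). apply filter_imp. intros w Hw.
apply (Cder_unique rgam w); [now apply Cder_rgam_any | apply Cder_rgam].
Qed.

Lemma gauss_rgam_from (k : nat) (z : C) : ~ nonpos_int z -> 0 < Re (z + RtoC (INR k)) ->
  Clim eventually (gauss z) (/ rgam_from k z)%C /\ rgam_from k z <> RtoC 0.
Proof.
intros Hn Hz.
assert (HC : forall k, (z + RtoC (INR k))%C <> RtoC 0) by (intros j; now apply nonpos_shift).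
split.
2:{ apply Cmult_neq_0; [apply rising_neq_0; intros j _; apply HC | apply Cexp_neq_0]. }
clear HC. revert z Hn Hz. induction k as [|k IH]; intros z Hn Hz.
- change (INR 0) with 0 in Hz. rewrite Cplus_0_r in Hz.
  replace (/ rgam_from 0 z)%C with (Cexp (lgam z)); [exact (gauss_right z Hz)|].
  unfold rgam_from. change (INR 0) with 0. change (rising z 0) with (RtoC 1).
  rewrite Cplus_0_r, Cmult_1_l, <- Cexp_opp. f_equal. ring.
- assert (Hz0 : z <> RtoC 0).
  { assert (A := nonpos_shift z 0 Hn). simpl in A. now rewrite Cplus_0_r in A. }
  assert (Hn1 : ~ nonpos_int (z + 1)).
  { intros [j Hj]. apply (nonpos_shift z (S j) Hn).
    rewrite S_INR, RtoC_plus.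
    replace (z + (RtoC (INR j) + 1))%C with (z + 1 + RtoC (INR j))%C by ring.
    rewrite Hj, RtoC_opp. ring. }
  assert (Hz1 : 0 < Re (z + 1 + RtoC (INR k))).
  { rewrite S_INR in Hz. rewrite !Re_plus_R in *. lra. }
  replace (/ rgam_from (S k) z)%C with (/ rgam_from k (z + 1) / z)%C.
  + apply gauss_shift; [exact Hn|]. now apply IH.
  + unfold rgam_from. rewrite <- rising_shift, S_INR, RtoC_plus.
    replace (z + (RtoC (INR k) + 1))%C with (z + 1 + RtoC (INR k))%C by ring.
    assert (A := Cexp_neq_0 (- lgam (z + 1 + RtoC (INR k)))).
    assert (B : rising (z + 1) k <> RtoC 0).
    { apply rising_neq_0. intros j _. now apply nonpos_shift. }
    field. auto.
Qed.

Lemma rgam_neq_0 (z : C) : ~ nonpos_int z -> rgam z <> RtoC 0.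
Proof. intros H. exact (proj2 (gauss_rgam_from _ z H (depth_spec z))). Qed.

Lemma Gamma_rgam (z : C) : ~ nonpos_int z -> Gamma z = (/ rgam z)%C.
Proof. intros H. apply Gamma_eq. exact (proj1 (gauss_rgam_from _ z H (depth_spec z))). Qed.

Lemma rgam_shift (z : C) : rgam z = (z * rgam (z + 1))%C.
Proof.
assert (Hz := depth_spec (z + 1)). set (k := depth (z + 1)) in *.
rewrite (rgam_eq k (z + 1) Hz), (rgam_eq (S k) z).
- unfold rgam_from. rewrite <- rising_shift, S_INR, RtoC_plus.
  replace (z + (RtoC (INR k) + 1))%C with (z + 1 + RtoC (INR k))%C by ring.
  ring.
- rewrite S_INR. rewrite !Re_plus_R in *. lra.
Qed.

Lemma rgam'_shift (z : C) : rgam' z = (rgam (z + 1) + z * rgam' (z + 1))%C.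
Proof.
apply (Cder_unique rgam z); [apply Cder_rgam|].
apply (Cder_ext (fun v => (v * rgam (v + 1))%C)).
{ apply filter_forall. intros v. symmetry. apply rgam_shift. }
eapply Cder_eq.
- apply (Cder_mult (fun v => v)); [apply Cder_id|].
  apply (Cder_translate rgam), Cder_rgam.
- Cring.
Qed.

Lemma rising_1 (n : nat) : rising (RtoC 1) n = RtoC (INR (fact n)).
Proof.
induction n as [|n IH]; [reflexivity|].
rewrite rising_S, IH. change (fact (S n)) with (S n * fact n)%nat.
rewrite mult_INR, RtoC_mult, S_INR, RtoC_plus. ring.
Qed.

Lemma rgam_1 : rgam (RtoC 1) = 1.
Proof.
assert (Hone : ~ nonpos_int (RtoC 1)) by (apply nonpos_right; rewrite re_RtoC; lra).
assert (H := proj1 (gauss_rgam_from _ _ Hone (depth_spec (RtoC 1)))).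
assert (H0 := rgam_neq_0 _ Hone). fold (rgam (RtoC 1)) in H.
assert (E : (/ rgam (RtoC 1))%C = 1).
{ apply (Clim_unique (F := eventually) (gauss (RtoC 1))); [exact H|].
  apply Clim_eventually_S.
  apply (Clim_ext (fun n => (RtoC 1 - RtoC (/ INR (S (S n))))%C)).
  - apply filter_forall. intros n. unfold gauss. rewrite rising_1, Cmult_1_l, Cexp_R.
    assert (Hn : 0 < INR (S n)) by (apply lt_0_INR; lia).
    rewrite exp_ln by exact Hn.
    change (fact (S (S n))) with (S (S n) * fact (S n))%nat.
    rewrite mult_INR, (S_INR (S n)).
    assert (Hf : INR (fact (S n)) <> 0) by apply INR_fact_neq_0.
    rewrite <- RtoC_mult, <- RtoC_div by (apply Rmult_integral_contrapositive_currified; lra).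
    rewrite <- RtoC_minus. f_equal. field. split; [exact Hf | lra].
  - assert (A : Clim eventually (fun n => (RtoC 1 - RtoC (/ INR (S (S n))))%C) (RtoC 1 - 0)%C).
    { apply Clim_minus; [apply Clim_const|].
      intros P HP. destruct (Clim_inv_nat P HP) as [N HN]. exists N. intros n Hn.
      apply HN. lia. }
    replace (RtoC 1 - 0)%C with (RtoC 1) in A by ring. exact A. }
replace (rgam (RtoC 1)) with (/ / rgam (RtoC 1))%C by (field; exact H0).
rewrite E. field.
Qed.

(** From [1 / Gamma(z) = z / Gamma(z + 1)] and its derivative, by induction from
    [Gamma(1) = 1]. *)
Lemma rgam_nonpos (j : nat) :
  rgam (RtoC (- INR j)) = 0 /\
  rgam' (RtoC (- INR j)) = RtoC ((-1) ^ j * INR (fact j)).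
Proof.
induction j as [|j [IH1 IH2]].
- simpl. rewrite Ropp_0. split.
  + rewrite rgam_shift. ring.
  + rewrite rgam'_shift. replace (RtoC 0 + 1)%C with (RtoC 1) by ring.
    rewrite rgam_1, Rmult_1_l. ring.
- assert (E : (RtoC (- INR (S j)) + 1)%C = RtoC (- INR j)).
  { rewrite S_INR, <- RtoC_plus. f_equal. ring. }
  split.
  + rewrite rgam_shift, E, IH1. ring.
  + rewrite rgam'_shift, E, IH1, IH2, <- RtoC_mult, Cplus_0_l. f_equal.
    change (fact (S j)) with (S j * fact j)%nat. rewrite mult_INR. simpl pow. ring.
Qed.

(** * The digamma function *)

(** The nonpositive integers are zeros of the continuous function [rgam]. *)
Lemma near_not_nonpos (q : C) : ~ nonpos_int q -> nearC q (fun w => ~ nonpos_int w).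
Proof.
intros Hq. assert (H0 := rgam_neq_0 q Hq).
assert (Hc := Cder_continuous _ _ _ (Cder_rgam q)).
apply Cmod_gt_0 in H0 as Hp.
generalize (proj1 (Clim_iff _ _) Hc _ Hp). apply filter_imp. intros w Hw [n ->].
rewrite (proj1 (rgam_nonpos n)) in Hw.
replace (RtoC 0 - rgam q)%C with (- rgam q)%C in Hw by ring. rewrite Cmod_opp in Hw. lra.
Qed.

(** The logarithmic derivative of [Gamma(q + k) / (q (q + 1) ... (q + k - 1))]. *)
Definition digam (k : nat) (q : C) : C :=
  (lgam' (q + RtoC (INR k)) - Csum_lt (fun j => / (RtoC (INR j) + q)) k)%C.

Lemma Cexp_sum_Clog (theta : R) (q : C) (k : nat) : theta_ok theta -> ~ nonpos_int q ->
  Cexp (Csum_lt (fun j => Clog theta (RtoC (INR j) + q)) k) = rising q k.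
Proof.
intros Ht Hq. induction k as [|k IH]; [apply Cexp_0|].
simpl. rewrite Cexp_plus, IH, Cexp_Clog.
- rewrite Cplus_comm. ring.
- exact Ht.
- rewrite Cplus_comm. now apply nonpos_shift.
Qed.

(** A branch of [log Gamma] near [q] is obtained from [lgam (q + k)] by subtracting
    the logarithms of the [q + j], for a cut that avoids all of them.  The
    derivative of any other branch is the same, because [Gamma q] is not [0]. *)
Lemma digamma_eq (k : nat) (q : C) : ~ nonpos_int q -> 0 < Re (q + RtoC (INR k)) ->
  digamma q = digam k q.
Proof.
intros Hq Hk.
destruct (off_cuts_exists q Hq) as [theta [Ht Ho]].
set (L := fun w => (lgam (w + RtoC (INR k))
  - Csum_lt (fun j => Clog theta (RtoC (INR j) + w)) k)%C).
assert (HL : nearC q (fun w => Cexp (L w) = Gamma w)).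
{ generalize (filter_and _ _ (near_not_nonpos q Hq) (near_shift k q Hk)).
  apply filter_imp. intros w [Hw1 Hw2]. unfold L, Cminus.
  rewrite Cexp_plus, Cexp_opp, Cexp_sum_Clog by assumption.
  rewrite Gamma_rgam, (rgam_eq k) by assumption. unfold rgam_from. rewrite Cexp_opp.
  assert (A := Cexp_neq_0 (lgam (w + RtoC (INR k)))).
  assert (B : rising w k <> RtoC 0).
  { apply rising_neq_0. intros j _. now apply nonpos_shift. }
  field. auto. }
assert (HdL : Cder L q (digam k q)).
{ apply Cder_minus; [now apply (Cder_translate lgam), Cder_lgam|].
  apply (Cder_sum_lt (fun j w => Clog theta (RtoC (INR j) + w))
    (fun j w => (/ (RtoC (INR j) + w))%C)).
  intros j _.
  apply (Cder_translate_l (Clog theta)), Cder_Clog; [exact Ht | exact (Ho j)]. }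
destruct (epsilon_spec (inhabits (RtoC 0)) (fun l : C => exists L : C -> C,
    locally q (fun w : C => Cexp (L w) = Gamma w) /\
    is_derive (K := C_AbsRing) (V := C_NormedModule) L q l)) as [M [HM HdM]].
{ exists (digam k q), L. split; [exact HL | exact HdL]. }
fold (digamma q) in HdM.
assert (EM : Cexp (M q) = Cexp (L q)).
{ rewrite (nearC_point _ _ HL). exact (nearC_point _ _ HM). }
assert (E : (digamma q * Cexp (M q))%C = (digam k q * Cexp (L q))%C).
{ apply (Cder_unique Gamma q).
  - apply (Cder_ext (fun w => Cexp (M w))); [exact HM | now apply Cder_Cexp_comp].
  - apply (Cder_ext (fun w => Cexp (L w))); [exact HL | now apply Cder_Cexp_comp]. }
rewrite EM in E. assert (A := Cexp_neq_0 (L q)).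
replace (digamma q) with (digamma q * Cexp (L q) / Cexp (L q))%C by (field; exact A).
rewrite E. field. exact A.
Qed.

Lemma trigamma_series (q : C) : ~ nonpos_int q ->
  Cser (fun n => / ((RtoC (INR n) + q) * (RtoC (INR n) + q)))%C (polygamma 1 q).
Proof.
intros Hq. assert (Hk := depth_spec q). set (k := depth q) in *.
set (S2 := Csum_lt (fun n => / ((RtoC (INR n) + q) * (RtoC (INR n) + q)))%C k).
assert (E : polygamma 1 q = (S2 + lgam'' (q + RtoC (INR k)))%C).
{ apply is_C_derive_unique. apply (Cder_ext (digam k)).
  - generalize (filter_and _ _ (near_not_nonpos q Hq) (near_shift k q Hk)).
    apply filter_imp. intros w [Hw1 Hw2]. symmetry. now apply digamma_eq.
  - eapply Cder_eq.
    + apply Cder_minus; [now apply (Cder_translate lgam'), Cder_lgam'|].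
      apply (Cder_sum_lt (fun j w => / (RtoC (INR j) + w))%C
        (fun j w => (- 1 * / ((RtoC (INR j) + w) * (RtoC (INR j) + w)))%C)).
      intros j _. eapply Cder_eq.
      * apply Cder_inv_shift. rewrite Cplus_comm. now apply nonpos_shift.
      * ring.
    + rewrite Csum_lt_scal. fold S2. ring. }
rewrite E. apply (Cser_shift (fun n => / ((RtoC (INR n) + q) * (RtoC (INR n) + q)))%C).
eapply Cser_ext; [|exact (lgam''_series _ Hk)]. intros n. cbv beta.
rewrite plus_INR, RtoC_plus.
replace (RtoC (INR k) + RtoC (INR n) + q)%C with (RtoC (INR n) + (q + RtoC (INR k)))%C by ring.
reflexivity.
Qed.

(** * The generalized polygamma function *)

(** [1 / Gamma(- w) = - w / Gamma(1 - w)], and the factor [w] cancels the pole of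
    [zeta(w + 1, q)].  Hence [e^(gamma w) zeta(w + 1, q) / Gamma(- w)] extends
    to the entire function [- e^(gamma w) (w zeta(w + 1, q)) / Gamma(1 - w)], and
    [Psi] is [e^(- gamma z)] times the derivative of this extension at [z]. *)
Definition Psi (theta : R) (N : nat) (z q : C) : C :=
  (num_branch theta N (z + 1) q * rgam' (- z + 1)
   - (RtoC Euler_gamma * num_branch theta N (z + 1) q + num_branch' theta N (z + 1) q)
     * rgam (- z + 1))%C.

Definition is_nat (z : C) : Prop := exists m : nat, z = RtoC (INR m).

Lemma not_nat_opp (z : C) : ~ is_nat z -> ~ nonpos_int (- z).
Proof.
intros H [n Hn]. apply H. exists n.
replace z with (- - z)%C by ring. rewrite Hn, RtoC_opp. ring.
Qed.

Lemma near_not_nat (z : C) : ~ is_nat z -> nearC z (fun w => ~ is_nat w).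
Proof.
intros H.
assert (Ho : Clim (nearC z) (fun w => (- w)%C) (- z)%C) by apply Clim_opp, filterlim_id.
assert (A := Ho _ (near_not_nonpos _ (not_nat_opp z H))). unfold filtermap in A.
revert A. apply filter_imp. intros w Hw [n ->]. apply Hw. exists n. now rewrite RtoC_opp.
Qed.

Lemma formula_Psi (theta : R) (N : nat) (z q : C) : principal_from theta N q -> ~ is_nat z ->
  gen_polygamma_formula theta z q = Psi theta N z q.
Proof.
intros HN Hz. unfold gen_polygamma_formula.
set (g := RtoC Euler_gamma).
set (H := fun w => (- (Cexp (g * w) * (num_branch theta N (w + 1) q * rgam (- w + 1))))%C).
assert (HH : Cder H z (Cexp (g * z) * Psi theta N z q)%C).
{ eapply Cder_eq.
  - apply Cder_opp, (Cder_mult (fun w => Cexp (g * w))).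
    + apply (Cder_Cexp_comp (fun w => (g * w)%C)), Cder_scal, Cder_id.
    + apply (Cder_mult (fun w => num_branch theta N (w + 1) q)).
      * apply (Cder_translate (fun s => num_branch theta N s q)), Cder_num_branch_s, HN.
      * apply (Cder_comp rgam (fun w => (- w + 1)%C)); [apply Cder_rgam|].
        apply Cder_plus; [apply Cder_opp, Cder_id | apply Cder_const].
  - unfold Psi. fold g. ring. }
assert (Hloc : forall w : C, ~ is_nat w ->
  H w = (Cexp (g * w) * (hurwitz_zeta theta (w + 1) q / Gamma (- w)))%C).
{ intros w Hw. unfold H.
  assert (Hw0 : w <> RtoC 0) by (intros ->; apply Hw; now exists 0%nat).
  assert (Hw1 : (w + 1)%C <> RtoC 1).
  { intros E. apply Hw0. replace w with (w + 1 - 1)%C by ring. rewrite E. ring. }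
  assert (Hn := not_nat_opp w Hw). assert (Hr := rgam_neq_0 _ Hn).
  rewrite (hurwitz_zeta_branch theta N _ q HN Hw1), Gamma_rgam by exact Hn.
  replace (w + 1 - 1)%C with w by ring.
  rewrite (rgam_shift (- w)) in Hr |- *.
  assert (Hr1 : rgam (- w + 1) <> RtoC 0).
  { intros E. apply Hr. rewrite E. ring. }
  field. auto. }
assert (E : C_derive (fun w : C => Cexp (g * w) * (hurwitz_zeta theta (w + 1) q / Gamma (- w)))%C z
  = (Cexp (g * z) * Psi theta N z q)%C).
{ apply is_C_derive_unique. apply (Cder_ext H); [|exact HH].
  generalize (near_not_nat z Hz). apply filter_imp. exact Hloc. }
rewrite E, Cmult_assoc, Cexp_opp_l. ring.
Qed.

Lemma Clim_num_branch' (theta : R) (N : nat) (s q : C) : 0 < Re (q + RtoC (INR N)) ->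
  Clim (nearC s) (fun v => num_branch' theta N v q) (num_branch' theta N s q).
Proof.
intros Hq.
assert (Hp : forall w, Clim (nearC s) (fun v => pw theta w v) (pw theta w s)).
{ intros w. exact (Cder_continuous _ _ _ (Cder_pw_exponent theta w s)). }
assert (HS : forall f : nat -> C -> C, (forall n, Clim (nearC s) (f n) (f n s)) ->
  forall M, Clim (nearC s) (fun v => Csum_lt (fun n => f n v) M) (Csum_lt (fun n => f n s) M)).
{ intros f Hf M. induction M as [|M IH]; [exact (Clim_const (RtoC 0))|].
  exact (Clim_plus _ _ _ _ IH (Hf M)). }
apply Clim_plus; [apply Clim_plus|].
- apply (HS (fun n v => pw theta (RtoC (INR n) + q) v)). intros n. apply Hp.
- apply Clim_mult.
  + apply Clim_minus; [apply filterlim_id | apply Clim_const].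
  + apply (HS (fun n v => (- Clog theta (RtoC (INR n) + q) * pw theta (RtoC (INR n) + q) v)%C)).
    intros n. apply Clim_mult; [apply Clim_const | apply Hp].
- refine (filterlim_comp_2 (G := nearC s) (H := nearC (q + RtoC (INR N))%C)
    (fun v => v) (fun _ => (q + RtoC (INR N))%C) num_right' (filterlim_id _ _) (Clim_const _) _).
  apply (hl_cont' _ _ _ (num_right_hurwitz_like (Re s - 1))); [lra | exact Hq].
Qed.

Lemma Clim_Psi (theta : R) (N : nat) (z q : C) : 0 < Re (q + RtoC (INR N)) ->
  Clim (nearC z) (fun w => Psi theta N w q) (Psi theta N z q).
Proof.
intros Hq.
assert (H1 : Clim (nearC z) (fun w => (w + 1)%C) (z + 1)%C).
{ apply Clim_plus; [apply filterlim_id | apply Clim_const]. }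
assert (H2 : Clim (nearC z) (fun w => (- w + 1)%C) (- z + 1)%C).
{ apply Clim_plus; [apply Clim_opp, filterlim_id | apply Clim_const]. }
assert (HZ := Clim_comp _ _ _ _ H1 (Cder_continuous _ _ _ (Cder_num_branch_s theta N (z + 1) q Hq))).
assert (HZ' := Clim_comp _ _ _ _ H1 (Clim_num_branch' theta N (z + 1) q Hq)).
assert (HR := Clim_comp _ _ _ _ H2 (Cder_continuous _ _ _ (Cder_rgam (- z + 1)))).
assert (HR' := Clim_comp _ _ _ _ H2 (ccont_rgam' (- z + 1)%C)).
apply Clim_minus.
- exact (Clim_mult _ _ _ _ HZ HR').
- exact (Clim_mult _ _ _ _
    (Clim_plus _ _ _ _ (Clim_mult _ _ _ _ (Clim_const (RtoC Euler_gamma)) HZ) HZ') HR).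
Qed.

Lemma punctured_not_nat (m : nat) :
  locally' (T := C_UniformSpace) (RtoC (INR m)) (fun w => ~ is_nat w).
Proof.
apply nearC_iff. exists 1. split; [lra|]. intros w Hw Hne [k ->].
apply Hne. f_equal. f_equal. rewrite <- RtoC_minus, Cmod_R in Hw.
apply Rabs_def2 in Hw.
assert (H1 : INR k < INR (m + 1)) by (rewrite plus_INR; simpl; lra).
assert (H2 : INR m < INR (k + 1)) by (rewrite plus_INR; simpl; lra).
apply INR_lt in H1. apply INR_lt in H2. lia.
Qed.

(** At the natural numbers both sides agree because [Psi] is continuous in [z]. *)
Lemma gen_polygamma_Psi (theta : R) (N : nat) (z q : C) : principal_from theta N q ->
  gen_polygamma theta z q = Psi theta N z q.
Proof.
intros HN. unfold gen_polygamma.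
destruct (excluded_middle_informative (exists m : nat, z = RtoC (INR m))) as [[m ->]|Hz].
- apply is_C_lim_unique.
  apply (Clim_ext (fun w => Psi theta N w q)).
  + generalize (punctured_not_nat m). apply filter_imp. intros w Hw.
    symmetry. now apply formula_Psi.
  + apply Clim_punctured, Clim_Psi, HN.
- now apply formula_Psi.
Qed.

(** Differentiating [Psi] in [q] replaces the numerator at [z + 1] by [- z] times
    the numerator at [z + 2]; [rgam_shift] and [rgam'_shift] at [- z] turn
    the factor [- z / Gamma(1 - z)] into [1 / Gamma(- z)]. *)
Lemma Cder_gen_polygamma (theta : R) (z q : C) : theta_ok theta -> off_cuts theta q ->
  Cder (fun s => gen_polygamma theta z s) q (gen_polygamma theta (z + 1)%C q).
Proof.
intros Ht Ho. destruct (principal_from_near theta q Ht) as [N HN].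
assert (HNq := nearC_point _ _ HN). assert (Hq := proj1 HNq).
apply (Cder_ext (fun s => Psi theta N z s)).
{ revert HN. apply filter_imp. intros w Hw. symmetry. now apply gen_polygamma_Psi. }
rewrite (gen_polygamma_Psi theta N) by exact HNq.
assert (HZ := Cder_num_branch_q theta N (z + 1) q Ht Hq Ho).
assert (HZ' := Cder_num_branch'_q theta N (z + 1) q Ht Hq Ho).
eapply Cder_eq.
- apply Cder_minus.
  + apply (Cder_mult (fun s => num_branch theta N (z + 1) s)
      (fun _ => rgam' (- z + 1))); [exact HZ | apply Cder_const].
  + apply (Cder_mult (fun s => (RtoC Euler_gamma * num_branch theta N (z + 1) s
      + num_branch' theta N (z + 1) s)%C) (fun _ => rgam (- z + 1))); [|apply Cder_const].
    apply Cder_plus; [apply Cder_scal; exact HZ | exact HZ'].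
- unfold Psi.
  replace (- (z + 1) + 1)%C with (- z)%C by ring.
  rewrite (rgam_shift (- z)), (rgam'_shift (- z)).
  replace (z + 1 - 1)%C with z by ring. ring.
Qed.

(** At [z = j + 1], [1 / Gamma(1 - z)] vanishes and only its derivative
    [(- 1)^j j!] contributes to [Psi]; at integer exponents the powers, hence the
    zeta value, do not depend on the branch. *)
Lemma gen_polygamma_nat (theta : R) (j : nat) (q s : C) : theta_ok theta -> ~ nonpos_int q ->
  Cser (fun n => / (RtoC (INR n) + q) ^ (S (S j)))%C s ->
  gen_polygamma theta (RtoC (INR (S j))) q = (RtoC ((-1) ^ j * INR (fact (S j))) * s)%C.
Proof.
intros Ht Hq Hs. destruct (principal_from_near theta q Ht) as [N HN].
apply nearC_point in HN.
rewrite (gen_polygamma_Psi theta N) by exact HN. unfold Psi.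
assert (E1 : (- RtoC (INR (S j)) + 1)%C = RtoC (- INR j)).
{ rewrite S_INR, <- RtoC_opp, <- RtoC_plus. f_equal. ring. }
assert (E2 : (RtoC (INR (S j)) + 1)%C = RtoC (INR (S (S j)))).
{ now rewrite (S_INR (S j)), RtoC_plus. }
rewrite E1, E2, (proj1 (rgam_nonpos j)), (proj2 (rgam_nonpos j)).
assert (Hre : 1 < Re (RtoC (INR (S (S j))))).
{ rewrite re_RtoC, !S_INR. assert (A := pos_INR j). lra. }
assert (Hz := proj1 (num_branch_hurwitz theta N q HN) _ Hre).
assert (E3 : s = (num_branch theta N (RtoC (INR (S (S j)))) q / (RtoC (INR (S (S j))) - 1))%C).
{ apply (Cser_unique (fun n => / Cpower theta (RtoC (INR n) + q) (RtoC (INR (S (S j)))))%C);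
    [|exact Hz].
  eapply Cser_ext; [|exact Hs]. intros n.
  rewrite pw_Cpower, pw_nat; [reflexivity | exact Ht |].
  rewrite Cplus_comm. now apply nonpos_shift. }
rewrite <- E2 in E3 at 2. replace (RtoC (INR (S j)) + 1 - 1)%C
  with (RtoC (INR (S j))) in E3 by ring.
rewrite E3. change (fact (S j)) with (S j * fact j)%nat. rewrite mult_INR, !RtoC_mult.
assert (Hj : RtoC (INR (S j)) <> RtoC 0).
{ intros E. apply RtoC_inj in E. assert (A := pos_INR j). rewrite S_INR in E. lra. }
field. exact Hj.
Qed.

Lemma inv_power_series (j : nat) (q : C) : ~ nonpos_int q ->
  exists s, Cser (fun n => / (RtoC (INR n) + q) ^ (S (S j)))%C s.
Proof.
intros Hq. destruct (principal_from_near PI q PI_ok) as [N HN].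
apply nearC_point in HN.
assert (Hre : 1 < Re (RtoC (INR (S (S j))))).
{ rewrite re_RtoC, !S_INR. assert (A := pos_INR j). lra. }
eexists. eapply Cser_ext; [|exact (proj1 (num_branch_hurwitz PI N q HN) _ Hre)].
intros n. cbv beta. rewrite pw_Cpower, pw_nat; [reflexivity | exact PI_ok |].
rewrite Cplus_comm. now apply nonpos_shift.
Qed.

(** Both functions have the same derivatives in [q]: to differentiate at [q] one is
    free to choose a branch whose cuts avoid [q].  The induction starts with
    the trigamma function. *)
Lemma polygamma_nat (j : nat) (q s : C) : ~ nonpos_int q ->
  Cser (fun n => / (RtoC (INR n) + q) ^ (S (S j)))%C s ->
  polygamma (S j) q = (RtoC ((-1) ^ j * INR (fact (S j))) * s)%C.
Proof.
revert q s. induction j as [|j IH]; intros q s Hq Hs.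
- replace s with (polygamma 1 q).
  2:{ apply (Cser_unique (fun n => / ((RtoC (INR n) + q) * (RtoC (INR n) + q)))%C);
        [now apply trigamma_series|].
      eapply Cser_ext; [|exact Hs]. intros n. cbv beta. f_equal. Cring. }
  simpl fact. simpl pow. rewrite Rmult_1_l. change (INR 1) with 1. ring.
- destruct (off_cuts_exists q Hq) as [theta [Ht Ho]].
  rewrite <- (gen_polygamma_nat theta (S j) q s Ht Hq Hs).
  change (polygamma (S (S j)) q) with (C_derive (polygamma (S j)) q).
  apply is_C_derive_unique.
  rewrite (S_INR (S j)), RtoC_plus.
  apply (Cder_ext (fun w => gen_polygamma theta (RtoC (INR (S j))) w)).
  + generalize (near_not_nonpos q Hq). apply filter_imp. intros w Hw.
    destruct (inv_power_series j w Hw) as [t Ht'].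
    rewrite (gen_polygamma_nat theta j w t Ht Hw Ht'). symmetry. now apply IH.
  + now apply Cder_gen_polygamma.
Qed.

Theorem theorem2p4 (theta : R) (htheta : 0 < theta < 2 * PI) :
  (forall z q : C, ~ nonpos_int q -> off_cuts theta q ->
     is_derive (K := C_AbsRing) (V := C_NormedModule)
       (fun s : C => gen_polygamma theta z s) q
       (gen_polygamma theta (z + 1)%C q)) /\
  (forall (m : nat) (q : C), (1 <= m)%nat -> ~ nonpos_int q ->
     gen_polygamma theta (RtoC (INR m)) q = polygamma m q).
Proof.
split.
- intros z q _ Ho. now apply Cder_gen_polygamma.
- intros m q Hm Hq. destruct m as [|j]; [lia|].
  destruct (inv_power_series j q Hq) as [s Hs].
  rewrite (gen_polygamma_nat theta j q s htheta Hq Hs).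
  symmetry. now apply polygamma_nat.
Qed.
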